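(* Assume (SH), and suppose $H\in C^2(\mathbb{R}^n\times(\mathbb{R}^n\setminus\{0\}))$ and $\phi:\mathbb{R}^n\to\mathbb{R}$ is locally Lipschitz with $\partial^+\phi(z)\neq\emptyset$ for all $z\in\mathbb{R}^n$. Let $\overline{x}$ be an optimal solution for $\mathcal{P}(t_0,x_0)$ such that $\partial^+\phi(\overline{x}(T))\neq\{0\}$, and consider a dual arc $\overline{p}$ associated with $\overline{x}$ satisfying $-\overline{p}(T)\in\partial^+\phi(\overline{x}(T))\setminus\{0\}$. Suppose that $V(t_0,\cdot)$ is continuously differentiable on a neighborhood of $x_0$ and twice Fréchet differentiable at $x_0$. Assume in addition that $\phi$ is locally semiconcave. Then the solution $R$ of $$\dot R(t)+H_{px}[t]R(t)+R(t)H_{xp}[t]+R(t)H_{pp}[t]R(t)+H_{xx}[t]=0,\qquad R(t_0)=-\nabla^2_{xx}V(t_0,x_0),$$ is defined on the whole interval $[t_0,T]$, and for every $t\in[t_0,T]$ the function $V(t,\cdot)$ is twice Fréchet differentiable at $\overline{x}(t)$ with $R(t)=-\nabla^2_{xx}V(t,\overline{x}(t))$.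
   Context: Fix $T\in\mathbb{R}$, a multifunction $F:\mathbb{R}^n\rightrightarrows\mathbb{R}^n$ and $\phi:\mathbb{R}^n\to\mathbb{R}$. An arc is an absolutely continuous function on a compact interval. For $(t_0,x_0)\in(-\infty,T]\times\mathbb{R}^n$, the Mayer problem $\mathcal{P}(t_0,x_0)$ is to minimize $\phi(x(T))$ over all arcs $x:[t_0,T]\to\mathbb{R}^n$ with $\dot x(s)\in F(x(s))$ for a.e. $s\in[t_0,T]$ and $x(t_0)=x_0$; a minimizer is called an optimal solution for $\mathcal{P}(t_0,x_0)$. The value function $V:(-\infty,T]\times\mathbb{R}^n\to\mathbb{R}$ is the infimum $V(t_0,x_0)$ of this problem. The Hamiltonian is $H(x,p)=\sup_{v\in F(x)}\langle v,p\rangle$, $x,p\in\mathbb{R}^n$. (SH): (i) $F(x)$ is nonempty, convex, compact for each $x$; (ii) $F$ is locally Lipschitz, i.e. each $x$ has a neighborhood $K$ and a constant $c>0$ with $F(z)\subset F(y)+c|z-y|B(0,1)$ for all $z,y\in K$; (iii) there is $\gamma>0$ with $\max\{|v|:v\in F(x)\}\le\gamma(1+|x|)$ for all $x$. $B(x,\epsilon)$ is the closed ball. Fréchet sub/superdifferentials: $\partial^-f(x)=\{p:\liminf_{y\to x}\frac{f(y)-f(x)-\langle p,y-x\rangle}{|y-x|}\ge0\}$, $\partial^+f(x)=\{p:\limsup_{y\to x}\frac{f(y)-f(x)-\langle p,y-x\rangle}{|y-x|}\le0\}$. A dual arc associated with an optimal $\overline{x}$ is an arc $\overline{p}:[t_0,T]\to\mathbb{R}^n$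 with $\dot{\overline{x}}(s)\in\partial_p^-H(\overline{x}(s),\overline{p}(s))$, $-\dot{\overline{p}}(s)\in\partial_x^-H(\overline{x}(s),\overline{p}(s))$ for a.e. $s\in[t_0,T]$ and $-\overline{p}(T)\in\partial\phi(\overline{x}(T))$, where $\partial_x^-H,\partial_p^-H$ are the Fréchet subdifferentials of $H(\cdot,p)$, $H(x,\cdot)$ and $\partial\phi$ is the Clarke generalized gradient. (A dual arc vanishes either everywhere or nowhere on $[t_0,T]$.) $H_{px}[t]=\nabla^2_{px}H(\overline{x}(t),\overline{p}(t))$ and similarly for $H_{xp}[t],H_{pp}[t],H_{xx}[t]$; here $H_{xp}$ is the Jacobian in $x$ of $\nabla_pH$ and $H_{px}=H_{xp}^*$ is the Jacobian in $p$ of $\nabla_xH$. $\nabla^2_{xx}V(t,x)$ is the Hessian (second Fréchet derivative) of $V(t,\cdot)$ at $x$. A function $f$ is semiconcave on $\Omega$ if it is continuous and for some $c$, $f(x+h)+f(x-h)-2f(x)\le c|h|^2$ whenever $[x-h,x+h]\subset\Omega$; it is locally semiconcave if it is semiconcave on a neighborhood of each point. *)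

(* Defs.v *)
From HB Require Import structures.
From mathcomp Require Import all_boot all_order all_algebra.
From mathcomp Require Import all_classical all_reals all_analysis.

Set Implicit Arguments.
Unset Strict Implicit.
Unset Printing Implicit Defensive.

Import Order.TTheory GRing.Theory Num.Theory.
Import numFieldNormedType.Exports.

Local Open Scope classical_set_scope.
Local Open Scope ring_scope.

(* R^n is ['rV[R]_n]. The library norm on it is the sup norm, so the Euclidean
   norm is introduced separately; topology, differentiability, Lipschitz
   continuity and absolute continuity do not depend on this choice. *)
Definition dotv (R : realType) (n : nat) (u v : 'rV[R]_n) : R :=
  \sum_i u 0 i * v 0 i.

Definition enorm (R : realType) (n : nat) (u : 'rV[R]_n) : R :=
  Num.sqrt (dotv u u).

Definition eball (R : realType) (n : nat) (x : 'rV[R]_n) (e : R) :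
  set 'rV[R]_n := [set y | enorm (y - x) <= e].

Definition abs_continuous (R : realType) (V : normedModType R) (a b : R)
    (f : R -> V) : Prop :=
  forall e : R, 0 < e -> exists2 d : R, 0 < d &
    forall (m : nat) (u v : 'I_m -> R),
      (forall i, [/\ a <= u i, u i <= v i & v i <= b]) ->
      trivIset setT (fun i => [set` `]u i, v i[]) ->
      \sum_i (v i - u i) < d ->
      \sum_i `|f (v i) - f (u i)| < e.

Definition ae_on (R : realType) (a b : R) (P : R -> Prop) : Prop :=
  {ae @lebesgue_measure R, forall s, a <= s <= b -> P s}.

(* An arc on [t0, T] is a total function of which only the restriction to
   [t0, T] is constrained: the endpoints, where the two-sided derivative sees
   values outside the interval, form a null set. *)
Definition trajectory (R : realType) (n : nat) (T : R)
    (F : 'rV[R]_n -> set 'rV[R]_n) (t0 : R) (x0 : 'rV[R]_n)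
    (x : R -> 'rV[R]_n) : Prop :=
  [/\ abs_continuous t0 T x,
      ae_on t0 T (fun s => derivable x s 1 /\ F (x s) (derive1 x s)) &
      x t0 = x0].

Definition optimal (R : realType) (n : nat) (T : R)
    (F : 'rV[R]_n -> set 'rV[R]_n) (phi : 'rV[R]_n -> R) (t0 : R)
    (x0 : 'rV[R]_n) (x : R -> 'rV[R]_n) : Prop :=
  trajectory T F t0 x0 x /\
  forall y, trajectory T F t0 x0 y -> phi (x T) <= phi (y T).

(* Only meaningful for t <= T. The infimum is taken in R; under [SH] and for
   continuous phi the set is nonempty and bounded below. *)
Definition value (R : realType) (n : nat) (T : R)
    (F : 'rV[R]_n -> set 'rV[R]_n) (phi : 'rV[R]_n -> R) (t : R)
    (x : 'rV[R]_n) : R :=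
  inf [set phi (y T) | y in trajectory T F t x].

Definition hamiltonian (R : realType) (n : nat)
    (F : 'rV[R]_n -> set 'rV[R]_n) (x p : 'rV[R]_n) : R :=
  sup [set dotv v p | v in F x].

Definition SH (R : realType) (n : nat) (F : 'rV[R]_n -> set 'rV[R]_n) : Prop :=
  [/\ forall x, [/\ F x !=set0, convex_set (F x) & compact (F x)],
      forall x : 'rV[R]_n, exists2 K, nbhs x K &
        exists2 c : R, 0 < c &
          forall z y, K z -> K y ->
            F z `<=` [set w + (c * enorm (z - y)) *: b
                     | w in F y & b in eball 0 1] &
      exists2 gamma : R, 0 < gamma &
        forall x v : 'rV[R]_n, F x v -> enorm v <= gamma * (1 + enorm x)].

Definition subdiff (R : realType) (n : nat) (f : 'rV[R]_n -> R)
    (x : 'rV[R]_n) : set 'rV[R]_n :=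
  [set p | (0 <= limf_einf
     (fun y => ((f y - f x - dotv p (y - x)) / enorm (y - x))%:E) x^')%E].

Definition superdiff (R : realType) (n : nat) (f : 'rV[R]_n -> R)
    (x : 'rV[R]_n) : set 'rV[R]_n :=
  [set p | (limf_esup
     (fun y => ((f y - f x - dotv p (y - x)) / enorm (y - x))%:E) x^' <= 0)%E].

(* Clarke's generalized directional derivative: limsup of difference quotients
   as y -> x and h -> 0+. *)
Definition clarke_dir (R : realType) (n : nat) (f : 'rV[R]_n -> R)
    (x v : 'rV[R]_n) : \bar R :=
  limf_esup (fun yh : 'rV[R]_n * R =>
      ((f (yh.1 + yh.2 *: v) - f yh.1) / yh.2)%:E)
    (filter_prod (nbhs x) (at_right 0)).

Definition clarke_grad (R : realType) (n : nat) (f : 'rV[R]_n -> R)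
    (x : 'rV[R]_n) : set 'rV[R]_n :=
  [set p | forall v, ((dotv p v)%:E <= clarke_dir f x v)%E].

Definition dual_arc (R : realType) (n : nat) (T : R)
    (F : 'rV[R]_n -> set 'rV[R]_n) (phi : 'rV[R]_n -> R) (t0 : R)
    (x p : R -> 'rV[R]_n) : Prop :=
  let H := hamiltonian F in
  [/\ abs_continuous t0 T p,
      ae_on t0 T (fun s =>
        [/\ derivable x s 1, derivable p s 1,
            subdiff (fun q => H (x s) q) (p s) (derive1 x s) &
            subdiff (fun y => H y (p s)) (x s) (- derive1 p s)]) &
      clarke_grad phi (x T) (- p T)].

Definition locally_lipschitz (R : realType) (n : nat) (f : 'rV[R]_n -> R) :
  Prop := forall x : 'rV[R]_n, exists2 U, nbhs x U & [lipschitz f y | y in U].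

Definition semiconcave (R : realType) (n : nat) (f : 'rV[R]_n -> R)
    (Omega : set 'rV[R]_n) : Prop :=
  {within Omega, continuous f} /\
  exists c : R, forall x h : 'rV[R]_n,
    (forall s : R, -1 <= s <= 1 -> Omega (x + s *: h)) ->
    f (x + h) + f (x - h) - 2 * f x <= c * enorm h ^+ 2.

Definition locally_semiconcave (R : realType) (n : nat) (f : 'rV[R]_n -> R) :
  Prop := forall x : 'rV[R]_n, exists2 U, nbhs x U & semiconcave f U.

(* The spaces V used below are finite-dimensional, where continuity of every
   directional derivative is continuity of the differential. *)
Definition C1_on (R : realType) (V : normedModType R) (Omega : set V)
    (f : V -> R) : Prop :=
  forall z, Omega z ->
    differentiable f z /\ forall u, {for z, continuous ('D_u f)}.

Definition C2_on (R : realType) (V : normedModType R) (Omega : set V)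
    (f : V -> R) : Prop :=
  C1_on Omega f /\ forall u, C1_on Omega ('D_u f).

Definition grad (R : realType) (n : nat) (f : 'rV[R]_n -> R)
    (x : 'rV[R]_n) : 'rV[R]_n :=
  \row_i 'D_(delta_mx 0 i) f x.

(* The library's ['J] acts on row vectors from the right; its transpose is the
   usual Jacobian matrix, with entry (i, j) the j-th partial of the i-th
   component. *)
Definition jac (R : realType) (n : nat) (f : 'rV[R]_n -> 'rV[R]_n)
    (x : 'rV[R]_n) : 'M[R]_n := ('J f x)^T.

Definition hess (R : realType) (n : nat) (f : 'rV[R]_n -> R)
    (x : 'rV[R]_n) : 'M[R]_n := jac (grad f) x.

Definition twice_differentiable (R : realType) (n : nat) (f : 'rV[R]_n -> R)
    (x : 'rV[R]_n) : Prop :=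
  (\forall y \near x, differentiable f y) /\ differentiable (grad f) x.

Definition Hxx (R : realType) (n : nat) (H : 'rV[R]_n -> 'rV[R]_n -> R)
  (x p : 'rV[R]_n) : 'M[R]_n := jac (fun y => grad (fun z => H z p) y) x.

Definition Hpp (R : realType) (n : nat) (H : 'rV[R]_n -> 'rV[R]_n -> R)
  (x p : 'rV[R]_n) : 'M[R]_n := jac (fun q => grad (fun r => H x r) q) p.

Definition Hxp (R : realType) (n : nat) (H : 'rV[R]_n -> 'rV[R]_n -> R)
  (x p : 'rV[R]_n) : 'M[R]_n := jac (fun y => grad (fun q => H y q) p) x.

Definition Hpx (R : realType) (n : nat) (H : 'rV[R]_n -> 'rV[R]_n -> R)
  (x p : 'rV[R]_n) : 'M[R]_n := jac (fun q => grad (fun y => H y q) x) p.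

(* Classical solution on [t0, T]. Along the arcs considered the coefficients
   are continuous on [t0, T], so continuity of Q up to the endpoints together
   with the equation in the interior amounts to the equation on [t0, T] with
   one-sided derivatives at the endpoints. *)
Definition riccati_solution (R : realType) (n : nat) (t0 T : R)
    (H : 'rV[R]_n -> 'rV[R]_n -> R) (x p : R -> 'rV[R]_n) (Q0 : 'M[R]_n)
    (Q : R -> 'M[R]_n) : Prop :=
  [/\ {within `[t0, T], continuous Q},
      forall t, t0 < t < T ->
        derivable Q t 1 /\
        derive1 Q t + Hpx H (x t) (p t) *m Q t + Q t *m Hxp H (x t) (p t)
          + Q t *m Hpp H (x t) (p t) *m Q t + Hxx H (x t) (p t) = 0 &
      Q t0 = Q0].

(* Main.v *)
Require Import Defs.
From HB Require Import structures.
From mathcomp Require Import all_boot all_order all_algebra.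
From mathcomp Require Import all_classical all_reals all_analysis.
From mathcomp Require Import ring lra.

(** The proof is the method of characteristics.  Let [E x] be the solution [(X, P)]
    of the Hamiltonian system that starts at time [t0] from
    [(x, - grad (V t0) x)].  If every [E x] with [x] near [x0] is optimal, the value
    is constant along it and [grad (V t)] equals [- P] at its position [X]; if moreover
    [x |-> X] is a homeomorphism near [x0] at time [t], with invertible derivative
    [A], and if [B] is the derivative of [x |-> P], then [V t] is twice
    differentiable at [xb t] with Hessian [- (A^-1 B)^T].  As [(A, B)] solves
    the linearised Hamiltonian system, [(A^-1 B)^T] solves the Riccati equation, and
    it exists as long as [A] is invertible.  What has to be proved is thus the
    optimality of the extremals, the invertibility of [A] up to time [T] (absence
    of conjugate points), and that the extremals cover a neighbourhood of [xb t].

    Everything rests on one estimate.  Since [H] is [C^2] away from [p = 0], the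
    set [F y] is curved at the velocity [u] that maximizes the pairing with the
    costate: [|v - u|^2 <= C <p, u - v>] for [v] in [F y] ([flow_tube]).  An arc
    [y] close to an extremal therefore pays for its deviation [w = y - X] by a
    growth of [- <P, w>], and conversely [deviation_estimate] bounds [w] on the whole
    interval, linearly in a parameter [sigma], as soon as [- <P, w>] is at most
    [kappa] up to a quadratic error, starts above [kappa - sigma^2], and [w] starts
    no larger than [sigma].  The upper bound on [- <P, w>] is supplied by optimality: from any point of [y] the feedback
    [u] of the tube around the extremal steers back to the end where a quadratic
    bound on the value is known ([forward_close], [backward_close]).

    Optimality.  At a point where [V t0] has a quadratic minorant, near-optimal arcs
    are near the extremal, which is then optimal ([minorant_optimal]); such points
    are dense ([quadratic_minorant_dense]), and optimality passes to the limit
    ([extremal_optimal]).  The subgradient of the value propagates forward to the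
    final cost, meets there the assumed supergradient, and the resulting gradient
    propagates back ([value_has_grad]).

    No conjugate points.  Semiconcavity of the cost with its supergradient at
    [xb T] yields a quadratic upper bound for [V t] at [xb t]
    ([semiconcave_quadratic], [value_upper_quad]); the second derivative of [V t0] at
    [x0] yields a lower one.  In reversed time the deviation estimate then
    gives [|x - x0| <= K |X - xb t|] ([extremal_separation]), so [A] is
    injective.

    Covering.  For [z] near [xb t] consider the points [x] that can be steered to
    [z] and maximize [V t0 y - k |x - y|^2].  At a maximum [2 k (x - y)] is the
    costate [- grad (V t0) y], and the arc from [x] to [z] is the extremal with this
    costate; letting [k] grow, an extremal of the family ends at [z]
    ([sup_convolution], [extremal_covering]).

    Two further points: a dual arc never vanishes and is a classical solution of the
    Hamiltonian system ([dual_arc_regular]), and any solution of the Riccati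
    equation is [(A^-1 B)^T], because [B - A Q^T] solves a linear equation
    ([riccati_unique]). *)

Set Implicit Arguments.
Unset Strict Implicit.
Unset Printing Implicit Defensive.

Import Order.TTheory GRing.Theory Num.Theory.
Import numFieldNormedType.Exports.

Local Open Scope classical_set_scope.
Local Open Scope ring_scope.

(** * Monotonicity of absolutely continuous functions *)

(** The supremum of the points reached by [Q] belongs to them and is [b]: a step
    crosses [s] from any point slightly before it to any point slightly after. *)
Lemma real_induction (R : realType) (a b : R) (Q : R -> Prop) :
  a <= b -> Q a ->
  (forall s, a <= s <= b -> exists2 r : R, 0 < r &
    forall u v, a <= u -> u <= s -> s <= v -> v <= b ->
      s - r < u -> v < s + r -> Q u -> Q v) -> Q b.
Proof.
move=> ab Qa step.
pose S := [set x | a <= x <= b /\ Q x].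
have Sa : S a by split; [rewrite lexx ab|].
have ubS : ubound S b by move=> x [/andP[_ ->]].
have hS : has_sup S by split; [exists a|exists b].
set s := sup S.
have as_ : a <= s by apply: sup_upper_bound.
have sb : s <= b by apply: sup_le_ub => //; exists a.
have [|r r0 H] := step s; first by rewrite as_ sb.
have [u [uab Qu] su] := sup_adherent r0 hS.
have us : u <= s by apply: sup_upper_bound.
have [au ub] := andP uab.
have Qs : Q s by apply: (H u s) => //; rewrite -?ltrBlDl ?subrr // /s; lra.
move: sb; rewrite le_eqVlt => /orP[/eqP <- //|sb].
pose v := Num.min b (s + r / 2).
have vb : v <= b by rewrite /v ge_min lexx.
have sv : s < v by rewrite /v lt_min sb; lra.
have vr : v < s + r by rewrite /v gt_min; apply/orP; right; lra.
have Qv : Q v by apply: (H s v) => //; lra.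
have : v <= s by apply: sup_upper_bound => //; split => //; lra.
by rewrite leNgt sv.
Qed.

Section ac_monotone.
Variable R : realType.
Local Notation mu := (@lebesgue_measure R).

(** Intervals listed from right to left, contained in [O] and in [a, x], with
    disjoint interiors: the pieces of [a, x] where the derivative gives no
    information. *)
Fixpoint chain (O : set R) (a x : R) (l : seq (R * R)) : Prop :=
  if l is p :: l' then
    [/\ p.1 <= p.2, p.2 <= x, `[p.1, p.2] `<=` O & chain O a p.1 l']
  else a <= x.

Lemma chain_le (O : set R) a x y l : x <= y -> chain O a x l -> chain O a y l.
Proof.
case: l => [|p l] xy /=; first by move=> /le_trans; apply.
by move=> [? px ? ?]; split => //; exact: le_trans xy.
Qed.

Lemma chain_ge (O : set R) a x l : chain O a x l -> a <= x.
Proof.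
elim: l x => [//|p l ih] x /= [p12 px _ /ih ap].
by rewrite (le_trans ap) // (le_trans p12).
Qed.

Lemma chain_nth (O : set R) a x l p0 i : chain O a x l -> (i < size l)%N ->
  [/\ a <= (nth p0 l i).1, (nth p0 l i).1 <= (nth p0 l i).2,
    (nth p0 l i).2 <= x &
    forall j, (i < j)%N -> (j < size l)%N -> (nth p0 l j).2 <= (nth p0 l i).1].
Proof.
elim: l x i => [//|p l ih] x [|i] /= [p12 px _ cl] il; split => //.
- exact: chain_ge cl.
- move=> [//|j] _ jl /=; by have [] := ih _ j cl jl.
- by have [] := ih _ i cl il.
- by have [] := ih _ i cl il.
- have [_ _ h _] := ih _ i cl il; rewrite (le_trans h) // (le_trans p12) //.
- move=> [//|j] ij jl /=; have [_ _ _ h] := ih _ i cl il; exact: h.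
Qed.

Lemma chain_measure (O : set R) a x l : open O -> chain O a x l ->
  ((\sum_(p <- l) (p.2 - p.1))%:E <= mu (O `&` `]-oo, x]))%E.
Proof.
move=> oO; elim: l x => [|p l ih] x /= cl.
  by rewrite big_nil measure_ge0.
have [p12 px pO {}cl] := cl.
rewrite big_cons EFinD.
have mO : measurable (O : set (measurableTypeR R)) by exact: measurable_realfun.open_measurable.
have -> : ((p.2 - p.1)%:E = mu `]p.1, p.2])%E.
  rewrite lebesgue_measure_itv /= lte_fin.
  case: ltP => // p21; congr EFin; apply/eqP.
  by rewrite subr_eq0 eq_le p12 p21.
apply: (@le_trans _ _ (mu `]p.1, p.2] + mu (O `&` `]-oo, p.1]))%E).
  by rewrite leeD2l // ih.
rewrite -measureU //; last 2 first.
- by apply: measurableI.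
- rewrite -subset0 => z /= []; rewrite !in_itv /= => /andP[pz _] [_ zp].
  by move: pz; rewrite ltNge zp.
rewrite le_measure ?inE //.
- by apply: measurableU => //; apply: measurableI.
- by apply: measurableI.
- move=> z /= []; rewrite !in_itv /=.
    move=> /andP[pz zp]; split; last by rewrite (le_trans zp).
    by apply: pO; rewrite /= in_itv /= (ltW pz).
  by move=> [Oz zp]; split => //; rewrite (le_trans zp) // (le_trans p12).
Qed.

(** The total length of the chain is at most the measure of [O], so absolute
    continuity bounds the growth over it. *)
Lemma chain_ac (O : set R) (a b : R) (f : R -> R) (e d : R) l :
  open O -> (mu O < d%:E)%E -> chain O a b l ->
  (forall (m : nat) (u v : 'I_m -> R),
      (forall i, [/\ a <= u i, u i <= v i & v i <= b]) ->
      trivIset setT (fun i => [set` `]u i, v i[]) ->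
      \sum_i (v i - u i) < d ->
      \sum_i `|f (v i) - f (u i)| < e) ->
  \sum_(p <- l) (f p.2 - f p.1) < e.
Proof.
move=> oO muO cl acf; pose p0 : R * R := (0, 0).
have := acf (size l) (fun i => (nth p0 l i).1) (fun i => (nth p0 l i).2).
rewrite -(big_mkord xpredT (fun i => (nth p0 l i).2 - (nth p0 l i).1)).
rewrite -(big_mkord xpredT (fun i => `|f (nth p0 l i).2 - f (nth p0 l i).1|)).
rewrite -(big_nth p0 xpredT (fun p => p.2 - p.1)).
rewrite -(big_nth p0 xpredT (fun p => `|f p.2 - f p.1|)) => H.
apply: le_lt_trans (H _ _ _).
- by apply: ler_sum => p _; rewrite ler_norm.
- by move=> i; have [] := chain_nth p0 cl (ltn_ord i).
- apply/trivIsetP => i j _ _ ij; rewrite -subset0 => z /= [].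
  rewrite !in_itv /= => /andP[zi1 zi2] /andP[zj1 zj2].
  have [_ _ _ hi] := chain_nth p0 cl (ltn_ord i).
  have [_ _ _ hj] := chain_nth p0 cl (ltn_ord j).
  have : (i < j)%N || (j < i)%N by rewrite -neq_ltn.
  case/orP => h.
    have := hi _ h (ltn_ord j); lra.
  have := hj _ h (ltn_ord i); lra.
- rewrite -lte_fin; apply: le_lt_trans muO.
  apply: (le_trans (chain_measure oO cl)).
  have mO : measurable (O : set (measurableTypeR R)) by exact: measurable_realfun.open_measurable.
  by rewrite le_measure ?inE //; exact: measurableI.
Qed.

Lemma is_derive_dist (f : R -> R) (s l e : R) : is_derive s 1 f l -> 0 < e ->
  exists2 r, 0 < r & forall h, `|h| < r ->
    `|f (s + h) - f s - l * h| <= e * `|h|.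
Proof.
move=> [df <-] e0.
have := df; rewrite /derivable => /cvg_ex[l' hl'].
have El : 'D_1 f s = l' by apply/cvg_lim.
rewrite El; move/cvgrPdist_le : hl' => /(_ e e0).
rewrite /nbhs /= /dnbhs /within /= => -[r /= r0 hr].
exists r => // h hr'.
have [->|h0] := eqVneq h 0.
  by rewrite addr0 subrr mulr0 subrr normr0 mulr0.
have := hr h; rewrite /ball_ /= sub0r normrN => /(_ hr' h0).
rewrite scaler1 [h + s]addrC => H.
have -> : f (s + h) - f s - l' * h = - h * (l' - h^-1 * (f (s + h) - f s)).
  by field.
by rewrite normrM normrN mulrC ler_wpM2r.
Qed.

(** Real induction on the growth being at most [e] per unit of time, up to a chain of
    exceptional intervals.  Where the derivative is nonpositive this persists; a
    point of the exceptional null set is crossed by one interval inside an open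
    neighbourhood of that set, chosen so small that the growth over the whole chain
    stays below [e]. *)
Lemma abs_continuous_nonincreasing (a b : R) (f : R -> R) : a <= b ->
  abs_continuous a b f ->
  ae_on a b (fun s => derivable f s 1 /\ derive1 f s <= 0) -> f b <= f a.
Proof.
move=> ab acf [N [mN N0 NP]].
suff H e : 0 < e -> f b <= f a + e * (b - a) + e.
  apply/ler_addgt0Pr => e e0.
  have c0 : 0 < b - a + 1 by lra.
  have := H (e / (b - a + 1)); rewrite divr_gt0 // => /(_ isT).
  rewrite -addrA -[X in _ + X]/(_ * _ + _).
  by rewrite -[X in _ * _ + X]mulr1 -mulrDr divfK ?gt_eqF.
move=> e0; have [d d0 hd] := acf _ e0.
have [|U [oU NU muU]] := lebesgue_regularity_outer mN _ d0.
  by rewrite [X in (X < _)%E]N0 ltry.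
have {}muU : (mu U < d%:E)%E.
  have mU : measurable (U : set (measurableTypeR R)) by exact: measurable_realfun.open_measurable.
  have -> : mu U = (mu (U `\` N) + mu (U `&` N))%E.
    by rewrite [LHS](@measureDI _ _ _ mu U N).
  have -> : U `&` N = N by apply/setIidPr.
  by rewrite [X in (_ + X)%E]N0 adde0.
(* The growth up to [x] is at most [e] per unit of time, apart from a chain. *)
pose Q x := exists2 l, chain U a x l &
  f x - f a <= e * (x - a) + \sum_(p <- l) (f p.2 - f p.1).
suff [l cl hl] : Q b.
  have := chain_ac oU muU cl hd; lra.
apply: (real_induction ab).
  by exists [::] => //=; rewrite big_nil; lra.
move=> s sab.
have [Ns|nNs] := pselect (N s).
  have /= := oU s (NU _ Ns); rewrite /interior /= => -[r /= r0 hr].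
  exists r => // u v au us sv vb sr vr [l cl hl].
  exists ((u, v) :: l) => /=.
    split => //; first exact: le_trans sv.
    move=> z /=; rewrite in_itv /= => /andP[uz zv].
    by apply: hr; rewrite /ball /= ltr_distl; apply/andP; split; lra.
  rewrite big_cons /=.
  have : e * (u - a) <= e * (v - a) by rewrite ler_wpM2l //; lra.
  by lra.
have [dfs f's] : derivable f s 1 /\ derive1 f s <= 0.
  by apply: contrapT => h; apply: nNs; apply: NP => /(_ sab).
have ids : is_derive s 1 f (derive1 f s).
  by rewrite derive1E; exact: derivableP.
have [r r0 hr] := is_derive_dist ids e0.
exists r => // u v au us sv vb sr vr [l cl hl].
exists l; first by apply: chain_le cl; exact: le_trans sv.
have hv : f v - f s <= e * (v - s).
  have vs : v - s < r by lra.
  have := hr (v - s); rewrite ger0_norm ?subr_ge0 // => /(_ vs).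
  rewrite [s + _]addrC subrK => /(le_trans (ler_norm _)).
  have : derive1 f s * (v - s) <= 0 by rewrite mulr_le0_ge0 ?subr_ge0.
  lra.
have hu : f s - f u <= e * (s - u).
  have vs : - (u - s) < r by lra.
  have := hr (u - s); rewrite ler0_norm ?subr_le0 // => /(_ vs).
  rewrite [s + _]addrC subrK ler_norml => /andP[h _].
  have : 0 <= derive1 f s * (u - s) by rewrite mulr_le0 ?subr_le0.
  lra.
have -> : e * (v - a) = e * (v - s) + e * (s - u) + e * (u - a) by ring.
by lra.
Qed.

End ac_monotone.

(** * Vectors, and almost every time in an interval *)
Section vectors.
Variables (R : realType) (n : nat).
Implicit Types u v w : 'rV[R]_n.

Lemma norm_coord_le u i : `|u 0 i| <= `|u|.
Proof.
rewrite [leRHS]/Num.Def.normr /= mx_normrE.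
exact: (le_bigmax _ (fun i => `|u i.1 i.2|) (0, i)).
Qed.

Lemma norm_coordP u (c : R) : 0 <= c -> (forall i, `|u 0 i| <= c) -> `|u| <= c.
Proof.
move=> c0 h; rewrite [leLHS]/Num.Def.normr /= mx_normrE.
by rewrite (bigmax_le _ c0) // => -[i j] _ /=; rewrite [i]ord1.
Qed.

Lemma dotvC u v : dotv u v = dotv v u.
Proof. by apply: eq_bigr => i _; rewrite mulrC. Qed.

Lemma dotvDl u v w : dotv (u + v) w = dotv u w + dotv v w.
Proof. by rewrite -big_split; apply: eq_bigr => i _; rewrite !mxE mulrDl. Qed.

Lemma dotvDr u v w : dotv u (v + w) = dotv u v + dotv u w.
Proof. by rewrite dotvC dotvDl !(dotvC u). Qed.

Lemma dotvZl (c : R) u v : dotv (c *: u) v = c * dotv u v.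
Proof. by rewrite mulr_sumr; apply: eq_bigr => i _; rewrite !mxE mulrA. Qed.

Lemma dotvZr (c : R) u v : dotv u (c *: v) = c * dotv u v.
Proof. by rewrite dotvC dotvZl dotvC. Qed.

Lemma dotvNl u v : dotv (- u) v = - dotv u v.
Proof. by rewrite -scaleN1r dotvZl mulN1r. Qed.

Lemma dotvNr u v : dotv u (- v) = - dotv u v.
Proof. by rewrite dotvC dotvNl dotvC. Qed.

Lemma dotvBl u v w : dotv (u - v) w = dotv u w - dotv v w.
Proof. by rewrite dotvDl dotvNl. Qed.

Lemma dotvBr u v w : dotv u (v - w) = dotv u v - dotv u w.
Proof. by rewrite dotvDr dotvNr. Qed.

Lemma dotv0r u : dotv u 0 = 0.
Proof. by rewrite -(scale0r 0) dotvZr mul0r. Qed.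

Lemma dotv0l u : dotv 0 u = 0.
Proof. by rewrite dotvC dotv0r. Qed.

Lemma dotv_delta u i : dotv u (delta_mx 0 i) = u 0 i.
Proof.
rewrite /dotv (bigD1 i) //= mxE !eqxx mulr1 big1 ?addr0 // => j ji.
by rewrite mxE eqxx (negbTE ji) mulr0.
Qed.

Lemma dotv_abs_le u v : `|dotv u v| <= n%:R * `|u| * `|v|.
Proof.
apply: le_trans (ler_norm_sum _ _ _) _.
apply: (@le_trans _ _ (\sum_(i < n) `|u| * `|v|)).
  by apply: ler_sum => i _; rewrite normrM ler_pM // norm_coord_le.
by rewrite sumr_const card_ord -mulrA mulr_natl.
Qed.

Lemma dotv_ge0 u : 0 <= dotv u u.
Proof. by apply: sumr_ge0 => i _; rewrite -expr2 sqr_ge0. Qed.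

Lemma coord_sqr_le u i : u 0 i ^+ 2 <= dotv u u.
Proof.
rewrite /dotv (bigD1 i) //= -expr2 lerDl; apply: sumr_ge0 => j _.
by rewrite -expr2 sqr_ge0.
Qed.

Lemma norm_sqr_le u : `|u| ^+ 2 <= dotv u u.
Proof.
rewrite -[leRHS]sqr_sqrtr ?dotv_ge0 // lerXn2r ?nnegrE ?sqrtr_ge0 //.
apply: norm_coordP; rewrite ?sqrtr_ge0 // => i.
by rewrite -sqrtr_sqr ler_sqrt ?dotv_ge0 ?coord_sqr_le.
Qed.

Lemma dotv_sqr_le u : dotv u u <= n%:R * `|u| ^+ 2.
Proof. by have := dotv_abs_le u u; rewrite ger0_norm ?dotv_ge0 // -mulrA. Qed.

Lemma enorm_ge0 u : 0 <= enorm u. Proof. exact: sqrtr_ge0. Qed.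

Lemma enorm_sqr u : enorm u ^+ 2 = dotv u u.
Proof. by rewrite sqr_sqrtr ?dotv_ge0. Qed.

Lemma norm_le_enorm u : `|u| <= enorm u.
Proof.
rewrite -(@ler_pXn2r R 2) ?nnegrE ?enorm_ge0 //.
by rewrite enorm_sqr norm_sqr_le.
Qed.

Lemma enorm_le u : enorm u <= n%:R * `|u|.
Proof.
rewrite -(@ler_pXn2r R 2) ?nnegrE ?enorm_ge0 ?mulr_ge0 //.
rewrite enorm_sqr exprMn; apply: (le_trans (dotv_sqr_le u)).
rewrite ler_wpM2r ?sqr_ge0 //; case: n => [|k]; first by rewrite expr0n.
by rewrite ler_eXnr // ler1n.
Qed.

Lemma enorm0_eq u : enorm u = 0 -> u = 0.
Proof.
by move=> h; apply/eqP; rewrite -normr_eq0 eq_le normr_ge0 -h norm_le_enorm.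
Qed.

End vectors.

Section ae_interval.
Variable R : realType.
Implicit Types (a b : R) (P Q : R -> Prop).
Local Notation mu := (@lebesgue_measure R).

Local Instance ae_lebesgue_filter :
  Filter (nbhs (almost_everywhere (@lebesgue_measure R))).
Proof. exact: ae_filter_ringOfSetsType. Qed.

Lemma ae_on_all a b P : (forall s, a <= s <= b -> P s) -> ae_on a b P.
Proof. by move=> h; apply: aeW => s; exact: h. Qed.

Lemma ae_on_imp a b P Q : (forall s, a <= s <= b -> P s -> Q s) ->
  ae_on a b P -> ae_on a b Q.
Proof.
move=> h; rewrite /ae_on; apply: filterS => s Ps ab; exact: h (Ps ab).
Qed.

Lemma ae_on_sub a b a' b' P : a <= a' -> b' <= b -> ae_on a b P ->
  ae_on a' b' P.
Proof.
move=> aa bb; rewrite /ae_on; apply: filterS => s h /andP[h1 h2]; apply: h.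
by rewrite (le_trans aa h1) (le_trans h2 bb).
Qed.

Lemma ae_neq (c : R) : {ae mu, forall s, s != c}.
Proof.
exists [set c]; split; [exact: measurable_set1|exact: lebesgue_measure_set1|].
by move=> s /= /negP; rewrite negbK => /eqP.
Qed.

Lemma ae_on_oo a b P : ae_on a b (fun s => a < s < b -> P s) -> ae_on a b P.
Proof.
move=> h; move: h (ae_neq a) (ae_neq b).
rewrite /ae_on; apply: filterS3 => s h1 sa sb /andP[as_ sb'].
by apply: h1; rewrite ?as_ ?sb' // !lt_neqAle as_ sb' sb eq_sym sa.
Qed.

Lemma ae_on_cat a b c P : ae_on a b P -> ae_on b c P -> ae_on a c P.
Proof.
rewrite /ae_on; apply: filterS2 => s h1 h2 /andP[as_ sc].
by have [sb|bs] := leP s b; [apply: h1|apply: h2]; rewrite ?as_ ?sb // ltW.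
Qed.

Lemma lebesgue_measure_reflect (c : R) (A : set R) :
  measurable (A : set (measurableTypeR R)) ->
  pushforward mu ((fun s => c - s) : _ -> measurableTypeR R) A = mu A.
Proof.
have mf : measurable_fun setT ((fun s => c - s) : measurableTypeR R -> _).
  apply: measurable_realfun.continuous_measurable_fun => s; apply: cvgB; [exact: cvg_cst|exact: cvg_id].
move=> mA; apply/esym/lebesgue_measure_unique => //= _ [[x y]] _ <-.
rewrite /pushforward /=.
have -> : (fun s => c - s) @^-1` `]x, y]%classic = `[c - y, c - x[%classic.
  apply/seteqP; split => t /=; rewrite !in_itv /= => /andP[? ?];
  by apply/andP; split; lra.
rewrite !lebesgue_measure_itv /= !lte_fin ltrD2l ltrN2 -!EFinD.
by case: ifP => // _; congr EFin; ring.
Qed.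

(** Reversing time preserves null sets, so statements about the right end of an
    interval follow from those about its left end. *)
Lemma ae_on_rev a b P : ae_on a b P -> ae_on a b (fun s => P (a + b - s)).
Proof.
move=> [N [mN N0 NP]].
have mf : measurable_fun setT ((fun s => a + b - s) : R -> R).
  apply: measurable_realfun.continuous_measurable_fun => s; apply: cvgB; [exact: cvg_cst|exact: cvg_id].
exists ((fun s => a + b - s) @^-1` N); split.
- by rewrite -[X in measurable X]setTI; exact: mf.
- by have := lebesgue_measure_reflect (a + b) mN; rewrite /pushforward => ->.
- move=> s /= h; apply: NP => /= h'; apply: h => /andP[as_ sb]; apply: h'.
  by apply/andP; split; lra.
Qed.

End ae_interval.

(** * Lipschitz functions of time *)

(** Real induction for a property that passes to limits from the left and
    extends slightly to the right. *)
Lemma continuous_induction (R : realType) (a b : R) (Q : R -> Prop) :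
  Q a ->
  (forall s, a < s -> s <= b -> (forall u, a <= u -> u < s -> Q u) -> Q s) ->
  (forall s, a <= s -> s < b -> (forall u, a <= u -> u <= s -> Q u) ->
    exists2 r : R, 0 < r & forall v, s < v -> v < s + r -> v <= b -> Q v) ->
  forall s, a <= s <= b -> Q s.
Proof.
move=> Qa lft rgt s0 /andP[as0 sb0].
have ab : a <= b by exact: le_trans sb0.
pose S := [set x | a <= x <= b /\ forall u, a <= u -> u <= x -> Q u].
have Sa : S a.
  split; first by rewrite lexx ab.
  by move=> u au ua; have -> : u = a by apply/eqP; rewrite eq_le ua au.
have ubS : ubound S b by move=> x [/andP[_ ->]].
have hS : has_sup S by split; [exists a|exists b].
set s := sup S.
have as_ : a <= s by apply: sup_upper_bound.
have sb : s <= b by apply: sup_le_ub => //; exists a.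
have Qlt u : a <= u -> u < s -> Q u.
  move=> au us; have e0 : 0 < s - u by rewrite subr_gt0.
  have [x [_ hx] sx] := sup_adherent e0 hS.
  by apply: hx => //; rewrite -/s in sx; lra.
have Qs : Q s.
  move: as_; rewrite le_eqVlt => /orP[/eqP <- //|as_].
  exact: lft.
have Qle u : a <= u -> u <= s -> Q u.
  by move=> au; rewrite le_eqVlt => /orP[/eqP -> //|]; exact: Qlt.
move: sb; rewrite le_eqVlt => /orP[/eqP sb|sb].
  by apply: Qle => //; rewrite sb.
have [r r0 hr] := rgt s as_ sb Qle.
pose v := Num.min b (s + r / 2).
have vb : v <= b by rewrite /v ge_min lexx.
have sv : s < v by rewrite /v lt_min sb; lra.
have vr : v < s + r by rewrite /v gt_min; apply/orP; right; lra.
have : v <= s.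
  apply: sup_upper_bound => //; split; first by rewrite vb; lra.
  move=> u au uv; have [us|su] := leP u s; first exact: Qle.
  by apply: hr => //; lra.
by rewrite leNgt sv.
Qed.

Section lipschitz_interval.
Variable R : realType.
Implicit Types (a b L : R).

Definition lip_on (V : normedModType R) a b L (f : R -> V) : Prop :=
  forall s t, a <= s <= b -> a <= t <= b -> `|f s - f t| <= L * `|s - t|.

Definition lip (V : normedModType R) a b (f : R -> V) : Prop :=
  exists L, lip_on a b L f.

Lemma lip_pos (V : normedModType R) a b (f : R -> V) : lip a b f ->
  exists2 L, 0 < L & lip_on a b L f.
Proof.
move=> [L h]; exists (`|L| + 1); first by rewrite ltr_wpDl.
move=> s t sab tab; apply: le_trans (h s t sab tab) _.
rewrite ler_wpM2r //; have := ler_norm L; lra.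
Qed.

Lemma lip_sub (V : normedModType R) a b a' b' (f : R -> V) :
  a <= a' -> b' <= b -> lip a b f -> lip a' b' f.
Proof.
move=> aa bb [L h]; exists L => s t /andP[? ?] /andP[? ?].
by apply: h; apply/andP; split; lra.
Qed.

Lemma lip_bounded (V : normedModType R) a b (f : R -> V) : lip a b f ->
  exists2 M, 0 < M & forall s, a <= s <= b -> `|f s| <= M.
Proof.
move=> /lip_pos[L L0 h].
have [ab|ba] := leP a b; last by exists 1 => // s /andP[? ?]; exfalso; lra.
exists (`|f a| + L * (b - a) + 1).
  have : 0 <= L * (b - a) by apply: mulr_ge0; [exact: ltW|rewrite subr_ge0].
  have := normr_ge0 (f a); lra.
move=> s sab; have := h s a sab; rewrite lexx ab => /(_ isT) h1.
have : `|f s| <= `|f s - f a| + `|f a| by rewrite -{1}(subrK (f a) (f s)) ler_normD.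
have : L * `|s - a| <= L * (b - a).
  rewrite ler_wpM2l //; first exact: ltW.
  by rewrite ger0_norm; lra.
lra.
Qed.

Lemma lip_cst (V : normedModType R) a b (c : V) : lip a b (fun _ => c).
Proof. by exists 0 => s t _ _; rewrite subrr normr0 mul0r. Qed.

Lemma lipD (V : normedModType R) a b (f g : R -> V) :
  lip a b f -> lip a b g -> lip a b (fun s => f s + g s).
Proof.
move=> [L h] [M k]; exists (L + M) => s t sab tab.
rewrite opprD addrACA mulrDl; apply: le_trans (ler_normD _ _) _.
by rewrite lerD ?h ?k.
Qed.

Lemma lipN (V : normedModType R) a b (f : R -> V) :
  lip a b f -> lip a b (fun s => - f s).
Proof.
by move=> [L h]; exists L => s t sab tab; rewrite -opprD normrN h.
Qed.

Lemma lipB (V : normedModType R) a b (f g : R -> V) :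
  lip a b f -> lip a b g -> lip a b (fun s => f s - g s).
Proof. by move=> lf lg; apply: lipD => //; exact: lipN. Qed.

Lemma lipM a b (f g : R -> R) :
  lip a b f -> lip a b g -> lip a b (fun s => f s * g s).
Proof.
move=> lf lg; have [M M0 bf] := lip_bounded lf; have [N N0 bg] := lip_bounded lg.
have [L L0 h] := lip_pos lf; have [K K0 k] := lip_pos lg.
exists (M * K + N * L) => s t sab tab.
have -> : f s * g s - f t * g t = f s * (g s - g t) + g t * (f s - f t) by ring.
apply: le_trans (ler_normD _ _) _; rewrite !normrM mulrDl -!mulrA.
by apply: lerD; apply: ler_pM => //; [exact: bf|exact: k|exact: bg|exact: h].
Qed.

Lemma lip_coord n a b (y : R -> 'rV[R]_n) i :
  lip a b y -> lip a b (fun s => y s 0 i).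
Proof.
move=> [L h]; exists L => s t sab tab.
apply: le_trans (h s t sab tab).
by have := norm_coord_le (y s - y t) i; rewrite !mxE.
Qed.

Lemma lip_vec n a b (y : R -> 'rV[R]_n) :
  (forall i, lip a b (fun s => y s 0 i)) -> lip a b y.
Proof.
move=> h; have /choice[L hL] : forall i, exists L, 0 < L /\
    lip_on a b L (fun s => y s 0 i).
  by move=> i; have [L ? ?] := lip_pos (h i); exists L.
exists (\sum_i L i) => s t sab tab; apply: norm_coordP.
  by rewrite mulr_ge0 // sumr_ge0 // => i _; rewrite ltW //; have [] := hL i.
move=> i; rewrite !mxE; have [L0 hi] := hL i.
apply: le_trans (hi s t sab tab) _; rewrite ler_wpM2r //.
rewrite (bigD1 i) //= lerDl sumr_ge0 // => j _.
by rewrite ltW //; have [] := hL j.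
Qed.

Lemma lip_dotv n a b (y z : R -> 'rV[R]_n) :
  lip a b y -> lip a b z -> lip a b (fun s => dotv (y s) (z s)).
Proof.
move=> ly lz; rewrite /dotv.
have : forall i, lip a b (fun s => y s 0 i * z s 0 i).
  by move=> i; apply: lipM; exact: lip_coord.
move=> h; elim: (index_enum _) => [|i r ih].
  by under [fun s => _]eq_fun do rewrite big_nil; exact: lip_cst.
by under [fun s => _]eq_fun do rewrite big_cons; exact: lipD.
Qed.

Lemma lip_of_derive a b (f df : R -> R) (M : R) :
  (forall s, a <= s <= b -> is_derive s 1 f (df s)) ->
  (forall s, a <= s <= b -> `|df s| <= M) -> lip_on a b M f.
Proof.
move=> hf hM.
have H s t : a <= s -> s <= t -> t <= b -> `|f t - f s| <= M * `|t - s|.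
  move=> as_ st tb; have [|||c cst ->] := @MVT_segment R f df s t.
  - by [].
  - move=> x; rewrite in_itv /= => /andP[sx xt].
    by apply: hf; apply/andP; split; lra.
  - apply: derivable_within_continuous => x; rewrite in_itv /= => /andP[sx xt].
    have [|//] := hf x; apply/andP; split; lra.
  rewrite normrM ler_wpM2r //; apply: hM.
  by move: cst; rewrite in_itv /= => /andP[? ?]; apply/andP; split; lra.
move=> s t /andP[as_ sb] /andP[at_ tb].
have [st|/ltW ts] := leP s t; last exact: H.
by rewrite distrC [`|s - t|]distrC; exact: H.
Qed.

Lemma abs_continuous_sub (V : normedModType R) a b a' b' (f : R -> V) :
  a <= a' -> b' <= b -> abs_continuous a b f -> abs_continuous a' b' f.
Proof.
move=> aa bb acf e e0; have [d d0 hd] := acf e e0; exists d => // m u v huv.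
by apply: hd => i; have [? ? ?] := huv i; split => //; lra.
Qed.

Lemma lip_abs_continuous (V : normedModType R) a b (f : R -> V) :
  lip a b f -> abs_continuous a b f.
Proof.
move=> /lip_pos[L L0 h] e e0; exists (e / L); first by rewrite divr_gt0.
move=> m u v huv _; rewrite ltr_pdivlMr // mulrC mulr_sumr => {e0}; apply: le_lt_trans.
apply: ler_sum => i _; have [au uv vb] := huv i.
have /andP[??] : a <= v i <= b by apply/andP; split; lra.
have := h (v i) (u i); rewrite [`|v i - u i|]ger0_norm ?subr_ge0 //.
by apply; apply/andP; split; lra.
Qed.

Lemma abs_continuousB (V : normedModType R) a b (f g : R -> V) :
  abs_continuous a b f -> abs_continuous a b g ->
  abs_continuous a b (fun s => f s - g s).
Proof.
move=> acf acg e e0; have e20 : 0 < e / 2 by rewrite divr_gt0.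
have [d d0 hd] := acf _ e20; have [c c0 hc] := acg _ e20.
exists (Num.min d c); first by rewrite lt_min d0.
move=> m u v huv tuv; rewrite lt_min => /andP[h1 h2].
have := hd m u v huv tuv h1; have := hc m u v huv tuv h2.
suff : \sum_i `|f (v i) - g (v i) - (f (u i) - g (u i))| <=
  \sum_i `|f (v i) - f (u i)| + \sum_i `|g (v i) - g (u i)| by lra.
rewrite -big_split /=; apply: ler_sum => i _.
have -> : f (v i) - g (v i) - (f (u i) - g (u i)) =
    (f (v i) - f (u i)) - (g (v i) - g (u i)).
  by rewrite !opprB addrACA [in RHS]addrACA [- g _ - _]addrC.
by apply: le_trans (ler_normD _ _) _; rewrite normrN.
Qed.

Lemma abs_continuous_coord n a b (y : R -> 'rV[R]_n) i :
  abs_continuous a b y -> abs_continuous a b (fun s => y s 0 i).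
Proof.
move=> acy e e0; have [d d0 hd] := acy e e0; exists d => // m u v huv tuv suv.
apply: le_lt_trans (hd m u v huv tuv suv); apply: ler_sum => j _.
by have := norm_coord_le (y (v j) - y (u j)) i; rewrite !mxE.
Qed.

Lemma abs_continuous_le a b (f g : R -> R) : a <= b ->
  abs_continuous a b f -> abs_continuous a b g ->
  ae_on a b (fun s => exists df dg,
    [/\ is_derive s 1 f df, is_derive s 1 g dg & df <= dg]) ->
  f b - f a <= g b - g a.
Proof.
move=> ab acf acg h.
suff : f b - g b <= f a - g a by lra.
apply: (abs_continuous_nonincreasing (f := fun s => f s - g s)) => //.
  exact: abs_continuousB.
apply: ae_on_imp h => s _ [df [dg [hf hg dfg]]].
have hfg : is_derive s 1 (fun t => f t - g t) (df - dg) by apply: is_deriveB.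
by split; [case: hfg|rewrite derive1E derive_val subr_le0].
Qed.

Lemma lip_le a b (f g : R -> R) : a <= b -> lip a b f -> lip a b g ->
  ae_on a b (fun s => exists df dg,
    [/\ is_derive s 1 f df, is_derive s 1 g dg & df <= dg]) ->
  f b - f a <= g b - g a.
Proof. by move=> ab lf lg; apply: abs_continuous_le => //; exact: lip_abs_continuous. Qed.

Lemma is_derive_coordP n (y : R -> 'rV[R]_n) (s : R) (v : 'rV[R]_n) :
  is_derive s 1 y v <-> forall i, is_derive s 1 (fun t => y t 0 i) (v 0 i).
Proof.
split=> [[dy <-] i|h].
  have /derivable_mxP dyi := dy.
  by apply: DeriveDef; [exact: dyi|rewrite derive_mx // mxE].
have dy : derivable y s 1.
  by apply/derivable_mxP => i j; rewrite [i]ord1; case: (h j).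
apply: DeriveDef => //; rewrite derive_mx //; apply/rowP => j; rewrite mxE.
by case: (h j).
Qed.

(** By comparison with the affine functions of slope [M] and [- M]. *)
Lemma abs_continuous_lip a b (y : R -> R) (M : R) :
  abs_continuous a b y ->
  ae_on a b (fun s => exists2 dy, is_derive s 1 y dy & `|dy| <= M) ->
  lip_on a b M y.
Proof.
move=> acy hy.
have H s t : a <= s -> s <= t -> t <= b -> `|y t - y s| <= M * `|t - s|.
  move=> as_ st tb; rewrite [`|t - s|]ger0_norm ?subr_ge0 // mulrBr ler_norml.
  have lM : lip s t (fun r => M * r).
    exists `|M| => p q _ _; by rewrite -mulrBr normrM.
  have acst := abs_continuous_sub as_ tb acy.
  have hst := ae_on_sub as_ tb hy.
  apply/andP; split.
    have -> : - (M * t - M * s) = - (M * t) - - (M * s) by ring.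
    apply: (@abs_continuous_le s t (fun r => - (M * r)) y) => //.
      by apply: lip_abs_continuous; exact: lipN.
    apply: ae_on_imp hst => r _ [dy hdy]; rewrite ler_norml => /andP[? ?].
    exists (- M), dy; split => //.
    by apply: is_deriveN; apply: is_derive_eq; rewrite /GRing.scale /= mulr1.
  apply: (@abs_continuous_le s t y (fun r => M * r)) => //.
    exact: lip_abs_continuous.
  apply: ae_on_imp hst => r _ [dy hdy]; rewrite ler_norml => /andP[? ?].
  exists dy, M; split => //.
  by apply: is_derive_eq; rewrite /GRing.scale /= mulr1.
move=> s t /andP[as_ sb] /andP[at_ tb].
have [st|/ltW ts] := leP s t; last exact: H.
by rewrite distrC [`|s - t|]distrC; exact: H.
Qed.

(** A bound that improves itself as long as it holds is never violated: the first
    time of violation would be a time of equality. *)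
Lemma lip_bootstrap a b (N : R -> R) (c : R) : lip a b N -> N a <= c ->
  (forall t, a <= t <= b -> (forall s, a <= s <= t -> N s <= c) -> N t < c) ->
  forall s, a <= s <= b -> N s < c.
Proof.
move=> /lip_pos[L L0 lN] Na step.
suff H s : a <= s <= b -> N s <= c.
  move=> s /andP[as_ sb]; apply: step => [|t /andP[? ?]]; first by rewrite as_.
  by apply: H; apply/andP; split => //; lra.
move: s; apply: (continuous_induction (Q := fun s => N s <= c)) => //.
- move=> s as_ sb h; apply/ler_addgt0Pr => e e0.
  pose u := Num.max a (s - e / L).
  have au : a <= u by rewrite le_max lexx.
  have us : u < s by rewrite gt_max as_ ltrBlDr ltrDl divr_gt0.
  have su : L * (s - u) <= e.
    rewrite mulrC -ler_pdivlMr // lerBlDr -lerBlDl le_max; apply/orP; right; lra.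
  have Nu := h u au us.
  have := lN s u; rewrite [`|s - u|]ger0_norm ?subr_ge0 ?(ltW us) //.
  rewrite (ltW as_) sb au (le_trans (ltW us) sb) => /(_ isT isT) h1.
  by have := le_trans h1 su; rewrite ler_norml => /andP[_ ?]; lra.
- move=> s as_ sb h.
  have Ns : N s < c.
    apply: step => [|t /andP[? ?]]; first by rewrite as_ ltW.
    exact: h.
  exists ((c - N s) / L); first by rewrite divr_gt0 // subr_gt0.
  move=> v sv vr vb.
  have : L * (v - s) <= c - N s.
    rewrite mulrC -ler_pdivlMr //; lra.
  have := lN v s; rewrite [`|v - s|]ger0_norm ?subr_ge0 ?(ltW sv) //.
  rewrite as_ (ltW sb) vb (le_trans as_ (ltW sv)) => /(_ isT isT).
  rewrite ler_norml => /andP[_ ? ?]; lra.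
Qed.

End lipschitz_interval.

(** * The deviation estimate *)
Section deviation.
Variable R : realType.

Section derivation_rules.
Implicit Types (f g : R -> R) (s : R).

Lemma der_eq f s df df' : is_derive s 1 f df -> df = df' ->
  is_derive s 1 f df'.
Proof. by move=> ? <-. Qed.

Lemma derD f g s df dg : is_derive s 1 f df -> is_derive s 1 g dg ->
  is_derive s 1 (fun t => f t + g t) (df + dg).
Proof. by move=> hf hg; apply: is_deriveD. Qed.

Lemma derB f g s df dg : is_derive s 1 f df -> is_derive s 1 g dg ->
  is_derive s 1 (fun t => f t - g t) (df - dg).
Proof. by move=> hf hg; apply: is_deriveB. Qed.

Lemma derN f s df : is_derive s 1 f df -> is_derive s 1 (fun t => - f t) (- df).
Proof. by move=> hf; apply: is_deriveN. Qed.

Lemma derZ c f s df : is_derive s 1 f df ->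
  is_derive s 1 (fun t => c * f t) (c * df).
Proof. by move=> hf; apply: (@is_deriveZ _ _ _ f c). Qed.

Lemma der_cst c s : is_derive s 1 (fun=> c : R) (0 : R).
Proof. exact: is_derive_cst. Qed.

Lemma derM f g s df dg : is_derive s 1 f df -> is_derive s 1 g dg ->
  is_derive s 1 (fun t => f t * g t) (df * g s + f s * dg).
Proof.
move=> hf hg; have h := is_deriveM hf hg.
by apply: is_derive_eq; rewrite /GRing.scale /= addrC [g s * _]mulrC.
Qed.

Lemma der_sum n (h dh : 'I_n -> R -> R) s :
  (forall i, is_derive s 1 (h i) (dh i s)) ->
  is_derive s 1 (fun t => \sum_i h i t) (\sum_i dh i s).
Proof.
move=> H; have := @is_derive_sum _ _ _ n h s 1 (fun i => dh i s) H.
by congr is_derive; apply/funext => t; rewrite fct_sumE.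
Qed.

End derivation_rules.

Lemma norm_attained n (u : 'rV[R]_n) : `|u| != 0 -> exists i, `|u| = `|u 0 i|.
Proof.
by move=> u0; have [[i j]] := mx_norm_neq0 u0; rewrite [i]ord1; exists j.
Qed.

Lemma is_derive_exp_affine (L a s : R) :
  is_derive s 1 (fun t => expR (L * (t - a))) (L * expR (L * (s - a))).
Proof.
have h : is_derive s 1 (fun t => L * (t - a)) L.
  by apply: is_derive_eq; rewrite /GRing.scale /= subr0 mulr1.
have h' := @is_derive1_comp R expR _ s _ _ (is_derive_expR (L * (s - a))) h.
by apply: is_derive_eq; rewrite mulrC.
Qed.

Lemma lip_exp_affine (L c a b : R) : lip a b (fun t => expR (L * (t - c))).
Proof.
exists (`|L| * expR (`|L| * (`|a| + `|b| + `|c|))).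
apply: (lip_of_derive (fun s _ => is_derive_exp_affine L c s)) => s /andP[as_ sb].
rewrite normrM ler_wpM2l // ger0_norm ?expR_ge0 // ler_expR.
apply: le_trans (ler_norm _) _; rewrite normrM ler_wpM2l //.
apply: le_trans (ler_normB _ _) _; rewrite lerD2r ler_norml.
have := ler_norm (- a); have := ler_norm b; rewrite normrN.
by have := normr_ge0 a; have := normr_ge0 b => *; apply/andP; split; lra.
Qed.

Lemma lip_within_continuous (V : normedModType R) (a b : R) (f : R -> V) :
  lip a b f -> {within `[a, b], continuous f}.
Proof.
move=> /lip_pos[L L0 h]; apply/subspace_continuousP => x /=.
rewrite in_itv /= => xab; apply/cvgrPdist_le => e e0.
rewrite near_withinE; near=> t => /= /[!in_itv]/= tab.
apply: le_trans (h x t xab tab) _; rewrite mulrC -ler_pdivlMr //.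
by near: t; apply: cvgr_dist_le => //; rewrite divr_gt0.
Unshelve. all: by end_near. Qed.

(** Here [w] is the deviation of an arc from an extremal and [J] the opposite of
    its pairing with the costate.  The pointwise inequality, for all [lam], encodes
    [|w'|^2 <= C (J' + C |w|^2)] up to terms linear in [w].  It is integrated with
    [lam = lam0 / e] for the exponential weight [e]: integrating [lam J'] by parts,
    and bounding [J] above by a quadratic in [w] and below at [a], gives for
    [m = max (|w| / e)] an inequality [m <= sigma + ...] whose other terms are small
    multiples of [m + sigma] when [lam0] is of order [1 / (m + sigma)].  The
    assumption [|w| <= rho] is removed by [lip_bootstrap]. *)
Lemma deviation_estimate (n : nat) (a b C : R) : a <= b -> 1 <= C ->
  exists2 K : R, 1 <= K &
  forall (rho sigma kappa : R) (w : R -> 'rV[R]_n) (J : R -> R),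
    lip a b w -> lip a b J -> 0 < sigma -> K * sigma < rho ->
    ae_on a b (fun s => `|w s| <= rho -> exists (dw : 'rV[R]_n) (dJ : R),
      [/\ forall i, is_derive s 1 (fun t => w t 0 i) (dw 0 i),
          is_derive s 1 J dJ &
          forall lam i, 0 < lam -> `|dw 0 i| <=
            C * `|w s| + C * lam * (dJ + C * `|w s| ^+ 2) + C / lam]) ->
    (forall s, a <= s <= b -> `|w s| <= rho ->
       J s <= kappa + C * `|w s| ^+ 2) ->
    kappa - sigma ^+ 2 <= J a -> `|w a| <= sigma ->
    forall s, a <= s <= b -> `|w s| <= K * sigma.
Proof.
move=> ab C1.
have C0 : 0 < C by exact: lt_le_trans C1.
(* These constants make each of the error terms [k1], [k2] and [k4] below at most a
   quarter of [m + sigma]. *)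
pose eta : R := (8 * C ^+ 2)^-1.
have eta0 : 0 < eta by rewrite invr_gt0 mulr_gt0 // exprn_gt0.
have etaC2 : C ^+ 2 * eta = 8^-1.
  by rewrite /eta invfM mulrCA divff ?mulr1 // expf_neq0 // gt_eqF.
have etaC : C * eta <= 8^-1.
  rewrite -etaC2 ler_wpM2r ?(ltW eta0) // expr2 ler_peMl // ltW //.
pose L : R := 8 * (C + 8^-1 + C / eta).
have Ceta0 : 0 < C / eta by rewrite divr_gt0.
have L0 : 0 < L by rewrite /L; lra.
pose e s := expR (L * (s - a)).
have e0 s : 0 < e s by exact: expR_gt0.
have e1 s : a <= s -> 1 <= e s.
  move=> as_; have := expR_ge1Dx (L * (s - a)).
  have : 0 <= L * (s - a) by rewrite mulr_ge0 ?(ltW L0) // subr_ge0.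
  by rewrite /e; lra.
exists (2 * e b); first by have := e1 b ab; lra.
move=> rho sigma kappa w J lw lJ s0 Ks hae hJ Ja wa.
have lwa : lip a b (fun s => `|w s|).
  have [M hM] := lw; exists M => s t sab tab.
  exact: le_trans (ler_dist_dist _ _) (hM s t sab tab).
suff est t : a <= t <= b -> (forall s, a <= s <= t -> `|w s| <= rho) ->
    `|w t| <= 2 * e b * sigma.
  have H s : a <= s <= b -> `|w s| < rho.
    apply: (lip_bootstrap lwa).
      apply: le_trans wa _; apply: le_trans (ltW Ks).
      by rewrite ler_peMl ?(ltW s0) //; have := e1 b ab; lra.
    by move=> t tab ht; apply: le_lt_trans Ks; exact: est.
  move=> s sab; apply: est => // t /andP[at_ ts]; apply/ltW/H.
  by case/andP: sab => ? ?; rewrite at_ (le_trans ts).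
move=> /andP[at_ tb] hrho.
pose ei s := expR (- L * (s - a)).
have eiE s : ei s = (e s)^-1 by rewrite /ei /e mulNr expRN.
have [|s2 s2t hmax] := @EVT_max R (fun s => `|w s| * ei s) a t at_.
  apply: lip_within_continuous; apply: lipM; last exact: lip_exp_affine.
  exact: lip_sub lwa.
move: s2t; rewrite in_itv /= => /andP[as2 s2t].
set m := `|w s2| * ei s2 in hmax.
have m0 : 0 <= m by rewrite mulr_ge0 // expR_ge0.
have mE : `|w s2| * ei s2 = m by [].
clearbody m.
have wm s : a <= s -> s <= t -> `|w s| <= m * e s.
  move=> as_ st; have := hmax s; rewrite in_itv /= as_ st => /(_ isT).
  by rewrite eiE ler_pdivrMr.
have m2 : m <= 2 * sigma; last first.
  have := wm t at_ (lexx _); move/le_trans; apply.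
  rewrite mulrAC; have h : e t <= e b by rewrite ler_expR ler_pM2l // lerD2r.
  by apply: ler_pM => //; exact: (ltW (e0 t)).
(* With this weight [lam |w|^2] and [1 / lam] are of the same order. *)
pose lam0 := eta / (m + sigma).
have ms0 : 0 < m + sigma by rewrite ltr_wpDl.
have lam00 : 0 < lam0 by rewrite divr_gt0.
have C20 : 0 <= C ^+ 2 by rewrite exprn_ge0 // ltW.
pose A := C * m + C ^+ 2 * (lam0 * m ^+ 2) + C / lam0
  + L * (C ^+ 2 * (lam0 * m ^+ 2)).
have A0 : 0 <= A.
  have ? : 0 <= C ^+ 2 * (lam0 * m ^+ 2).
    by rewrite mulr_ge0 // mulr_ge0 ?exprn_ge0 // ltW.
  have ? : 0 <= C / lam0 by rewrite divr_ge0 // ltW.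
  by rewrite /A !addr_ge0 // mulr_ge0 // ltW.
(* [G] grows faster than any coordinate of [w]: its first term accounts for [lam J'],
   the second for all the rest, including the derivative of the weight. *)
pose G s := C * (lam0 * ei s) * (J s - kappa) + A / L * e s.
have lag : lip a s2 G.
  apply: lipD; apply: lipM.
  - apply: lipM; first exact: lip_cst.
    by apply: lipM; [exact: lip_cst|exact: lip_exp_affine].
  - apply: lipB; last exact: lip_cst.
    by apply: lip_sub lJ => //; exact: le_trans tb.
  - exact: lip_cst.
  - exact: lip_exp_affine.
pose rhs := G s2 - G a.
have main (eps : R) i : `|eps| = 1 -> eps * w s2 0 i - eps * w a 0 i <= rhs.
  move=> eps1.
  apply: (@lip_le _ a s2 (fun s => eps * w s 0 i) G as2) => //.
    apply: lipM; first exact: lip_cst.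
    by apply: lip_coord; apply: lip_sub lw => //; exact: le_trans tb.
  have := ae_on_sub (lexx a) (le_trans s2t tb) hae.
  apply: ae_on_imp => s /andP[as_ ss2].
  have st : s <= t by exact: le_trans s2t.
  have wrho : `|w s| <= rho by apply: hrho; rewrite as_ st.
  move=> /(_ wrho)[dw [dJ [hw hj hl]]].
  exists (eps * dw 0 i), (C * (lam0 * (- L * ei s)) * (J s - kappa)
    + C * (lam0 * ei s) * dJ + A * e s); split.
  - exact: derZ.
  - rewrite /G; apply: is_derive_eq.
    rewrite /GRing.scale /= !subr0 !mulr1 -/(ei s) -/(e s).
    by field; rewrite gt_eqF.
  - apply: le_trans (ler_norm _) _; rewrite normrM eps1 mul1r.
    have lams : 0 < lam0 * ei s by rewrite mulr_gt0 // expR_gt0.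
    apply: le_trans (hl _ i lams) _.
    set x := e s; have x0 : 0 < x by exact: e0.
    rewrite eiE -/x.
    have Hw : `|w s| <= m * x by exact: wm.
    have Hw2 : `|w s| ^+ 2 / x <= m ^+ 2 * x.
      rewrite ler_pdivrMr // -mulrA -expr2 -exprMn.
      by rewrite ler_pXn2r // nnegrE // mulr_ge0 // ltW.
    have HJ : J s - kappa <= C * `|w s| ^+ 2.
      by rewrite lerBlDl; apply: hJ => //; rewrite as_ (le_trans ss2) // (le_trans s2t).
    have h1 : C * `|w s| <= C * m * x by rewrite -mulrA ler_pM2l.
    have h2 : C * (lam0 / x) * (C * `|w s| ^+ 2) <= C ^+ 2 * (lam0 * m ^+ 2) * x.
      have -> : C * (lam0 / x) * (C * `|w s| ^+ 2) =
        C ^+ 2 * (lam0 * (`|w s| ^+ 2 / x)) by ring.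
      have -> : C ^+ 2 * (lam0 * m ^+ 2) * x = C ^+ 2 * (lam0 * (m ^+ 2 * x)).
        by ring.
      by apply: ler_wpM2l => //; apply: ler_wpM2l => //; exact: ltW.
    have h3 : C / (lam0 / x) = C / lam0 * x.
      by field; rewrite !gt_eqF.
    have h4 : C * (lam0 / x) * (J s - kappa) <= C ^+ 2 * (lam0 * m ^+ 2) * x.
      apply: le_trans h2; rewrite ler_wpM2l //.
      by rewrite mulr_ge0 ?(ltW C0) // divr_ge0 // ltW.
    have h5 := ler_wpM2l (ltW L0) h4.
    rewrite h3 /A; move: h1 h2 h5.
    have -> : C * (lam0 * (- L / x)) * (J s - kappa) =
      - (L * (C * (lam0 / x) * (J s - kappa))) by ring.
    set t1 := C * `|w s|; set t2 := C * (lam0 / x).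
    rewrite [t2 * (dJ + _)]mulrDr.
    set t3 := t2 * (C * _); set t4 := t2 * dJ; set t5 := L * (t2 * _).
    set q := C ^+ 2 * _.
    move=> h1 h2 h5.
    have -> : (C * m + q + C / lam0 + L * q) * x =
      C * m * x + q * x + C / lam0 * x + L * (q * x) by ring.
    lra.
have [m00|m0'] := eqVneq m 0; first by rewrite m00 mulr_ge0 // ltW.
have w2 : `|w s2| <= sigma + rhs.
  have [|i ->] := @norm_attained n (w s2).
    by apply: contra_neq m0' => h; rewrite -mE h mul0r.
  have := norm_coord_le (w a) i; rewrite !ler_norml => /andP[? ?].
  apply/andP; split; last by have := main 1 i; rewrite normr1 => /(_ erefl); lra.
  by have := main (-1) i; rewrite normrN1 => /(_ erefl); lra.
have ea : e a = 1 by rewrite /e subrr mulr0 expR0.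
set E := e s2; have E1 : 1 <= E by exact: e1.
have E0 : 0 < E by exact: e0.
have wE : `|w s2| = m * E by rewrite -mE eiE divfK // gt_eqF.
have q0 : 0 <= lam0 * m ^+ 2 by rewrite mulr_ge0 ?exprn_ge0 // ltW.
have r1 : C * (lam0 * ei s2) * (J s2 - kappa) <= C ^+ 2 * (lam0 * m ^+ 2) * E.
  have HJ : J s2 - kappa <= C * `|w s2| ^+ 2.
    rewrite lerBlDl; apply: hJ; first by rewrite as2 (le_trans s2t).
    by apply: hrho; rewrite as2.
  have -> : C ^+ 2 * (lam0 * m ^+ 2) * E =
      C * (lam0 * ei s2) * (C * `|w s2| ^+ 2).
    by rewrite wE eiE -/E; field; rewrite gt_eqF.
  by apply: ler_wpM2l => //; do 2 (apply: mulr_ge0; first exact: ltW); exact: expR_ge0.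
have r2 : - (C * (lam0 * ei a) * (J a - kappa)) <= C * (lam0 * sigma ^+ 2).
  rewrite eiE ea invr1 mulr1 -mulrN -mulrA ler_pM2l // ler_pM2l //.
  by lra.
have AL : 0 <= A / L by rewrite divr_ge0 // (ltW L0).
have mle : m <= sigma + C ^+ 2 * (lam0 * m ^+ 2) + C * (lam0 * sigma ^+ 2) + A / L.
  rewrite -(ler_pM2r E0) -wE; apply: le_trans w2 _.
  have h1 : C * (lam0 * sigma ^+ 2) <= C * (lam0 * sigma ^+ 2) * E.
    apply: ler_peMr => //; do 2 (apply: mulr_ge0; first exact: ltW).
    by rewrite exprn_ge0 // ltW.
  have h2 : sigma <= sigma * E by apply: ler_peMr => //; exact: ltW.
  rewrite /rhs /G ea -/E mulr1; move: r1 r2 h1 h2 AL.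
  move: (C * (lam0 * ei s2) * _) (C * (lam0 * ei a) * _) (A / L) => t1 t2 al.
  move: (C * (lam0 * _)) (C ^+ 2 * _) => t3 t4 r1 r2 h1 h2 al0.
  have -> : (sigma + t4 + t3 + al) * E = sigma * E + t4 * E + t3 * E + al * E.
    by ring.
  lra.
have lm : lam0 * m ^+ 2 <= eta * m.
  rewrite /lam0 mulrAC ler_pdivrMr // expr2 mulrA.
  by rewrite ler_wpM2l ?mulr_ge0 // ?(ltW eta0) //; lra.
have ls : lam0 * sigma ^+ 2 <= eta * sigma.
  rewrite /lam0 mulrAC ler_pdivrMr // expr2 mulrA.
  by rewrite ler_wpM2l ?mulr_ge0 // ?(ltW eta0) ?(ltW s0) //; lra.
have k1 : C ^+ 2 * (lam0 * m ^+ 2) <= m / 8.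
  have := ler_wpM2l C20 lm; rewrite [X in _ <= X]mulrA etaC2; lra.
have k2 : C * (lam0 * sigma ^+ 2) <= sigma / 8.
  have := ler_wpM2l (ltW C0) ls; rewrite [X in _ <= X]mulrA.
  have := ler_wpM2r (ltW s0) etaC; lra.
have k3 : C / lam0 = C / eta * (m + sigma).
  by rewrite /lam0; field; rewrite !gt_eqF.
have k4 : A / L <= (m + sigma) / 8 + m / 8.
  rewrite ler_pdivrMr // /A k3.
  have : C ^+ 2 * (lam0 * m ^+ 2) * L <= m / 8 * L by rewrite ler_pM2r.
  have : 0 <= C * sigma by rewrite mulr_ge0 // ltW.
  move: k1; rewrite /L; move: (C / eta) (C ^+ 2 * (lam0 * m ^+ 2)) => ce q.
  by move=> ? ? ?; lra.
lra.
Qed.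

End deviation.

(** * Differential equations: Gronwall and Picard *)
Section antiderivative.
Variable R : realType.

Lemma derive_zero_cst (f : R -> R) (a b : R) :
  (forall s, a < s < b -> is_derive s 1 f 0) ->
  forall s t, a < s < b -> a < t < b -> f s = f t.
Proof.
move=> hf.
have H s t : a < s -> s <= t -> t < b -> f s = f t.
  move=> as_ st tb; apply/eqP; rewrite -subr_eq0 -normr_le0.
  have h : lip_on s t 0 f.
    apply: (@lip_of_derive _ _ _ _ (fun=> 0)) => [r /andP[sr rt]|r _].
      by apply: hf; apply/andP; split; lra.
    by rewrite normr0.
  by have := h s t; rewrite mul0r !lexx st; apply.
move=> s t /andP[as_ sb] /andP[at_ tb].
by have [st|/ltW ts] := leP s t; [exact: H|apply/esym/H].
Qed.

(** Integrals from different lower ends differ by constants, so they glue to a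
    primitive on the whole line. *)
Lemma antiderivative (f : R -> R) : continuous f ->
  exists2 F : R -> R, F 0 = 0 & forall s : R, is_derive s 1 F (f s).
Proof.
move=> cf.
pose P (M x : R) := Rintegral lebesgue_measure `[- M, x]%classic f.
have hP (M x : R) : - M < x -> is_derive x 1 (P M) (f x).
  move=> Mx.
  have [] := @continuous_FTC1_closed R f (- M) x (x + 1) _ _ Mx (cf x).
  - by rewrite ltrDl.
  - apply: continuous_compact_integrable; first exact: segment_compact.
    exact: continuous_subspaceT.
  - by move=> h <-; rewrite derive1E; exact: derivableP.
pose G M x := P M x - P M 0.
have hG (M x : R) : - M < x -> is_derive x 1 (G M) (f x).
  by move=> Mx; have h := hP M x Mx; apply: is_derive_eq; rewrite subr0.
have GE (M N x : R) : 0 < M -> 0 < N -> - M < x -> - N < x -> G M x = G N x.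
  move=> M0 N0 Mx Nx.
  suff : G M x - G N x = G M 0 - G N 0 by rewrite /G !subrr; lra.
  pose c := Num.min M N.
  have c1 : c <= M by rewrite ge_min lexx.
  have c2 : c <= N by rewrite ge_min lexx orbT.
  have cx : - c < x by rewrite /c oppr_min gt_max Mx.
  have c0 : 0 < c by rewrite lt_min M0.
  apply: (@derive_zero_cst (fun t => G M t - G N t) (- c) (`|x| + 1)).
  - move=> s /andP[cs _].
    have h1 : is_derive s 1 (G M) (f s) by apply: hG; lra.
    have h2 : is_derive s 1 (G N) (f s) by apply: hG; lra.
    by apply: is_derive_eq; rewrite subrr.
  - by have := ler_norm x => ?; apply/andP; split; lra.
  - by have := normr_ge0 x => ?; apply/andP; split; lra.
exists (fun x => G (`|x| + 1) x); first by rewrite /G subrr.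
move=> s; pose M := `|s| + 2.
have sM : - M < s by have := ler_norm (- s); rewrite normrN /M; lra.
apply: (@near_eq_is_derive _ _ _ (G M)); last exact: hG.
near=> x.
have [x1 x2] : - M < x /\ x < M.
  have : `|s - x| < 1 by near: x; apply: cvgr_dist_lt => //.
  rewrite ltr_distl => /andP[? ?].
  have := ler_norm (- s); have := ler_norm s; rewrite normrN /M; split; lra.
have := normr_ge0 s; have := ler_norm (- x); rewrite normrN => ? ?.
by apply: GE => //; rewrite /M; have := normr_ge0 x; lra.
Unshelve. all: by end_near. Qed.

End antiderivative.

Section gronwall.
Variable R : realType.

Lemma is_derive_reflect (c s df : R) (f : R -> R) :
  is_derive (c - s) 1 f df -> is_derive s 1 (fun t => f (c - t)) (- df).
Proof.
move=> hf.
have h : is_derive s 1 (fun t => c - t) (- 1).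
  by apply: (der_eq (derB (der_cst c s) (is_derive_id s 1))); rewrite sub0r.
have h' := @is_derive1_comp R f _ s _ _ hf h.
by apply: is_derive_eq; rewrite mulrN1.
Qed.

(** Maximize [|D| / e] with [e s = expR (2 L (s - a))] and integrate one coordinate of
    [D] up to the maximizer: the weight reduces the contribution of [L |D|] to half
    of the maximum. *)
Lemma gronwall_lip n (a b L eps : R) (D : R -> 'rV[R]_n) :
  0 < L -> 0 <= eps -> lip a b D ->
  ae_on a b (fun s => exists2 dD : 'rV[R]_n,
    forall i, is_derive s 1 (fun t => D t 0 i) (dD 0 i) &
    `|dD| <= L * `|D s| + eps) ->
  forall s, a <= s <= b ->
    `|D s| <= (2 * `|D a| + eps / L) * expR (2 * L * (s - a)).
Proof.
move=> L0 eps0 lD hD t /andP[at_ tb].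
pose e s := expR (2 * L * (s - a)).
have e0 s : 0 < e s by exact: expR_gt0.
have e1 s : a <= s -> 1 <= e s.
  move=> as_; have := expR_ge1Dx (2 * L * (s - a)).
  have : 0 <= 2 * L * (s - a) by rewrite !mulr_ge0 ?(ltW L0) // subr_ge0.
  by rewrite /e; lra.
pose ei s := expR (- (2 * L) * (s - a)).
have eiE s : ei s = (e s)^-1 by rewrite /ei /e mulNr expRN.
have lDn : lip a t (fun s => `|D s|).
  have [M hM] := lip_sub (lexx a) tb lD; exists M => s r sab rab.
  exact: le_trans (ler_dist_dist _ _) (hM s r sab rab).
have [|s2 s2t hmax] := @EVT_max R (fun s => `|D s| * ei s) a t at_.
  by apply: lip_within_continuous; apply: lipM => //; exact: lip_exp_affine.
move: s2t; rewrite in_itv /= => /andP[as2 s2t].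
set m := `|D s2| * ei s2 in hmax.
have m0 : 0 <= m by rewrite mulr_ge0 // expR_ge0.
have mE : `|D s2| * ei s2 = m by [].
clearbody m.
have Dm s : a <= s -> s <= t -> `|D s| <= m * e s.
  move=> as_ st; have := hmax s; rewrite in_itv /= as_ st => /(_ isT).
  by rewrite eiE ler_pdivrMr.
apply: le_trans (Dm t at_ (lexx t)) _; apply: ler_wpM2r; first exact: expR_ge0.
have Lm : 0 <= L * m + eps by rewrite addr_ge0 // mulr_ge0 // ltW.
have main (sg : R) i : `|sg| = 1 -> sg * D s2 0 i - sg * D a 0 i <=
    (L * m + eps) / (2 * L) * e s2 - (L * m + eps) / (2 * L) * e a.
  move=> sg1.
  apply: (@lip_le _ a s2 (fun s => sg * D s 0 i)
    (fun s => (L * m + eps) / (2 * L) * e s) as2).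
  - apply: lipM; first exact: lip_cst.
    by apply: lip_coord; apply: lip_sub lD => //; exact: le_trans tb.
  - by apply: lipM; [exact: lip_cst|exact: lip_exp_affine].
  have := ae_on_sub (lexx a) (le_trans s2t tb) hD.
  apply: ae_on_imp => s /andP[as_ ss2] [dD hdD dDle].
  exists (sg * dD 0 i), ((L * m + eps) * e s); split.
  - exact: derZ.
  - apply: is_derive_eq; rewrite /GRing.scale /= !subr0 !mulr1 -/(e s).
    by field; rewrite gt_eqF.
  - apply: le_trans (ler_norm _) _; rewrite normrM sg1 mul1r.
    apply: le_trans (norm_coord_le _ _) _; apply: le_trans dDle _.
    rewrite mulrDl -mulrA; apply: lerD.
      by rewrite ler_pM2l // Dm // (le_trans ss2).
    by rewrite ler_peMr // e1.
have [m00|m0'] := eqVneq m 0.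
  by rewrite m00; apply: addr_ge0; [exact: mulr_ge0|rewrite divr_ge0 // ltW].
have ea : e a = 1 by rewrite /e subrr mulr0 expR0.
have L2 : (L * m + eps) / (2 * L) = m / 2 + eps / L / 2.
  by field; rewrite gt_eqF.
have E1 := e1 s2 as2.
have DE : `|D s2| = m * e s2 by rewrite -mE eiE divfK // gt_eqF.
have : `|D s2| <= `|D a| + (m / 2 + eps / L / 2) * (e s2 - 1).
  have [|i ->] := @norm_attained R n (D s2).
    by apply: contra_neq m0' => h; rewrite -mE h mul0r.
  have := norm_coord_le (D a) i; rewrite !ler_norml => /andP[? ?].
  have := main 1 i; rewrite normr1 ea L2 => /(_ erefl).
  have := main (-1) i; rewrite normrN1 ea L2 => /(_ erefl).
  by rewrite -mulrBr => ? ?; apply/andP; split; lra.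
have epsL : 0 <= eps / L by rewrite divr_ge0 // ltW.
have Da : `|D a| <= `|D a| * e s2 by rewrite ler_peMr.
rewrite DE => h.
have : m * e s2 <= (`|D a| + (m / 2 + eps / L / 2)) * e s2.
  rewrite mulrDl; move: h Da; rewrite mulrBr mulr1; move: (_ * e s2) => q.
  by move: (`|D a| * e s2) => p; lra.
by rewrite ler_pM2r //; lra.
Qed.

Lemma gronwall_lip_rev n (a b L eps : R) (D : R -> 'rV[R]_n) :
  0 < L -> 0 <= eps -> lip a b D ->
  ae_on a b (fun s => exists2 dD : 'rV[R]_n,
    forall i, is_derive s 1 (fun t => D t 0 i) (dD 0 i) &
    `|dD| <= L * `|D s| + eps) ->
  forall s, a <= s <= b ->
    `|D s| <= (2 * `|D b| + eps / L) * expR (2 * L * (b - s)).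
Proof.
move=> L0 eps0 lD hD s /andP[as_ sb].
pose D' t := D (a + b - t).
have := @gronwall_lip n a b L eps D' L0 eps0 _ _ (a + b - s).
have -> : D' (a + b - s) = D s by rewrite /D'; congr D; ring.
have -> : D' a = D b by rewrite /D'; congr D; ring.
have -> : a + b - s - a = b - s by ring.
apply; last by apply/andP; split; lra.
- have [M hM] := lD; exists M => t r /andP[? ?] /andP[? ?].
  have := hM (a + b - t) (a + b - r).
  have -> : a + b - t - (a + b - r) = r - t by ring.
  by rewrite [`|r - t|]distrC; apply; apply/andP; split; lra.
- apply: ae_on_imp (ae_on_rev hD) => t _ [dD h1 h2].
  exists (- dD); last by rewrite normrN.
  by move=> i; rewrite mxE; exact: (is_derive_reflect (h1 i)).
Qed.

End gronwall.

Section picard.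
Variable R : realType.

Lemma der_vecB (V : normedModType R) (f g : R -> V) (s : R) df dg :
  is_derive s 1 f df -> is_derive s 1 g dg ->
  is_derive s 1 (fun t => f t - g t) (df - dg).
Proof. by move=> hf hg; apply: is_deriveB. Qed.

(** Integrated form of the derivative bound; the norm weighted by
    [expR (K |s - s0|)] is the one in which Picard iteration contracts. *)
Lemma exp_growth (f df : R -> R) (s0 K M : R) : 0 < K -> 0 <= M ->
  (forall s : R, is_derive s 1 f (df s)) ->
  (forall s, `|df s| <= M * K * expR (K * `|s - s0|)) ->
  forall s, `|f s - f s0| <= M * (expR (K * `|s - s0|) - 1).
Proof.
move=> K0 M0.
suff H (g dg : R -> R) : (forall s : R, is_derive s 1 g (dg s)) ->
  (forall s, `|dg s| <= M * K * expR (K * `|s - s0|)) ->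
  forall s, s0 <= s -> `|g s - g s0| <= M * (expR (K * `|s - s0|) - 1).
  move=> hf hdf s; have [s0s|/ltW ss0] := leP s0 s; first exact: (H f df).
  have E : s0 + s0 - s - s0 = - (s - s0) by ring.
  have := H (fun t => f (s0 + s0 - t)) (fun t => - df (s0 + s0 - t)) _ _
    (s0 + s0 - s).
  rewrite E normrN.
  have -> : s0 + s0 - s0 = s0 by ring.
  have -> : s0 + s0 - (s0 + s0 - s) = s by ring.
  apply; last by lra.
    by move=> t; apply: is_derive_reflect.
  move=> t; rewrite normrN; apply: le_trans (hdf _) _.
  have -> : s0 + s0 - t - s0 = - (t - s0) by ring.
  by rewrite normrN.
move=> hg hdg s s0s.
have E : `|s - s0| = s - s0 by rewrite ger0_norm // subr_ge0.
pose e t := M * expR (K * (t - s0)).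
have lg : lip s0 s g.
  exists (M * K * expR (K * (s - s0))); apply: (lip_of_derive (fun s _ => hg s)).
  move=> t /andP[s0t ts]; apply: le_trans (hdg t) _.
  rewrite ler_wpM2l ?mulr_ge0 // ?(ltW K0) // ler_expR ler_pM2l //.
  by rewrite ger0_norm ?subr_ge0 // lerD2r.
have main (sg : R) : `|sg| = 1 -> sg * g s - sg * g s0 <= e s - e s0.
  move=> sg1; apply: (@lip_le _ s0 s (fun t => sg * g t) e s0s).
  - by apply: lipM => //; exact: lip_cst.
  - by apply: lipM; [exact: lip_cst|exact: lip_exp_affine].
  apply: ae_on_all => t /andP[s0t ts].
  exists (sg * dg t), (M * K * expR (K * (t - s0))); split.
  - exact: derZ.
  - by rewrite /e; apply: is_derive_eq; rewrite /GRing.scale /= !subr0 !mulr1; ring.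
  - apply: le_trans (ler_norm _) _; rewrite normrM sg1 mul1r.
    by have := hdg t; rewrite [`|t - s0|]ger0_norm ?subr_ge0.
rewrite E mulrBr mulr1 ler_norml.
have e0 : e s0 = M by rewrite /e subrr mulr0 expR0 mulr1.
have := main 1; rewrite normr1 => /(_ erefl).
have := main (-1); rewrite normrN1 => /(_ erefl).
by rewrite e0 /e => ? ?; apply/andP; split; lra.
Qed.

Lemma exp_growth_vec n (Y dY : R -> 'rV[R]_n) (s0 K M : R) : 0 < K -> 0 <= M ->
  (forall s : R, is_derive s 1 Y (dY s)) ->
  (forall s, `|dY s| <= M * K * expR (K * `|s - s0|)) ->
  forall s, `|Y s - Y s0| <= M * expR (K * `|s - s0|).
Proof.
move=> K0 M0 hY hdY s; apply: norm_coordP; first by rewrite mulr_ge0 // expR_ge0.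
move=> i; rewrite !mxE.
have h1 (t : R) : is_derive t 1 (fun t => Y t 0 i) (dY t 0 i).
  by move/is_derive_coordP : (hY t).
have h2 t : `|dY t 0 i| <= M * K * expR (K * `|t - s0|).
  exact: le_trans (norm_coord_le _ _) (hdY t).
have := exp_growth K0 M0 h1 h2 s.
move/le_trans; apply; rewrite ler_wpM2l //; lra.
Qed.

Lemma geometric_limit (u : nat -> R) (c : R) :
  (forall k, `|u k.+1 - u k| <= c / 2 ^+ k) ->
  exists l, forall k, `|u k - l| <= 2 * c / 2 ^+ k.
Proof.
move=> hu.
have p2 k : 0 < (2 : R) ^+ k by rewrite exprn_gt0.
have c0 : 0 <= c by have := le_trans (normr_ge0 _) (hu 0%N); rewrite expr0 divr1.
pose d k := 2 * c / 2 ^+ k.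
have dS k : d k.+1 = d k - c / 2 ^+ k.
  by rewrite /d exprS; field; rewrite expf_neq0.
have d0 k : 0 <= d k by rewrite divr_ge0 ?mulr_ge0 // ltW.
have mono k j : u k - d k <= u (k + j)%N - d (k + j)%N /\
    u (k + j)%N + d (k + j)%N <= u k + d k.
  elim: j => [|j [ih1 ih2]]; first by rewrite addn0.
  rewrite addnS; have := hu (k + j)%N; rewrite dS ler_norml => /andP[? ?].
  by split; lra.
have bnd k j : u k - d k <= u j + d j.
  have [kj|jk] := leqP k j.
    have [h _] := mono k (j - k)%N; rewrite subnKC // in h.
    by have := d0 j; lra.
  have [_ h] := mono j (k - j)%N; rewrite subnKC ?(ltnW jk) // in h.
  by have := d0 k; lra.
pose S := [set x | exists k, x = u k - d k].
have hS : has_sup S.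
  split; first by exists (u 0%N - d 0%N), 0%N.
  by exists (u 0%N + d 0%N) => x [k ->].
exists (sup S) => k; rewrite ler_norml; apply/andP; split.
  have : sup S <= u k + d k.
    by apply: sup_le_ub; [case: hS|move=> x [j ->]].
  by rewrite -/(d k); lra.
have : u k - d k <= sup S by apply: sup_upper_bound => //; exists k.
by rewrite -/(d k); lra.
Qed.

Lemma geometric_limit_vec n (u : nat -> 'rV[R]_n) (c : R) :
  (forall k, `|u k.+1 - u k| <= c / 2 ^+ k) ->
  exists l, forall k, `|u k - l| <= 2 * c / 2 ^+ k.
Proof.
move=> hu.
have c0 : 0 <= c by have := le_trans (normr_ge0 _) (hu 0%N); rewrite expr0 divr1.
have /choice[l hl] : forall i, exists l, forall k, `|u k 0 i - l| <= 2 * c / 2 ^+ k.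
  move=> i; apply: geometric_limit => k; apply: le_trans (hu k).
  by have := norm_coord_le (u k.+1 - u k) i; rewrite !mxE.
exists (\row_i l i) => k; apply: norm_coordP => [|i].
  by rewrite divr_ge0 ?mulr_ge0 // exprn_ge0.
by rewrite !mxE.
Qed.

Lemma small_geometric (c e : R) : 0 < e -> exists k, c / 2 ^+ k <= e.
Proof.
move=> e0; have p2 k : 0 < (2 : R) ^+ k by rewrite exprn_gt0.
have [k hk] : exists k : nat, c / e <= k%:R.
  exists (Num.truncn (`|c / e|)).+1; apply: le_trans (ler_norm _) _.
  by apply: ltW; rewrite truncnS_gt.
exists k; rewrite ler_pdivrMr // mulrC -ler_pdivrMr //.
apply: le_trans hk _; rewrite -natrX ler_nat ltnW //.
by apply: ltn_expl.
Qed.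

Lemma vec_antiderivative n (h : R -> 'rV[R]_n) (s0 : R) (z0 : 'rV[R]_n) :
  continuous h ->
  exists2 Y : R -> 'rV[R]_n, Y s0 = z0 & forall s : R, is_derive s 1 Y (h s).
Proof.
move=> ch.
have /choice[F hF] : forall i, exists F : R -> R,
    forall s : R, is_derive s 1 F (h s 0 i).
  move=> i; have [|F _ hF] := @antiderivative R (fun s => h s 0 i).
    move=> s; apply: (cvg_comp h (fun v : 'rV[R]_n => v 0 i)); first exact: ch.
    exact: coord_continuous.
  by exists F.
exists (fun s => \row_i (z0 0 i + (F i s - F i s0))).
  by apply/rowP => i; rewrite !mxE subrr addr0.
move=> s; apply/is_derive_coordP => i.
have -> : (fun t => (\row_i (z0 0 i + (F i t - F i s0))) 0 i) =
    (fun t => z0 0 i + (F i t - F i s0)).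
  by apply/funext => t; rewrite mxE.
apply: (der_eq (derD (der_cst _ s) (derB (hF i s) (der_cst _ s)))).
by rewrite subr0 add0r.
Qed.

Lemma is_derive_continuous (n : nat) (Y : R -> 'rV[R]_n) (dY : R -> 'rV[R]_n) :
  (forall s : R, is_derive s 1 Y (dY s)) -> continuous Y.
Proof.
move=> hY s; apply: differentiable_continuous; apply/derivable1_diffP.
by case: (hY s).
Qed.

Section fixed_field.
Variables (n : nat) (G : R -> 'rV[R]_n -> 'rV[R]_n) (L : R).
Hypothesis L0 : 0 < L.
Hypothesis GL : forall s z z', `|G s z - G s z'| <= L * `|z - z'|.
Hypothesis Gc : forall z, continuous (G^~ z).

Lemma field_continuous (y : R -> 'rV[R]_n) : continuous y ->
  continuous (fun s => G s (y s)).
Proof.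
move=> cy s; apply/cvgrPdist_le => e e0; near=> t.
have -> : G s (y s) - G t (y t) = (G s (y s) - G t (y s)) + (G t (y s) - G t (y t)).
  by rewrite addrA subrK.
rewrite [e]splitr; apply: le_trans (ler_normD _ _) _; apply: lerD.
  near: t; have /cvgrPdist_le := @Gc (y s) s.
  by apply; rewrite divr_gt0.
apply: le_trans (GL _ _ _) _; rewrite mulrC -ler_pdivlMr //.
near: t; have /cvgrPdist_le := cy s.
by apply; rewrite !divr_gt0.
Unshelve. all: by end_near. Qed.

Hypothesis Gb : forall z, exists M, forall s, `|G s z| <= M.

(** In the norm weighted by [expR (2 L |s - s0|)] successive iterates are closer by a
    factor 2, uniformly in time: the solution is global at once. *)
Lemma picard (s0 : R) (z0 : 'rV[R]_n) : exists2 y : R -> 'rV[R]_n,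
  y s0 = z0 & forall s : R, is_derive s 1 y (G s (y s)).
Proof.
have /choice[Phi hPhi] : forall y : R -> 'rV[R]_n, exists Y : R -> 'rV[R]_n,
    continuous y -> Y s0 = z0 /\ forall s : R, is_derive s 1 Y (G s (y s)).
  move=> y; have [cy|ncy] := pselect (continuous y); last by exists y.
  have [Y ? ?] := vec_antiderivative s0 z0 (field_continuous cy).
  by exists Y.
pose y k := iter k Phi (fun=> z0).
have cy k : continuous (y k).
  elim: k => [|k ih]; first by move=> s; exact: cvg_cst.
  have [_ h] := hPhi _ ih; exact: is_derive_continuous h.
have y0 k : y k s0 = z0 by case: k => [|k] //; have [] := hPhi _ (cy k).
have dy k (s : R) : is_derive s 1 (y k.+1) (G s (y k s)).
  by have [] := hPhi _ (cy k).
have [M0 hM0] := Gb z0.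
pose K := 2 * L; have K0 : 0 < K by rewrite mulr_gt0.
pose E s := expR (K * `|s - s0|).
have E1 s : 1 <= E s.
  have := expR_ge1Dx (K * `|s - s0|).
  have : 0 <= K * `|s - s0| by rewrite mulr_ge0 // ltW.
  by rewrite /E; lra.
pose M := `|M0| / K.
have M_ge0 : 0 <= M by rewrite divr_ge0 // ltW.
have p2 k : 0 < (2 : R) ^+ k by rewrite exprn_gt0.
have grow (Y dY : R -> 'rV[R]_n) (C : R) : 0 <= C -> Y s0 = 0 ->
    (forall s : R, is_derive s 1 Y (dY s)) ->
    (forall s, `|dY s| <= L * (2 * C * E s)) -> forall s, `|Y s| <= C * E s.
  move=> C0 Y0 hY hdY s; have := @exp_growth_vec _ Y dY s0 K C K0 C0 hY.
  rewrite Y0 => h; have := h _ s; rewrite subr0; apply => t.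
  by apply: le_trans (hdY t) _; rewrite le_eqVlt; apply/orP; left; apply/eqP; rewrite /K /E; ring.
have step k : forall s, `|y k.+1 s - y k s| <= M / 2 ^+ k * E s.
  elim: k => [|k ih] s.
    apply: (grow (fun s => y 1%N s - y 0%N s) (fun s => G s z0)) => //.
    - by rewrite expr0 divr1.
    - by rewrite !y0 subrr.
    - move=> t; have h1 := dy 0%N t; have h2 : is_derive t 1 (y 0%N) 0.
        exact: is_derive_cst.
      by have := der_vecB h1 h2; rewrite subr0.
    - move=> t; apply: le_trans (hM0 t) _; apply: le_trans (ler_norm _) _.
      rewrite expr0 divr1.
      have -> : L * (2 * M * E t) = `|M0| * E t.
        by rewrite /M /K; field; rewrite gt_eqF.
      by rewrite ler_peMr.
  apply: (grow (fun s => y k.+2 s - y k.+1 s)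
    (fun s => G s (y k.+1 s) - G s (y k s))) => //.
  - by rewrite divr_ge0 // ltW.
  - by rewrite !y0 subrr.
  - move=> t; apply: le_trans (GL _ _ _) _; rewrite ler_pM2l //.
    apply: le_trans (ih t) _; rewrite le_eqVlt; apply/orP; left; apply/eqP.
    by rewrite exprS; field; rewrite expf_neq0.
have /choice[z hz] : forall s, exists l, forall k, `|y k s - l| <= 2 * (M * E s) / 2 ^+ k.
  move=> s; apply: geometric_limit_vec => k.
  by apply: le_trans (step k s) _; rewrite mulrAC.
have cz : continuous z.
  move=> s; apply/cvgrPdist_le => e e0.
  have e30 : 0 < e / 3 by rewrite divr_gt0.
  have [k hk] := small_geometric (2 * (M * expR (K * (`|s - s0| + 1)))) e30.
  near=> t.
  have hE r : `|r - s0| <= `|s - s0| + 1 -> `|y k r - z r| <= e / 3.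
    move=> hr; apply: le_trans (hz r k) _; apply: le_trans hk.
    rewrite ler_pM2r ?invr_gt0 // ler_pM2l // ler_wpM2l // ler_expR ler_pM2l //.
  have -> : z s - z t = (z s - y k s) + (y k s - y k t) + (y k t - z t).
    by rewrite !subrKA.
  have -> : e = e / 3 + e / 3 + e / 3 by field.
  apply: le_trans (ler_normD _ _) _; apply: lerD; last first.
    apply: hE.
    have -> : t - s0 = (s - s0) - (s - t) by ring.
    apply: le_trans (ler_normB _ _) _; rewrite lerD2l.
    by near: t; apply: cvgr_dist_le.
  apply: le_trans (ler_normD _ _) _; apply: lerD.
    by rewrite distrC; apply: hE; lra.
  by near: t; have /cvgrPdist_le := cy k s; apply.
have [Y0 dY] := hPhi _ cz.
move: (Phi z) Y0 dY => Y Y0 dY.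
suff YE : Y = z by exists Y => // s; have := dY s; rewrite -YE.
apply/funext => s; apply/eqP; rewrite -subr_eq0 -normr_le0.
apply/ler_addgt0Pr => e e0; rewrite add0r.
have [k hk] := small_geometric (3 * (M * E s)) e0.
apply: le_trans hk.
have h1 : `|Y s - y k.+1 s| <= M / 2 ^+ k * E s.
  apply: (grow (fun s => Y s - y k.+1 s)
    (fun s => G s (z s) - G s (y k s))) => //.
  - by rewrite divr_ge0 // ltW.
  - by rewrite Y0 y0 subrr.
  - move=> t; apply: le_trans (GL _ _ _) _; rewrite ler_pM2l // distrC.
    apply: le_trans (hz t k) _; rewrite le_eqVlt; apply/orP; left; apply/eqP.
    by field; rewrite expf_neq0.
have -> : Y s - z s = (Y s - y k.+1 s) + (y k.+1 s - z s).
  by rewrite addrA subrK.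
apply: le_trans (ler_normD _ _) _.
have -> : 3 * (M * E s) / 2 ^+ k = M / 2 ^+ k * E s + 2 * (M * E s) / 2 ^+ k.
  by field; rewrite expf_neq0.
apply: lerD => //; apply: le_trans (hz s k.+1) _.
apply: ler_wpM2l.
  by do 2 (apply: mulr_ge0 => //); exact: expR_ge0.
by rewrite lef_pV2 ?posrE // exprS ler_peMl ?(ltW (p2 k)) // ler1n.
Unshelve. all: by end_near. Qed.

End fixed_field.
End picard.

(** * Gradients and one-sided gradients *)
Section limits.
Variables (R : realType) (n : nat).
Implicit Types (f : 'rV[R]_n -> R) (x p : 'rV[R]_n).

Lemma superdiff_le f x p : superdiff f x p -> forall e, 0 < e ->
  exists2 r, 0 < r & forall h, `|h| < r ->
    f (x + h) - f x - dotv p h <= e * enorm h.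
Proof.
rewrite /superdiff /= limf_esupE => hp e e0.
have /ereal_inf_lt[_ [V Vx <-] hV] := le_lt_trans hp (e0 : (0%:E < e%:E)%E).
move: Vx; rewrite /nbhs /= /dnbhs /within /= => /nbhs_ballP[r /= r0 hr].
exists r => // h hr'.
have [->|h0] := eqVneq h 0.
  by rewrite addr0 subrr dotv0r subr0 /enorm dotv0r sqrtr0 mulr0.
have xh : V (x + h).
  apply: hr; last by rewrite -subr_eq0 [x + h]addrC addrK.
  by rewrite -ball_normE /ball_ /= opprD addrA subrr sub0r normrN.
have eh : 0 < enorm h.
  by rewrite lt_neqAle enorm_ge0 andbT eq_sym; apply: contra_neq h0; exact: enorm0_eq.
rewrite -ler_pdivrMr // -lee_fin; apply: (@le_trans _ _ (ereal_sup
   ((fun y => ((f y - f x - dotv p (y - x)) / enorm (y - x))%:E) @` V))).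
  apply: ereal_sup_ubound; exists (x + h) => //.
  by rewrite [x + h]addrC addrK.
exact: ltW.
Qed.

Lemma subdiff_ge f x p : subdiff f x p -> forall e, 0 < e ->
  exists2 r, 0 < r & forall h, `|h| < r ->
    - (e * enorm h) <= f (x + h) - f x - dotv p h.
Proof.
rewrite /subdiff /= => hp e e0.
have : superdiff (fun y => - f y) x (- p).
  move: hp; rewrite /limf_einf oppe_ge0 /superdiff /= => h.
  apply: le_trans h; rewrite le_eqVlt; apply/orP; left; apply/eqP.
  congr limf_esup; apply/funext => y /=.
  by congr EFin; rewrite dotvNl -mulNr; congr (_ / _); ring.
move=> /superdiff_le/(_ e e0)[r r0 hr]; exists r => // h /hr.
by rewrite dotvNl; lra.
Qed.

End limits.

Section gradients.
Variable R : realType.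

Lemma diff_eps (V W : normedModType R) (f : V -> W) (x : V) : differentiable f x ->
  forall e, 0 < e -> exists2 r, 0 < r & forall h, `|h| < r ->
    `|f (x + h) - f x - 'd f x h| <= e * `|h|.
Proof.
move=> df e e0; have /eqaddoP/(_ e e0) := diff_locally df.
rewrite near_simpl => /nbhs_ballP[r /= r0 hr]; exists r => // h hr'.
have := hr h; rewrite -ball_normE /ball_ /= sub0r normrN => /(_ hr') /=.
by rewrite !fctE /= [h + x]addrC opprD addrA.
Qed.

Lemma diff_of_linear (V W : normedModType R) (f : V -> W) (x : V)
    (A : {linear V -> W}) : continuous A ->
  (forall e, 0 < e -> exists2 r, 0 < r & forall h, `|h| < r ->
    `|f (x + h) - f x - A h| <= e * `|h|) ->
  differentiable f x /\ 'd f x = A :> (V -> W).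
Proof.
move=> cA hf.
have fA : f \o shift x = cst (f x) + A +o_ 0 id.
  apply/eqaddoP => e e0; have [r r0 hr] := hf e e0.
  apply/nbhs_ballP; exists r => //= h; rewrite -ball_normE /ball_ /= sub0r normrN => hr'.
  have := hr h hr'; rewrite !fctE /= [h + x]addrC.
  by rewrite opprD addrA.
have dA := diff_unique cA fA.
by split => //; apply/diff_locallyP; rewrite dA.
Qed.

Lemma diff_near_eps (n m : nat) (f : 'rV[R]_n -> 'rV[R]_m) (x : 'rV[R]_n) : differentiable f x ->
  forall e, 0 < e -> exists2 r, 0 < r & forall h, `|h| < r ->
    `|f (x + h) - f x - h *m ('J f x)| <= e * `|h|.
Proof.
move=> df e e0; have [r r0 hr] := diff_eps df e0; exists r => // h hr'.
by have := hr h hr'; rewrite -(deriveE _ df) deriveEjacobian.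
Qed.

Lemma mulmx_bounded (n m : nat) (M : 'M[R]_(n, m)) :
  exists2 C, 0 < C & forall v : 'rV[R]_n, `|v *m M| <= C * `|v|.
Proof.
exists (1 + \sum_(i < n) \sum_(j < m) `|M i j|).
  rewrite ltr_pwDl //; apply: sumr_ge0 => i _; exact: sumr_ge0.
move=> v; apply: norm_coordP.
  rewrite mulr_ge0 // addr_ge0 //; apply: sumr_ge0 => i _; exact: sumr_ge0.
move=> j; rewrite mxE; apply: le_trans (ler_norm_sum _ _ _) _.
rewrite mulrDl mul1r; apply: (@le_trans _ _ ((\sum_i \sum_j0 `|M i j0|) * `|v|)); last by rewrite lerDr.
rewrite mulr_suml; apply: ler_sum => i _; rewrite normrM mulrC.
apply: ler_pM => //; last exact: norm_coord_le.
by rewrite (bigD1 j) //= lerDl sumr_ge0.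
Qed.

Lemma mulmx_continuous (n m : nat) (M : 'M[R]_(n, m)) :
  continuous (fun v : 'rV[R]_n => v *m M).
Proof.
move=> x; have [C C0 hC] := mulmx_bounded M.
apply/(@cvgrPdist_le _ _ _ (nbhs x)) => e e0; apply/nbhs_ballP.
exists (e / C); first by rewrite /= divr_gt0.
move=> y; rewrite -ball_normE /ball_ /= => /ltW hy.
by rewrite -mulmxBl; apply: le_trans (hC _) _; rewrite mulrC -ler_pdivlMr.
Qed.

Lemma diff_of_eps (n m : nat) (f : 'rV[R]_n -> 'rV[R]_m) (x : 'rV[R]_n) (M : 'M[R]_(n, m)) :
  (forall e, 0 < e -> exists2 r, 0 < r & forall h, `|h| < r ->
    `|f (x + h) - f x - h *m M| <= e * `|h|) ->
  differentiable f x /\ 'J f x = M.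
Proof.
move=> hf; pose A : {linear 'rV[R]_n -> 'rV[R]_m} := mulmxr M.
have cA : continuous A by exact: mulmx_continuous.
have [df dA] := diff_of_linear cA hf.
split => //; apply/row_matrixP => i; rewrite !rowE.
by rewrite -deriveEjacobian // deriveE // dA.
Qed.

(** Differentiability with a given gradient, in the form that splits into the
    one-sided bounds [lower_grad] and [upper_grad]. *)
Definition has_grad (n : nat) (f : 'rV[R]_n -> R) (x q : 'rV[R]_n) : Prop :=
  forall e, 0 < e -> exists2 r, 0 < r & forall h, `|h| < r ->
    `|f (x + h) - f x - dotv q h| <= e * `|h|.

Lemma has_grad_unique n (f : 'rV[R]_n -> R) (x q q' : 'rV[R]_n) :
  has_grad f x q -> has_grad f x q' -> q = q'.
Proof.
move=> hq hq'; apply/rowP => i; apply/eqP; rewrite -subr_eq0 -normr_le0.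
apply/ler_addgt0Pr => e e0; rewrite add0r.
have e20 : 0 < e / 2 by rewrite divr_gt0.
have [r r0 hr] := hq _ e20; have [s s0 hs] := hq' _ e20.
pose d := Num.min r s / 2.
have d0 : 0 < d by rewrite divr_gt0 // lt_min r0.
have dr : d < r by rewrite /d ltr_pdivrMr // gt_min; apply/orP; left; lra.
have ds : d < s by rewrite /d ltr_pdivrMr // gt_min; apply/orP; right; lra.
pose h : 'rV[R]_n := d *: delta_mx 0 i.
have nh : `|h| <= d.
  apply: norm_coordP; first exact: ltW.
  move=> j; rewrite !mxE; case: eqP => _; case: eqP => _ /=;
  by rewrite ?mulr1 ?mulr0 ?normr0 ?gtr0_norm // ltW.
have := hr h (le_lt_trans nh dr); have := hs h (le_lt_trans nh ds).
rewrite !dotvZr !dotv_delta => h1 h2.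
have k1 : e / 2 * `|h| <= e / 2 * d by rewrite ler_pM2l.
have : `|d * (q 0 i - q' 0 i)| <= e * d.
  move: (le_trans h1 k1) (le_trans h2 k1); rewrite !ler_norml mulrBr.
  by move=> /andP[? ?] /andP[? ?]; apply/andP; split; lra.
by rewrite normrM gtr0_norm // mulrC ler_pM2r.
Qed.

Lemma has_gradP n (f : 'rV[R]_n -> R) (x q : 'rV[R]_n) :
  has_grad f x q <-> differentiable f x /\ grad f x = q.
Proof.
have key : has_grad f x q -> differentiable f x.
  move=> hf.
  have [|df _] := @diff_of_eps n 1 (fun y => (f y)%:M) x q^T.
    move=> e e0; have [r r0 hr] := hf e e0; exists r => // h hr'.
    apply: le_trans (hr h hr'); apply: norm_coordP => // i.
    rewrite [i]ord1 !mxE eqxx !mulr1n dotvC.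
    by under eq_bigr do rewrite mxE.
  have -> : f = (fun N : 'rV[R]_1 => N 0 0) \o (fun y : 'rV[R]_n => (f y)%:M).
    by apply: funext => y /=; rewrite mxE eqxx mulr1n.
  exact: (differentiable_comp df (differentiable_coord _ 0 0)).
have key2 : differentiable f x -> has_grad f x (grad f x).
  move=> df e e0; have [r r0 hr] := diff_eps df e0; exists r => // h hr'.
  apply: le_trans (hr h hr').
  suff -> : dotv (grad f x) h = 'd f x h by [].
  rewrite [in RHS](row_sum_delta h) linear_sum; apply: eq_bigr => j _.
  by rewrite linearZ mxE deriveE // mulrC.
split=> [hf|[df <-]]; last exact: key2.
have df := key hf; split => //.
exact: has_grad_unique (key2 df) hf.
Qed.

Lemma dotv_grad n (f : 'rV[R]_n -> R) (x v : 'rV[R]_n) : differentiable f x ->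
  dotv (grad f x) v = 'D_v f x.
Proof.
move=> df; rewrite deriveE // [in RHS](row_sum_delta v) linear_sum.
by apply: eq_bigr => j _; rewrite linearZ mxE deriveE // mulrC.
Qed.

Lemma derive_along n (f : 'rV[R]_n -> R) (z h : 'rV[R]_n) (t : R) :
  differentiable f (z + t *: h) ->
  is_derive t 1 (fun s : R => f (z + s *: h)) (dotv (grad f (z + t *: h)) h).
Proof.
move=> df; have g : is_derive t 1 (fun s : R => z + s *: h) h.
  apply/is_derive_coordP => i.
  have -> : (fun s : R => (z + s *: h) 0 i) = (fun s : R => z 0 i + h 0 i * s).
    by apply/funext => s; rewrite !mxE mulrC.
  apply: (der_eq (derD (der_cst _ t) (derZ _ (is_derive_id t 1)))).
  by rewrite add0r mulr1.
have dg : differentiable (fun s : R => z + s *: h) t.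
  by apply/derivable1_diffP; case: g.
have dfg : differentiable (f \o (fun s : R => z + s *: h)) t.
  exact: differentiable_comp.
apply: DeriveDef; first exact/derivable1_diffP.
rewrite deriveE // diff_comp //= dotv_grad // deriveE //; congr ('d f _ _).
by rewrite -deriveE //; case: g.
Qed.

Lemma mvt_grad n (f : 'rV[R]_n -> R) (z h : 'rV[R]_n) :
  (forall t : R, 0 <= t <= 1 -> differentiable f (z + t *: h)) ->
  exists2 t : R, 0 <= t <= 1 & f (z + h) - f z = dotv (grad f (z + t *: h)) h.
Proof.
move=> df.
have [||t] := @MVT_segment R (fun s : R => f (z + s *: h))
  (fun s => dotv (grad f (z + s *: h)) h) 0 1 ler01.
- move=> t; rewrite in_itv /= => /andP[t0 t1]; apply: derive_along.
  by apply: df; rewrite !ltW.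
- apply: derivable_within_continuous => t; rewrite in_itv /= => t01.
  by have := derive_along (df t t01) => -[].
- rewrite in_itv /= => t01; rewrite scale1r scale0r addr0 subr0 mulr1 => ->.
  by exists t.
Qed.

(** The mean value theorem on segments: the gradient varies little near [z0]. *)
Lemma strict_diff n (Om : set 'rV[R]_n) (f : 'rV[R]_n -> R) (z0 : 'rV[R]_n) :
  open Om -> C1_on Om f -> Om z0 ->
  forall e, 0 < e -> exists2 r, 0 < r &
    forall z, `|z - z0| < r -> Om z /\ forall z', `|z' - z0| < r ->
      `|f z' - f z - dotv (grad f z0) (z' - z)| <= e * `|z' - z|.
Proof.
move=> oO c1 Oz0 e e0.
have e1 : 0 < e / n.+1%:R by rewrite divr_gt0.
have [r r0 hr] : exists2 r, 0 < r & forall z, `|z - z0| < r -> Om z /\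
    forall i, `|grad f z 0 i - grad f z0 0 i| <= e / n.+1%:R.
  have : \forall z \near z0, Om z /\
      forall i, `|grad f z 0 i - grad f z0 0 i| <= e / n.+1%:R.
    near=> z; split; first by near: z; exact: open_nbhs_nbhs.
    near: z; apply: filter_forall => i.
    have [_ /(_ (delta_mx 0 i)) ci] := c1 z0 Oz0.
    near=> z; rewrite !mxE distrC; near: z.
    by move/cvgrPdist_le : ci; apply.
  move=> /nbhs_ballP[r /= r0 hr]; exists r => // z hz; apply: hr.
  by rewrite -ball_normE /ball_ /= distrC.
exists r => // z hz; split; first by have [] := hr z hz.
move=> z' hz'.
have seg (t : R) : 0 <= t <= 1 -> `|z + t *: (z' - z) - z0| < r.
  move=> /andP[t0 t1].
  have -> : z + t *: (z' - z) - z0 = (1 - t) *: (z - z0) + t *: (z' - z0).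
    by apply/rowP => i; rewrite !mxE; ring.
  apply: le_lt_trans (ler_normD _ _) _; rewrite !normrZ.
  rewrite (ger0_norm t0) ger0_norm ?subr_ge0 //.
  have [->|tn0] := eqVneq t 0; first by rewrite mul0r addr0 subr0 mul1r.
  have t00 : 0 < t by rewrite lt_neqAle eq_sym tn0.
  have h1 : (1 - t) * `|z - z0| <= (1 - t) * r.
    by rewrite ler_wpM2l ?subr_ge0 // ltW.
  have h2 : t * `|z' - z0| < t * r by rewrite ltr_pM2l.
  by have -> : r = (1 - t) * r + t * r; [ring|exact: ler_ltD].
have [|t t01] := @mvt_grad n f z (z' - z).
  by move=> t t01; have [Ot _] := hr _ (seg t t01); have [] := c1 _ Ot.
have -> : z + (z' - z) = z' by rewrite addrC subrK.
move=> ->; rewrite -dotvBl.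
apply: le_trans (dotv_abs_le _ _) _; rewrite ler_wpM2r //.
have [_ hg] := hr _ (seg t t01).
apply: (@le_trans _ _ (n%:R * (e / n.+1%:R))).
  rewrite ler_wpM2l //; apply: norm_coordP; first exact: ltW.
  by move=> i; move: (hg i); rewrite !mxE.
by rewrite mulrA ler_pdivrMr // mulrC ler_pM2l // ler_nat.
Unshelve. all: by end_near. Qed.

(** Compactness of the time interval, through [real_induction]. *)
Lemma compact_uniform (a b : R) (P : R -> R -> Prop) :
  (forall t rho rho', P t rho -> 0 < rho' -> rho' <= rho -> P t rho') ->
  (forall s, a <= s <= b -> exists2 r, 0 < r & exists2 rho, 0 < rho &
     forall t, a <= t <= b -> `|t - s| < r -> P t rho) ->
  exists2 rho, 0 < rho & forall t, a <= t <= b -> P t rho.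
Proof.
move=> mono loc.
have [ab|ba] := leP a b; last by exists 1 => // t /andP[? ?]; exfalso; lra.
pose Q x := exists2 rho, 0 < rho & forall t, a <= t <= x -> P t rho.
apply: (@real_induction R a b Q ab).
  have [|r r0 [rho rho0 h]] := loc a; first by rewrite lexx.
  exists rho => // t /andP[at_ ta]; have -> : t = a by apply/le_anti; rewrite ta.
  by apply: h; [rewrite lexx ab|rewrite subrr normr0].
move=> s sab; have [r r0 [rho rho0 h]] := loc s sab.
exists r => // u v au us sv vb sr vr [rho1 rho10 h1].
exists (Num.min rho rho1); first by rewrite lt_min rho0.
have m0 : 0 < Num.min rho rho1 by rewrite lt_min rho0.
move=> t /andP[at_ tv]; have [tu|ut] := leP t u.
  apply: (mono t rho1) => //; last by rewrite ge_min lexx orbT.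
  by apply: h1; rewrite at_.
apply: (mono t rho) => //; last by rewrite ge_min lexx.
apply: h; first by rewrite at_ (le_trans tv).
by rewrite ltr_norml; apply/andP; split; lra.
Qed.

End gradients.

Section one_sided_gradients.
Variables (R : realType) (n : nat).
Implicit Types (f : 'rV[R]_n -> R) (x q : 'rV[R]_n).

Definition lower_grad f x q : Prop := forall e, 0 < e ->
  exists2 r, 0 < r & forall h, `|h| < r -> - (e * `|h|) <= f (x + h) - f x - dotv q h.

Definition upper_grad f x q : Prop := forall e, 0 < e ->
  exists2 r, 0 < r & forall h, `|h| < r -> f (x + h) - f x - dotv q h <= e * `|h|.

Lemma two_radii (P Q : R -> Prop) :
  (exists2 r, 0 < r & P r) -> (exists2 r, 0 < r & Q r) ->
  exists r s, [/\ 0 < Num.min r s, Num.min r s <= r, Num.min r s <= s, P r & Q s].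
Proof.
move=> [r r0 hr] [s s0 hs]; exists r, s.
by rewrite lt_min r0 s0 !ge_min !lexx orbT.
Qed.

Lemma has_grad_lower_upper f x q :
  lower_grad f x q -> upper_grad f x q -> has_grad f x q.
Proof.
move=> hl hu e e0; have [r [s [m0 mr ms hr hs]]] := two_radii (hl e e0) (hu e e0).
exists (Num.min r s) => // h hm; rewrite ler_norml hr ?hs //; exact: lt_le_trans hm _.
Qed.

Lemma has_grad_lower f x q : has_grad f x q -> lower_grad f x q.
Proof.
move=> hf e e0; have [r r0 hr] := hf e e0; exists r => // h /hr.
by rewrite ler_norml => /andP[].
Qed.

Lemma has_grad_upper f x q : has_grad f x q -> upper_grad f x q.
Proof.
move=> hf e e0; have [r r0 hr] := hf e e0; exists r => // h /hr.
by rewrite ler_norml => /andP[].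
Qed.

(** The difference of the two is bounded above by [o(|h|)] at [h] and at [- h], hence
    is the gradient of the zero function. *)
Lemma lower_upper_eq f x q q' : lower_grad f x q -> upper_grad f x q' -> q = q'.
Proof.
move=> hl hu; suff hg : has_grad (fun=> 0) 0 (q - q').
  suff h0 : has_grad (fun=> 0) 0 (0 : 'rV[R]_n).
    by apply/eqP; rewrite -subr_eq0; apply/eqP; exact: has_grad_unique hg h0.
  by move=> e e0; exists 1 => // h _; rewrite dotv0l !subr0 normr0 mulr_ge0 // ltW.
move=> e e0; have e20 : 0 < e / 2 by rewrite divr_gt0.
have [r [s [m0 mr ms hr hs]]] := two_radii (hl _ e20) (hu _ e20).
exists (Num.min r s) => // h hm.
have H k : `|k| < Num.min r s -> dotv (q - q') k <= e * `|k|.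
  move=> hk; have := hr k (lt_le_trans hk mr); have := hs k (lt_le_trans hk ms).
  rewrite dotvBl; have -> : e * `|k| = e / 2 * `|k| + e / 2 * `|k| by field.
  lra.
have := H _ hm; have := H (- h); rewrite normrN dotvNr => /(_ hm) h1 h2.
by rewrite subrr sub0r normrN ler_norml; apply/andP; split; lra.
Qed.

Lemma superdiff_upper_grad f x q : superdiff f x q -> upper_grad f x q.
Proof.
move=> hq e e0; have e1 : 0 < e / n.+1%:R by rewrite divr_gt0.
have [r r0 hr] := superdiff_le hq e1; exists r => // h /hr /le_trans; apply.
apply: (@le_trans _ _ (e / n.+1%:R * (n%:R * `|h|))).
  by rewrite ler_pM2l // enorm_le.
rewrite mulrA ler_wpM2r // mulrAC ler_pdivrMr // ler_pM2l //.
by rewrite ler_nat.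
Qed.

Lemma subdiff_lower_grad f x q : subdiff f x q -> lower_grad f x q.
Proof.
move=> hq e e0; have e1 : 0 < e / n.+1%:R by rewrite divr_gt0.
have [r r0 hr] := subdiff_ge hq e1; exists r => // h /hr; apply: le_trans.
rewrite lerN2; apply: (@le_trans _ _ (e / n.+1%:R * (n%:R * `|h|))).
  by rewrite ler_pM2l // enorm_le.
rewrite mulrA ler_wpM2r // mulrAC ler_pdivrMr // ler_pM2l //.
by rewrite ler_nat.
Qed.

(** Used to gather finitely many coordinates. *)
Lemma finite_radius (m : nat) (P : 'I_m -> R -> Prop) :
  (forall k r r', P k r -> 0 < r' -> r' <= r -> P k r') ->
  (forall k, exists2 r, 0 < r & P k r) -> exists2 r, 0 < r & forall k, P k r.
Proof.
move=> mono hP.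
have /choice[r hr] : forall k, exists r, 0 < r /\ P k r.
  by move=> k; have [r ? ?] := hP k; exists r.
pose r0 := \big[Num.min/1]_k r k.
have r00 : 0 < r0.
  by rewrite /r0; elim/big_ind: _ => // [x y ? ?|k _]; [rewrite lt_min; apply/andP|case: (hr k)].
exists r0 => // k; have [? hk] := hr k; apply: mono hk _ _ => //.
by rewrite /r0 (bigD1 k) //= ge_min lexx.
Qed.

End one_sided_gradients.

(** * The Hamiltonian and its vector field on phase space *)
Section row_blocks.
Variables (R : realType) (n : nat).

Lemma norm_lsubmx_le (Z : 'rV[R]_(n + n)) : `|lsubmx Z| <= `|Z|.
Proof. by apply: norm_coordP => // i; rewrite mxE norm_coord_le. Qed.

Lemma norm_rsubmx_le (Z : 'rV[R]_(n + n)) : `|rsubmx Z| <= `|Z|.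
Proof. by apply: norm_coordP => // i; rewrite mxE norm_coord_le. Qed.

Lemma norm_row_mx_le (x p : 'rV[R]_n) (c : R) :
  `|x| <= c -> `|p| <= c -> `|row_mx x p| <= c.
Proof.
move=> hx hp; apply: norm_coordP; first exact: le_trans hx.
move=> i; case: (split_ordP i) => j ->; rewrite ?row_mxEl ?row_mxEr.
  exact: le_trans (norm_coord_le _ _) hx.
exact: le_trans (norm_coord_le _ _) hp.
Qed.

Lemma norm_row_mx0 (x : 'rV[R]_n) : `|row_mx x (0 : 'rV[R]_n)| = `|x|.
Proof.
apply/le_anti; rewrite norm_row_mx_le //= ?normr0 //.
by have := norm_lsubmx_le (row_mx x 0); rewrite row_mxKl.
Qed.

Lemma norm_row_0mx (p : 'rV[R]_n) : `|row_mx (0 : 'rV[R]_n) p| = `|p|.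
Proof.
apply/le_anti; rewrite norm_row_mx_le //= ?normr0 //.
by have := norm_rsubmx_le (row_mx 0 p); rewrite row_mxKr.
Qed.

Lemma row_mxB (x y p q : 'rV[R]_n) : row_mx x p - row_mx y q = row_mx (x - y) (p - q).
Proof. by rewrite opp_row_mx add_row_mx. Qed.

End row_blocks.

Section hamiltonian_support.
Variables (R : realType) (n : nat) (F : 'rV[R]_n -> set 'rV[R]_n).
Hypothesis F_nonempty_compact : forall x, F x !=set0 /\ compact (F x).
Let H := hamiltonian F.

Lemma dotv_continuous (p : 'rV[R]_n) : continuous (fun v : 'rV[R]_n => dotv v p).
Proof.
move=> x; apply/(@cvgrPdist_le _ _ _ (nbhs x)) => e e0; apply/nbhs_ballP.
pose C := n%:R * `|p| + 1; have C0 : 0 < C by rewrite /C ltr_wpDl // mulr_ge0.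
exists (e / C); first by rewrite /= divr_gt0.
move=> y; rewrite -ball_normE /ball_ /= => /ltW hy.
rewrite -dotvBl; apply: le_trans (dotv_abs_le _ _) _.
rewrite mulrAC; apply: (@le_trans _ _ (C * `|x - y|)).
  by rewrite ler_wpM2r // /C lerDl.
by rewrite mulrC -ler_pdivlMr.
Qed.

Lemma hamiltonian_max x p : exists v, [/\ F x v, H x p = dotv v p &
  forall w, F x w -> dotv w p <= H x p].
Proof.
have [Fn Fc] := F_nonempty_compact x.
have [v Fv hv] := EVT_max_rV Fn Fc (continuous_subspaceT (@dotv_continuous p)).
have Hv : H x p = dotv v p.
  apply/le_anti; apply/andP; split.
    apply: sup_le_ub; first by have [w Fw] := Fn; exists (dotv w p), w.
    by move=> _ [w Fw <-]; apply: hv; rewrite inE.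
  apply: sup_upper_bound; last by exists v => //; rewrite inE in Fv.
  split; first by have [w Fw] := Fn; exists (dotv w p), w.
  by exists (dotv v p) => _ [w Fw <-]; apply: hv; rewrite inE.
rewrite inE in Fv; exists v; split => // w Fw; rewrite Hv.
by apply: hv; rewrite inE.
Qed.

Lemma hamiltonian_ge x p v : F x v -> dotv v p <= H x p.
Proof. by have [w [_ _ h]] := hamiltonian_max x p; exact: h. Qed.

(** For a maximizing velocity [v], the function [q |-> H x q - dotv v q] is minimal
    at [p], so [v] is the gradient. *)
Lemma hamiltonian_grad_in x p : differentiable (H x) p ->
  F x (grad (H x) p) /\ H x p = dotv (grad (H x) p) p.
Proof.
move=> dH; have [v [Fv Hv _]] := hamiltonian_max x p.
have hg : has_grad (H x) p (grad (H x) p) by apply/has_gradP.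
have -> : grad (H x) p = v.
  apply/esym/lower_upper_eq; last exact: has_grad_upper hg.
  move=> e e0; exists 1 => // h _.
  have := hamiltonian_ge (p + h) Fv; rewrite dotvDr -Hv.
  have : 0 <= e * `|h| by rewrite mulr_ge0 // ltW.
  lra.
by [].
Qed.

End hamiltonian_support.

Section hamiltonian_field.
Variables (R : realType) (n : nat) (H : 'rV[R]_n -> 'rV[R]_n -> R).
Let Hh (Z : 'rV[R]_(n + n)) := H (lsubmx Z) (rsubmx Z).
Let Hp (xp : 'rV[R]_n * 'rV[R]_n) := H xp.1 xp.2.

Definition ham_dom : set 'rV[R]_(n + n) := [set Z | rsubmx Z != 0].

(** Positions and costates are concatenated into one row vector, so that the
    Hamiltonian system is a single equation [Z' = ham_field Z]. *)
Definition ham_field (Z : 'rV[R]_(n + n)) : 'rV[R]_(n + n) :=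
  row_mx (grad (H (lsubmx Z)) (rsubmx Z))
    (- grad (H^~ (rsubmx Z)) (lsubmx Z)).

Lemma ham_fieldE (x p : 'rV[R]_n) :
  ham_field (row_mx x p) = row_mx (grad (H x) p) (- grad (H^~ p) x).
Proof. by rewrite /ham_field row_mxKl row_mxKr. Qed.

(** Smoothness of [H] is assumed on a product of spaces; directional derivatives
    are carried to phase space by the linear isomorphism. *)
Lemma derive_pair (u Z : 'rV[R]_(n + n)) :
  'D_u Hh Z = 'D_(lsubmx u, rsubmx u) Hp (lsubmx Z, rsubmx Z).
Proof.
rewrite /derive; congr (lim (_ @ 0^')); apply/funext => h.
by rewrite /= /Hh /Hp /=; rewrite !linearD !linearZ.
Qed.

Lemma derive_p (v x p : 'rV[R]_n) : 'D_v (H x) p = 'D_(row_mx 0 v) Hh (row_mx x p).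
Proof.
rewrite /derive; congr (lim (_ @ 0^')); apply/funext => h.
rewrite /= /Hh scale_row_mx scaler0 add_row_mx add0r !row_mxKl !row_mxKr.
by [].
Qed.

Lemma derive_x (v x p : 'rV[R]_n) : 'D_v (H^~ p) x = 'D_(row_mx v 0) Hh (row_mx x p).
Proof.
rewrite /derive; congr (lim (_ @ 0^')); apply/funext => h.
rewrite /= /Hh scale_row_mx scaler0 add_row_mx add0r !row_mxKl !row_mxKr.
by [].
Qed.

Lemma ham_dom_open : open ham_dom.
Proof.
rewrite openE => Z /= hZ; have h0 : 0 < `|rsubmx Z| by rewrite normr_gt0.
apply/nbhs_ballP; exists `|rsubmx Z| => //= Z'; rewrite -ball_normE /ball_ /= => hZ'.
apply/negP => /eqP h; have := norm_rsubmx_le (Z - Z').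
by rewrite linearB /= h subr0 leNgt hZ'.
Qed.

Hypothesis H_C2 : C2_on [set xp : 'rV[R]_n * 'rV[R]_n | xp.2 != 0] Hp.

Lemma C1_pair (f : 'rV[R]_n * 'rV[R]_n -> R) :
  C1_on [set xp : 'rV[R]_n * 'rV[R]_n | xp.2 != 0] f ->
  C1_on ham_dom (fun Z => f (lsubmx Z, rsubmx Z)).
Proof.
move=> c1 Z hZ.
have dpair : differentiable (fun Z : 'rV[R]_(n + n) => (lsubmx Z, rsubmx Z)) Z.
  by apply: differentiable_pair; [exact: differentiable_lsubmx|exact: differentiable_rsubmx].
have [df cf] := c1 (lsubmx Z, rsubmx Z) hZ.
split; first exact: (differentiable_comp dpair df).
move=> u.
have -> : 'D_u (fun Z => f (lsubmx Z, rsubmx Z)) =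
    ('D_(lsubmx u, rsubmx u) f) \o (fun Z => (lsubmx Z, rsubmx Z)).
  apply/funext => Y; rewrite /derive /=; congr (lim (_ @ 0^')); apply/funext => h /=.
  by rewrite !linearD !linearZ.
apply: continuous_comp; last exact: cf.
exact: differentiable_continuous.
Qed.

Lemma C1_derive_ham u : C1_on ham_dom ('D_u Hh).
Proof.
have [_ c2] := H_C2; have := C1_pair (c2 (lsubmx u, rsubmx u)).
by congr C1_on; apply/funext => Z; rewrite derive_pair.
Qed.

Lemma ham_field_l Z i : ham_field Z 0 (lshift n i) = 'D_(delta_mx 0 (rshift n i)) Hh Z.
Proof.
rewrite row_mxEl mxE derive_p hsubmxK; congr ('D_ _ _ _).
apply/rowP => j; case: (split_ordP j) => k ->; rewrite ?row_mxEl ?row_mxEr !mxE.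
  by rewrite eqxx eq_lrshift.
by rewrite eqxx (inj_eq (@rshift_inj _ _)).
Qed.

Lemma ham_field_r Z i : ham_field Z 0 (rshift n i) = - 'D_(delta_mx 0 (lshift n i)) Hh Z.
Proof.
rewrite row_mxEr mxE mxE derive_x hsubmxK; congr (- 'D_ _ _ _).
apply/rowP => j; case: (split_ordP j) => k ->; rewrite ?row_mxEl ?row_mxEr !mxE.
  by rewrite eqxx (inj_eq (@lshift_inj _ _)).
by rewrite eqxx eq_rlshift.
Qed.

(** Strict differentiability with modulus: being uniform in both points, it makes the
    field Lipschitz near [Z0] and its Jacobian continuous at [Z0]. *)
Definition strict_jac (g : 'rV[R]_(n + n) -> 'rV[R]_(n + n)) Z0
    (J : 'M[R]_(n + n)) (e r : R) : Prop :=
  forall Z, `|Z - Z0| < r -> ham_dom Z /\ forall Z', `|Z' - Z0| < r ->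
    `|g Z' - g Z - (Z' - Z) *m J| <= e * `|Z' - Z|.

Lemma ham_field_strict_ex (Z0 : 'rV[R]_(n + n)) : ham_dom Z0 -> exists J : 'M[R]_(n + n),
  forall e, 0 < e -> exists2 r, 0 < r & strict_jac ham_field Z0 J e r.
Proof.
move=> Z0d.
have comp (k : 'I_(n + n)) : exists q : 'rV[R]_(n + n), forall e, 0 < e ->
    exists2 r, 0 < r & forall Z, `|Z - Z0| < r -> ham_dom Z /\
      forall Z', `|Z' - Z0| < r ->
      `|ham_field Z' 0 k - ham_field Z 0 k - dotv q (Z' - Z)| <= e * `|Z' - Z|.
  case: (split_ordP k) => i ->.
    pose u : 'rV[R]_(n + n) := delta_mx 0 (rshift n i).
    exists (grad ('D_u Hh) Z0) => e e0.
    have [r r0 hr] := strict_diff ham_dom_open (C1_derive_ham u) Z0d e0.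
    exists r => // Z hZ; have [OZ hZ2] := hr Z hZ; split => // Z' hZ'.
    by rewrite !ham_field_l; exact: hZ2.
  pose u : 'rV[R]_(n + n) := delta_mx 0 (lshift n i).
  exists (- grad ('D_u Hh) Z0) => e e0.
  have [r r0 hr] := strict_diff ham_dom_open (C1_derive_ham u) Z0d e0.
  exists r => // Z hZ; have [OZ hZ2] := hr Z hZ; split => // Z' hZ'.
  rewrite !ham_field_r dotvNl; apply: le_trans (hZ2 Z' hZ').
  by rewrite -[leRHS]normrN !opprD !opprK.
have /choice[q hq] := comp.
exists (\matrix_(j, k) q k 0 j) => e e0.
have [|k|r r0 hr] := @finite_radius R (n + n) (fun k r => forall Z, `|Z - Z0| < r ->
    ham_dom Z /\ forall Z', `|Z' - Z0| < r ->
    `|ham_field Z' 0 k - ham_field Z 0 k - dotv (q k) (Z' - Z)| <= e * `|Z' - Z|).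
- move=> k r r' h r'0 rr' Z hZ; have [OZ h2] := h Z (lt_le_trans hZ rr').
  by split => // Z' hZ'; apply: h2; exact: lt_le_trans rr'.
- exact: hq.
have [s s0 hs] : exists2 s, 0 < s & forall Z, `|Z - Z0| < s -> ham_dom Z.
  have /nbhs_ballP[s /= s0 hs] := open_nbhs_nbhs (conj ham_dom_open Z0d).
  by exists s => // Z hZ; apply: hs; rewrite -ball_normE /ball_ /= distrC.
exists (Num.min r s); first by rewrite lt_min r0.
move=> Z; rewrite lt_min => /andP[hZ hZs]; split; first exact: hs.
move=> Z'; rewrite lt_min => /andP[hZ' _]; apply: norm_coordP.
  by rewrite mulr_ge0 // ltW.
move=> k; have [_ h2] := hr k Z hZ; have := h2 Z' hZ'.
suff -> : (ham_field Z' - ham_field Z - (Z' - Z) *m \matrix_(j, k0) q k0 0 j) 0 k =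
  ham_field Z' 0 k - ham_field Z 0 k - dotv (q k) (Z' - Z) by [].
have eB (u v : 'rV[R]_(n + n)) : (u - v) 0 k = u 0 k - v 0 k by rewrite !mxE.
rewrite 2!eB; congr (_ - _); rewrite mxE dotvC; apply: eq_bigr => j _.
by rewrite [X in _ * X = _]mxE.
Qed.

Lemma ham_field_strict (Z0 : 'rV[R]_(n + n)) : ham_dom Z0 -> forall e, 0 < e ->
  exists2 r, 0 < r & strict_jac ham_field Z0 ('J ham_field Z0) e r.
Proof.
move=> Z0d; have [J hJ] := ham_field_strict_ex Z0d.
suff [_ ->] : differentiable ham_field Z0 /\ 'J ham_field Z0 = J by [].
apply: diff_of_eps => e e0; have [r r0 hr] := hJ e e0.
exists r => // h hh; have [|_ h2] := hr Z0; first by rewrite subrr normr0.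
have := h2 (Z0 + h); have -> : Z0 + h - Z0 = h by rewrite addrC addKr.
exact.
Qed.

Lemma ham_field_diff (Z0 : 'rV[R]_(n + n)) : ham_dom Z0 -> forall e, 0 < e ->
  exists2 r, 0 < r & forall h, `|h| < r ->
    `|ham_field (Z0 + h) - ham_field Z0 - h *m 'J ham_field Z0| <= e * `|h|.
Proof.
move=> Z0d e e0; have [r r0 hr] := ham_field_strict Z0d e0.
exists r => // h hh; have [|_ h2] := hr Z0; first by rewrite subrr normr0.
have := h2 (Z0 + h); have -> : Z0 + h - Z0 = h by rewrite addrC addKr.
exact.
Qed.

(** Both Jacobians approximate the same increments of the field near [Z]. *)
Lemma strict_jac_close (Z0 : 'rV[R]_(n + n)) e r (Z : 'rV[R]_(n + n)) : strict_jac ham_field Z0 ('J ham_field Z0) e r ->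
  `|Z - Z0| < r ->
  forall h : 'rV[R]_(n + n), `|h *m ('J ham_field Z - 'J ham_field Z0)| <= e * `|h|.
Proof.
move=> hs hZ h; have [OZ hZ2] := hs Z hZ.
apply/ler_addgt0Pr => d d0.
have [->|hn0] := eqVneq h 0; first by rewrite mul0mx !normr0 mulr0 add0r ltW.
have h0 : 0 < `|h| by rewrite normr_gt0.
have d1 : 0 < d / `|h| by rewrite divr_gt0.
have [r1 r10 hr1] := ham_field_diff OZ d1.
have rr : 0 < r - `|Z - Z0| by rewrite subr_gt0.
pose t := Num.min r1 (r - `|Z - Z0|) / (2 * `|h|).
have m0 : 0 < Num.min r1 (r - `|Z - Z0|) by rewrite lt_min r10.
have t0 : 0 < t by rewrite divr_gt0 // mulr_gt0.
have nth : `|t *: h| < Num.min r1 (r - `|Z - Z0|).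
  rewrite normrZ gtr0_norm // /t; move: (Num.min _ _) m0 => m m0.
  have -> : m / (2 * `|h|) * `|h| = m / 2 by field; rewrite gt_eqF.
  by rewrite ltr_pdivrMr //; lra.
clearbody t; have := nth; rewrite lt_min => /andP[th1 th2].
have := hr1 _ th1; have := hZ2 (Z + t *: h).
have -> : Z + t *: h - Z = t *: h by rewrite addrC addKr.
have -> : Z + t *: h - Z0 = (Z - Z0) + t *: h by rewrite addrAC.
have hZt : `|(Z - Z0) + t *: h| < r.
  by apply: le_lt_trans (ler_normD _ _) _; rewrite -ltrBrDl.
move=> /(_ hZt).
set A := ham_field _ - _ => h1 h2.
have : `|t *: h *m ('J ham_field Z - 'J ham_field Z0)| <=
    (e + d / `|h|) * `|t *: h|.
  have sub3 (X Y B : 'rV[R]_(n + n)) : X - Y = (B - Y) - (B - X).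
    by rewrite opprB [RHS]addrC subrKA.
  rewrite mulmxBr (sub3 _ _ A).
  by apply: le_trans (ler_normB _ _) _; rewrite mulrDl lerD.
rewrite -scalemxAl !normrZ gtr0_norm // mulrCA ler_pM2l //.
by rewrite mulrDl divfK // gt_eqF.
Qed.

Lemma jac_of_eps (g : 'rV[R]_n -> 'rV[R]_n) (x : 'rV[R]_n) (M : 'M[R]_n) :
  (forall e, 0 < e -> exists2 r, 0 < r & forall h, `|h| < r ->
    `|g (x + h) - g x - h *m M| <= e * `|h|) -> jac g x = M^T.
Proof. by move=> /diff_of_eps[_ h]; rewrite /jac h. Qed.

(** The transposes come from ['J] acting on row vectors from the right, the signs
    from the costate block of the field. *)
Lemma ham_jacobians (x p : 'rV[R]_n) : p != 0 ->
  let J := 'J ham_field (row_mx x p) in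
  [/\ Hxp H x p = (ulsubmx J)^T, Hpp H x p = (dlsubmx J)^T,
      Hxx H x p = - (ursubmx J)^T & Hpx H x p = - (drsubmx J)^T].
Proof.
move=> p0 J.
have Zd : ham_dom (row_mx x p) by rewrite /ham_dom /= row_mxKr.
have JE : J = block_mx (ulsubmx J) (ursubmx J) (dlsubmx J) (drsubmx J).
  by rewrite submxK.
have Fx (h : 'rV[R]_n) : ham_field (row_mx (x + h) p) - ham_field (row_mx x p) - row_mx h 0 *m J =
    row_mx (grad (H (x + h)) p - grad (H x) p - h *m ulsubmx J)
      (- grad (H^~ p) (x + h) + grad (H^~ p) x - h *m ursubmx J).
  rewrite {1}JE mul_row_block !mul0mx !addr0 /ham_field !row_mxKl !row_mxKr.
  by rewrite !row_mxB opprK.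
have Fp (h : 'rV[R]_n) : ham_field (row_mx x (p + h)) - ham_field (row_mx x p) - row_mx 0 h *m J =
    row_mx (grad (H x) (p + h) - grad (H x) p - h *m dlsubmx J)
      (- grad (H^~ (p + h)) x + grad (H^~ p) x - h *m drsubmx J).
  rewrite {1}JE mul_row_block !mul0mx !add0r /ham_field !row_mxKl !row_mxKr.
  by rewrite !row_mxB opprK.
have dx e : 0 < e -> exists2 r, 0 < r & forall h : 'rV[R]_n, `|h| < r ->
    `|grad (H (x + h)) p - grad (H x) p - h *m ulsubmx J| <= e * `|h| /\
    `|- grad (H^~ p) (x + h) + grad (H^~ p) x - h *m ursubmx J| <= e * `|h|.
  move=> e0; have [r r0 hr] := ham_field_diff Zd e0; exists r => // h hh.
  have := hr (row_mx h 0); rewrite norm_row_mx0 => /(_ hh).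
  rewrite add_row_mx addr0 Fx => h1; split; apply: le_trans h1.
    by rewrite -[X in `|X|](row_mxKl _ (- grad (H^~ p) (x + h) + grad (H^~ p) x - h *m ursubmx J)) norm_lsubmx_le.
  by rewrite -[X in `|X|](row_mxKr (grad (H (x + h)) p - grad (H x) p - h *m ulsubmx J)) norm_rsubmx_le.
have dp e : 0 < e -> exists2 r, 0 < r & forall h : 'rV[R]_n, `|h| < r ->
    `|grad (H x) (p + h) - grad (H x) p - h *m dlsubmx J| <= e * `|h| /\
    `|- grad (H^~ (p + h)) x + grad (H^~ p) x - h *m drsubmx J| <= e * `|h|.
  move=> e0; have [r r0 hr] := ham_field_diff Zd e0; exists r => // h hh.
  have := hr (row_mx 0 h); rewrite norm_row_0mx => /(_ hh).
  rewrite add_row_mx addr0 Fp => h1; split; apply: le_trans h1.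
    by rewrite -[X in `|X|](row_mxKl _ (- grad (H^~ (p + h)) x + grad (H^~ p) x - h *m drsubmx J)) norm_lsubmx_le.
  by rewrite -[X in `|X|](row_mxKr (grad (H x) (p + h) - grad (H x) p - h *m dlsubmx J)) norm_rsubmx_le.
split.
- apply: jac_of_eps => e e0; have [r r0 hr] := dx e e0.
  by exists r => // h /hr[].
- apply: jac_of_eps => e e0; have [r r0 hr] := dp e e0.
  by exists r => // h /hr[].
- rewrite -linearN; apply: jac_of_eps => e e0; have [r r0 hr] := dx e e0.
  exists r => // h /hr[_]; rewrite -normrN mulmxN opprD !opprD !opprK.
  by [].
- rewrite -linearN; apply: jac_of_eps => e e0; have [r r0 hr] := dp e e0.
  exists r => // h /hr[_]; rewrite -normrN mulmxN opprD !opprD !opprK.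
  by [].
Qed.

Section along_curve.
Variables (a b : R) (zb : R -> 'rV[R]_(n + n)).
Hypothesis zb_lip : lip a b zb.
Hypothesis zb_dom : forall s, a <= s <= b -> ham_dom (zb s).

(** The radius is also the inverse of the Lipschitz constant: with one parameter
    the property is monotone, as [compact_uniform] requires. *)
Lemma ham_field_lip_tube : exists2 rho, 0 < rho &
  forall s, a <= s <= b -> forall Z, `|Z - zb s| < rho ->
    ham_dom Z /\ forall Z', `|Z' - zb s| < rho ->
    `|ham_field Z' - ham_field Z| <= rho^-1 * `|Z' - Z|.
Proof.
apply: (@compact_uniform R a b (fun s rho => forall Z, `|Z - zb s| < rho ->
    ham_dom Z /\ forall Z', `|Z' - zb s| < rho ->
    `|ham_field Z' - ham_field Z| <= rho^-1 * `|Z' - Z|)).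
  move=> t rho rho' h r0 rr Z hZ; have [OZ h2] := h Z (lt_le_trans hZ rr).
  split => // Z' hZ'; apply: le_trans (h2 Z' (lt_le_trans hZ' rr)) _.
  by rewrite ler_wpM2r // lef_pV2 // posrE // (lt_le_trans r0).
move=> s sab; have [r r0 hr] := ham_field_strict (zb_dom sab) ltr01.
have [L L0 hL] := lip_pos zb_lip.
have [C C0 hC] : exists2 C, 0 < C & forall v : 'rV[R]_(n + n),
    `|v *m 'J ham_field (zb s)| <= C * `|v|.
  exact: mulmx_bounded.
exists (r / (2 * L)); first by rewrite divr_gt0 // mulr_gt0.
exists (Num.min (r / 2) (1 + C)^-1).
  by rewrite lt_min divr_gt0 // invr_gt0 addr_gt0.
move=> t tab ts Z; rewrite lt_min => /andP[hZ _].
have near_s Y : `|Y - zb t| < r / 2 -> `|Y - zb s| < r.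
  move=> hY; have := hL t s tab sab.
  have : L * `|t - s| < r / 2.
    move: ts; rewrite ltr_pdivlMr ?mulr_gt0 //; lra.
  have -> : Y - zb s = (Y - zb t) + (zb t - zb s) by rewrite addrA subrK.
  have := ler_normD (Y - zb t) (zb t - zb s); lra.
have [OZ h2] := hr Z (near_s Z hZ); split => // Z'.
rewrite lt_min => /andP[hZ' _]; have := h2 Z' (near_s Z' hZ').
move=> h3; have := hC (Z' - Z).
set A := ham_field Z' - ham_field Z in h3 *; set B := _ *m _ in h3 * => h4.
have h5 : `|A| <= (1 + C) * `|Z' - Z|.
  have -> : A = (A - B) + B by rewrite subrK.
  by apply: le_trans (ler_normD _ _) _; rewrite mulrDl lerD.
apply: le_trans h5 _; rewrite ler_wpM2r //.
rewrite -[leLHS]invrK lef_pV2 ?posrE ?invr_gt0 ?addr_gt0 // ?ge_min ?lexx ?orbT //.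
by rewrite lt_min divr_gt0 // invr_gt0 addr_gt0.
Qed.

Lemma ham_field_diff_tube e : 0 < e -> exists2 rho, 0 < rho &
  forall s, a <= s <= b -> forall h : 'rV[R]_(n + n), `|h| < rho ->
  `|ham_field (zb s + h) - ham_field (zb s) - h *m 'J ham_field (zb s)| <= e * `|h|.
Proof.
move=> e0; have e20 : 0 < e / 2 by rewrite divr_gt0.
apply: (@compact_uniform R a b (fun s rho => forall h, `|h| < rho ->
  `|ham_field (zb s + h) - ham_field (zb s) - h *m 'J ham_field (zb s)| <= e * `|h|)).
  by move=> t rho rho' h r0 rr k hk; apply: h; exact: lt_le_trans rr.
move=> s sab; have [r r0 hr] := ham_field_strict (zb_dom sab) e20.
have [L L0 hL] := lip_pos zb_lip.
exists (r / (2 * L)); first by rewrite divr_gt0 // mulr_gt0.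
exists (r / 2); first by rewrite divr_gt0.
move=> t tab ts h hh.
have ts2 : `|zb t - zb s| < r / 2.
  have := hL t s tab sab.
  have : L * `|t - s| < r / 2.
    move: ts; rewrite ltr_pdivlMr ?mulr_gt0 //; lra.
  lra.
have tsr : `|zb t - zb s| < r by lra.
have [_ h2] := hr _ tsr; have := h2 (zb t + h).
have -> : zb t + h - zb t = h by rewrite addrC addKr.
have -> : zb t + h - zb s = (zb t - zb s) + h by rewrite addrAC.
have hth : `|(zb t - zb s) + h| < r.
  by apply: le_lt_trans (ler_normD _ _) _; rewrite [r]splitr ltrD.
move=> /(_ hth) h3.
have h4 := strict_jac_close hr tsr h.
set A := ham_field _ - _ in h3 *.
have sub4 (B X Y : 'rV[R]_(n + n)) : B - X = (B - Y) - (X - Y).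
  by rewrite opprB subrKA.
rewrite mulmxBr in h4; rewrite (sub4 A _ (h *m 'J ham_field (zb s))).
apply: le_trans (ler_normB _ _) _.
have -> : e * `|h| = e / 2 * `|h| + e / 2 * `|h| by field.
exact: lerD.
Qed.

Lemma ham_jac_continuous (v : 'rV[R]_(n + n)) s : a <= s <= b ->
  forall e, 0 < e -> exists2 r, 0 < r & forall t, a <= t <= b -> `|t - s| < r ->
   `|v *m 'J ham_field (zb t) - v *m 'J ham_field (zb s)| <= e.
Proof.
move=> sab e e0; have e1 : 0 < e / (`|v| + 1) by rewrite divr_gt0 // ltr_wpDl.
have [r r0 hr] := ham_field_strict (zb_dom sab) e1.
have [L L0 hL] := lip_pos zb_lip.
exists (r / L); first by rewrite divr_gt0.
move=> t tab; rewrite ltr_pdivlMr // mulrC => ts.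
have h := strict_jac_close hr (le_lt_trans (hL t s tab sab) ts) v.
rewrite -mulmxBr; apply: le_trans h _.
rewrite mulrAC ler_pdivrMr ?ltr_wpDl // ler_pM2l //; lra.
Qed.

End along_curve.
End hamiltonian_field.

(** * Matrix calculus and the Riccati equation *)
Section matrix_calculus.
Variable R : realType.

Lemma is_derive_mxP m k (M : R -> 'M[R]_(m, k)) (s : R) (dM : 'M[R]_(m, k)) :
  is_derive s 1 M dM <-> forall i j, is_derive s 1 (fun t => M t i j) (dM i j).
Proof.
split=> [[dy <-] i j|h].
  have /derivable_mxP dyi := dy.
  by apply: DeriveDef; [exact: dyi|rewrite derive_mx // mxE].
have dy : derivable M s 1 by apply/derivable_mxP => i j; case: (h i j).
apply: DeriveDef => //; rewrite derive_mx //; apply/matrixP => i j; rewrite mxE.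
by have [_ <-] := h i j.
Qed.

Lemma der_mulmx m k l (M : R -> 'M[R]_(m, k)) (N : R -> 'M[R]_(k, l)) (s : R)
    (dM : 'M[R]_(m, k)) (dN : 'M[R]_(k, l)) :
  is_derive s 1 M dM -> is_derive s 1 N dN ->
  is_derive s 1 (fun t => M t *m N t) (dM *m N s + M s *m dN).
Proof.
move=> /is_derive_mxP hM /is_derive_mxP hN; apply/is_derive_mxP => i j.
under [fun t => _]eq_fun do rewrite mxE.
rewrite !mxE -big_split /=.
have := @der_sum R k (fun l t => M t i l * N t l j)
  (fun l t => dM i l * N s l j + M s i l * dN l j) s.
by apply=> a; exact: derM.
Qed.

Lemma derivable_bigsum (I : Type) (r : seq I) (f : I -> R -> R) (s : R) :
  (forall i, derivable (f i) s 1) -> derivable (fun t => \sum_(i <- r) f i t) s 1.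
Proof.
move=> h; elim: r => [|i r IH].
  under [fun t => _]eq_fun do rewrite big_nil; exact: derivable_cst.
under [fun t => _]eq_fun do rewrite big_cons; exact: (derivableD (h i) IH).
Qed.

Lemma derivable_bigprod (I : Type) (r : seq I) (f : I -> R -> R) (s : R) :
  (forall i, derivable (f i) s 1) -> derivable (fun t => \prod_(i <- r) f i t) s 1.
Proof.
move=> h; elim: r => [|i r IH].
  under [fun t => _]eq_fun do rewrite big_nil; exact: derivable_cst.
under [fun t => _]eq_fun do rewrite big_cons; exact: (derivableM (h i) IH).
Qed.

Lemma derivable_det k (M : R -> 'M[R]_k) (s : R) :
  derivable M s 1 -> derivable (fun t => \det (M t)) s 1.
Proof.
move=> /derivable_mxP h; rewrite /determinant.
apply: derivable_bigsum => p; apply: derivableM; first exact: derivable_cst.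
by apply: derivable_bigprod => i; exact: h.
Qed.

Lemma derivable_adj k (M : R -> 'M[R]_k) (s : R) :
  derivable M s 1 -> derivable (fun t => \adj (M t)) s 1.
Proof.
move=> /derivable_mxP h; apply/derivable_mxP => i j.
under [fun t => _]eq_fun do rewrite mxE /cofactor.
apply: derivableM; first exact: derivable_cst.
apply: derivable_det; apply/derivable_mxP => a b.
by under [fun t => _]eq_fun do rewrite !mxE; exact: h.
Qed.

Lemma entry_le_norm m k (M : 'M[R]_(m, k)) i j : `|M i j| <= `|M|.
Proof.
rewrite [leRHS]/Num.Def.normr /= mx_normrE.
exact: (le_bigmax _ (fun i => `|M i.1 i.2|) (i, j)).
Qed.

Lemma mx_norm_le m k (M : 'M[R]_(m, k)) (c : R) :
  0 <= c -> (forall i j, `|M i j| <= c) -> `|M| <= c.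
Proof.
move=> c0 h; rewrite [leLHS]/Num.Def.normr /= mx_normrE.
by rewrite (bigmax_le _ c0) // => -[i j] _ /=.
Qed.

Lemma mulmx_norm_le m k (u : 'rV[R]_m) (M : 'M[R]_(m, k)) :
  `|u *m M| <= m%:R * `|M| * `|u|.
Proof.
apply: norm_coordP; first by rewrite !mulr_ge0.
move=> j; rewrite mxE; apply: le_trans (ler_norm_sum _ _ _) _.
apply: (@le_trans _ _ (\sum_(i < m) `|M| * `|u|)).
  apply: ler_sum => i _; rewrite normrM mulrC; apply: ler_pM => //.
    exact: entry_le_norm.
  exact: norm_coord_le.
by rewrite sumr_const card_ord -mulrA mulr_natl.
Qed.

Lemma lip_of_interior_derive (a b M : R) (f df : R -> R) :
  {within `[a, b], continuous f} ->
  (forall s, a < s < b -> is_derive s 1 f (df s)) ->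
  (forall s, a < s < b -> `|df s| <= M) -> lip_on a b M f.
Proof.
move=> cf hf hM.
have H s t : a <= s -> s < t -> t <= b -> `|f t - f s| <= M * (t - s).
  move=> as_ st tb; have [||c] := @MVT R f df s t st.
  - move=> c; rewrite in_itv /= => /andP[sc ct]; apply: hf.
    by rewrite (le_lt_trans as_ sc) (lt_le_trans ct tb).
  - apply: continuous_subspaceW cf => c /=; rewrite !in_itv /= => /andP[sc ct].
    by rewrite (le_trans as_ sc) (le_trans ct tb).
  rewrite in_itv /= => /andP[sc ct] ->; rewrite normrM [`|t - s|]gtr0_norm ?subr_gt0 //.
  rewrite ler_pM2r ?subr_gt0 //; apply: hM.
  by rewrite (le_lt_trans as_ sc) (lt_le_trans ct tb).
move=> s t /andP[as_ sb] /andP[at_ tb].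
have [st|ts|->] := ltgtP s t; last by rewrite !subrr normr0 mulr0.
  rewrite distrC [`|s - t|]distrC [`|t - s|]gtr0_norm ?subr_gt0 //; exact: H.
by rewrite [`|s - t|]gtr0_norm ?subr_gt0 //; exact: H.
Qed.

End matrix_calculus.

Lemma riccati_transpose (R : comPzRingType) n (S ur dr ul dl : 'M[R]_n) :
  (ur + S *m dr - ul *m S - S *m dl *m S)^T + - dr^T *m S^T + S^T *m ul^T
    + S^T *m dl^T *m S^T + - ur^T = 0.
Proof.
rewrite mulNmx -!trmx_mul (mulmxA S dl S).
by apply/matrixP => i j; rewrite !mxE; ring.
Qed.

Lemma riccati_defect (R : comPzRingType) n (A B Q dQ ur dr ul dl : 'M[R]_n) :
  dQ + - dr^T *m Q + Q *m ul^T + Q *m dl^T *m Q + - ur^T = 0 ->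
  (B - A *m Q^T) *m dr - (B - A *m Q^T) *m dl *m Q^T =
  (A *m ur + B *m dr) - ((A *m ul + B *m dl) *m Q^T + A *m dQ^T).
Proof.
move=> E; have {E} -> : dQ = ur^T + dr^T *m Q - Q *m ul^T - Q *m dl^T *m Q.
  by rewrite -[LHS]subr0 -E mulNmx; apply/matrixP => i j; rewrite !mxE; ring.
rewrite -[X in _ = X]addr0.
have -> : (ur^T + dr^T *m Q - Q *m ul^T - Q *m dl^T *m Q)^T =
    ur + Q^T *m dr - ul *m Q^T - Q^T *m dl *m Q^T.
  apply: trmx_inj; rewrite trmxK.
  have -> : (ur + Q^T *m dr - ul *m Q^T - Q^T *m dl *m Q^T)^T =
    ur^T + (Q^T *m dr)^T - (ul *m Q^T)^T - (Q^T *m dl *m Q^T)^T.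
    by apply/matrixP => i j; rewrite !mxE.
  by rewrite !trmx_mul !trmxK mulmxA.
rewrite addr0 !(mulmxDr, mulmxDl, mulmxBl, mulmxBr, mulNmx, mulmxN) !mulmxA.
by apply/matrixP => i j; rewrite !mxE; ring.
Qed.

Section riccati.
Variables (R : realType) (n : nat) (t0 T : R).
Variables (W : R -> 'M[R]_(n, n + n)) (J : R -> 'M[R]_(n + n)).
Hypothesis W_der : forall s, t0 <= s <= T -> is_derive s 1 W (W s *m J s).
Let A s := lsubmx (W s).
Let B s := rsubmx (W s).
Hypothesis A_unit : forall s, t0 <= s <= T -> A s \in unitmx.
Variables (H : 'rV[R]_n -> 'rV[R]_n -> R) (x p : R -> 'rV[R]_n).
Hypothesis H_coef : forall s, t0 <= s <= T ->
  [/\ Hxp H (x s) (p s) = (ulsubmx (J s))^T, Hpp H (x s) (p s) = (dlsubmx (J s))^T,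
      Hxx H (x s) (p s) = - (ursubmx (J s))^T & Hpx H (x s) (p s) = - (drsubmx (J s))^T].

Lemma der_blocks s : t0 <= s <= T ->
  is_derive s 1 A (A s *m ulsubmx (J s) + B s *m dlsubmx (J s)) /\
  is_derive s 1 B (A s *m ursubmx (J s) + B s *m drsubmx (J s)).
Proof.
move=> sab; have /is_derive_mxP hW := W_der sab.
have E : W s *m J s = row_mx (A s *m ulsubmx (J s) + B s *m dlsubmx (J s))
   (A s *m ursubmx (J s) + B s *m drsubmx (J s)).
  by rewrite -mul_row_block -[W s in LHS]hsubmxK -[J s in LHS]submxK.
split; apply/is_derive_mxP => i j.
  under [fun t => _]eq_fun do rewrite mxE.
  by have := hW i (lshift n j); rewrite E row_mxEl.
under [fun t => _]eq_fun do rewrite mxE.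
by have := hW i (rshift n j); rewrite E row_mxEr.
Qed.

(** Cramer's formula for [A^-1 B]: it is differentiable because its numerator and
    denominator are, with no reference to the invertibility of [A] at nearby times. *)
Let S s : 'M[R]_n := (\det (A s))^-1 *: (\adj (A s) *m B s).

Lemma riccati_quotientE s : t0 <= s <= T -> S s = invmx (A s) *m B s.
Proof. by move=> sab; rewrite /S /invmx A_unit // -scalemxAl. Qed.

Let AS s : t0 <= s <= T -> A s *m S s = B s.
Proof. by move=> sab; rewrite riccati_quotientE // mulKVmx // A_unit. Qed.

Lemma derivable_riccati_quotient s : t0 <= s <= T -> derivable S s 1.
Proof.
move=> sab; have [[dA _] [dB _]] := der_blocks sab.
have dadj := derivable_adj dA; have ddet := derivable_det dA.
have det0 : \det (A s) != 0 by rewrite -unitfE -unitmxE A_unit.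
have [dAB _] := der_mulmx (derivableP dadj) (derivableP dB).
apply/derivable_mxP => i j.
under [fun t => _]eq_fun do rewrite mxE.
apply: derivableM; first exact: derivableV.
by move/derivable_mxP : dAB; apply.
Qed.

(** Differentiate [A S = B] and insert the linear system satisfied by [A] and [B]. *)
Lemma riccati_quotient_solution :
  riccati_solution t0 T H x p (S t0)^T (fun s => (S s)^T).
Proof.
split => //.
  apply: derivable_within_continuous => s; rewrite in_itv /= => sab.
  apply/derivable_mxP => i j; under [fun t => _]eq_fun do rewrite mxE.
  by have /derivable_mxP := derivable_riccati_quotient sab; apply.
move=> s /andP[s0 sT]; have sab : t0 <= s <= T by rewrite !ltW.
have dS := derivable_riccati_quotient sab.
have dST : is_derive s 1 (fun s => (S s)^T) ('D_1 S s)^T.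
  apply/is_derive_mxP => i j; under [fun t => _]eq_fun do rewrite mxE.
  by rewrite mxE; move/is_derive_mxP : (derivableP dS); apply.
have [dST1 dST2] := dST; split => //; rewrite derive1E dST2.
have [dA dB] := der_blocks sab.
have dAS : is_derive s 1 B ((A s *m ulsubmx (J s) + B s *m dlsubmx (J s)) *m S s +
    A s *m 'D_1 S s).
  apply: near_eq_is_derive (der_mulmx dA (derivableP dS)).
  near=> t; rewrite AS //; apply/andP; split; apply: ltW; near: t.
    exact: lt_nbhsr.
  exact: lt_nbhsl.
have E : A s *m ursubmx (J s) + B s *m drsubmx (J s) =
    (A s *m ulsubmx (J s) + B s *m dlsubmx (J s)) *m S s + A s *m 'D_1 S s.
  by have [_ <-] := dB; have [_ <-] := dAS.
have {}E : 'D_1 S s = ursubmx (J s) + S s *m drsubmx (J s) - ulsubmx (J s) *m S s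
    - S s *m dlsubmx (J s) *m S s.
  apply: (can_inj (mulKmx (A_unit sab))).
  rewrite !mulmxDr !mulmxN !mulmxA AS //.
  move: E; rewrite mulmxDl => E.
  by apply/eqP; rewrite -subr_eq0; apply/eqP; rewrite -[RHS](subrr (A s *m ursubmx (J s) + B s *m drsubmx (J s))) {2}E;
    apply/matrixP => i j; rewrite !mxE; ring.
have [-> -> -> ->] := H_coef sab.
rewrite E; exact: riccati_transpose.
Unshelve. all: by end_near. Qed.

Variable K : R.
Hypothesis K0 : 0 < K.
Hypothesis J_bound : forall s (h : 'rV[R]_(n + n)), t0 <= s <= T ->
  `|h *m J s| <= K * `|h|.

Lemma lower_blocks_bound s (w : 'rV[R]_n) : t0 <= s <= T ->
  `|w *m dlsubmx (J s)| <= K * `|w| /\ `|w *m drsubmx (J s)| <= K * `|w|.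
Proof.
move=> sab; have := J_bound (row_mx 0 w) sab.
have -> : row_mx 0 w *m J s = row_mx (w *m dlsubmx (J s)) (w *m drsubmx (J s)).
  by rewrite -[J s in LHS]submxK mul_row_block !mul0mx !add0r.
have -> : `|row_mx (0 : 'rV[R]_n) w| = `|w| by exact: norm_row_0mx.
move=> h; split; apply: le_trans h.
  by rewrite -{1}(row_mxKl (w *m dlsubmx (J s)) (w *m drsubmx (J s))) norm_lsubmx_le.
by rewrite -{1}(row_mxKr (w *m dlsubmx (J s)) (w *m drsubmx (J s))) norm_rsubmx_le.
Qed.

(** For any solution [Q], the defect [B - A Q^T] solves a linear equation, so it
    vanishes identically when it vanishes at [t0]. *)
Lemma riccati_unique Q : riccati_solution t0 T H x p (S t0)^T Q ->
  forall s, t0 <= s <= T -> Q s = (invmx (A s) *m B s)^T.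
Proof.
move=> [cQ hQ Q0] s sab; have t0T : t0 <= T by case/andP: sab => /le_trans; apply.
have t0ab : t0 <= t0 <= T by rewrite lexx.
have [M M0 hM] : exists2 M, 0 < M & forall t, t0 <= t <= T -> `|Q t| <= M.
  have cn : {within `[t0, T], continuous (fun t => `|Q t|)}.
    by move=> t; apply: cvg_norm; exact: cQ.
  have [c _ hc] := EVT_max t0T cn; exists (`|Q c| + 1); first by rewrite ltr_wpDl.
  by move=> t tab; rewrite (le_trans (hc t _)) ?in_itv // lerDl.
pose D t := B t - A t *m (Q t)^T.
have dD t : t0 < t < T ->
    is_derive t 1 D (D t *m drsubmx (J t) - D t *m dlsubmx (J t) *m (Q t)^T).
  move=> t0T'; have tab : t0 <= t <= T by case/andP: t0T' => ? ?; rewrite !ltW.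
  have [dQ EQ] := hQ t t0T'; have [dA dB] := der_blocks tab.
  have dQT : is_derive t 1 (fun s => (Q s)^T) (derive1 Q t)^T.
    apply/is_derive_mxP => i j; under [fun t => _]eq_fun do rewrite mxE.
    rewrite mxE derive1E; move/is_derive_mxP : (derivableP dQ); exact.
  have dAQ := der_mulmx dA dQT.
  suff -> : D t *m drsubmx (J t) - D t *m dlsubmx (J t) *m (Q t)^T =
    (A t *m ursubmx (J t) + B t *m drsubmx (J t)) -
    ((A t *m ulsubmx (J t) + B t *m dlsubmx (J t)) *m (Q t)^T + A t *m (derive1 Q t)^T).
    apply/is_derive_mxP => i j; rewrite !mxE.
    under [fun t => _]eq_fun do rewrite /D mxE [X in _ + X]mxE.
    have := derB ((is_derive_mxP _ _ _).1 dB i j) ((is_derive_mxP _ _ _).1 dAQ i j).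
    by rewrite !mxE.
  move: EQ; have [-> -> -> ->] := H_coef tab; rewrite /D => EQ.
  exact: riccati_defect EQ.
have cD i j : {within `[t0, T], continuous (fun t => D t i j)}.
  have cA k : {within `[t0, T], continuous (fun t => A t i k)}.
    apply: derivable_within_continuous => t; rewrite in_itv /= => tab.
    by have [[/derivable_mxP dA _] _] := der_blocks tab; exact: dA.
  have cB : {within `[t0, T], continuous (fun t => B t i j)}.
    apply: derivable_within_continuous => t; rewrite in_itv /= => tab.
    by have [_ [/derivable_mxP dB _]] := der_blocks tab; exact: dB.
  have cQ' k : {within `[t0, T], continuous (fun t => Q t j k)}.
    move=> t; apply: (@continuous_comp (subspace `[t0, T]) _ _ Q (fun M : 'M[R]_n => M j k)).
      exact: cQ.
    exact: coord_continuous.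
  have -> : (fun t => D t i j) = (fun t => B t i j - \sum_k A t i k * Q t j k).
    apply/funext => t; rewrite /D; move: (B t) (A t) (Q t) => b a q.
    by rewrite !mxE; congr (_ - _); apply: eq_bigr => k _; rewrite mxE.
  move=> t; apply: (@continuousB _ _ (subspace `[t0, T])); first exact: cB.
  apply: (@continuous_big _ _ _ _ _ (@add_continuous _) (subspace `[t0, T])) => k _ t'.
  by apply: (@continuousM _ (subspace `[t0, T])); [exact: cA|exact: cQ'].
have bound (u : 'rV[R]_n) t : t0 <= t <= T ->
    `|u *m drsubmx (J t) - u *m dlsubmx (J t) *m (Q t)^T| <= (K + n%:R * M * K) * `|u|.
  move=> tab; have [h1 h2] := lower_blocks_bound u tab.
  apply: le_trans (ler_normB _ _) _; rewrite mulrDl; apply: lerD => //.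
  apply: le_trans (mulmx_norm_le _ _) _; rewrite -!mulrA ler_wpM2l //.
  apply: ler_pM => //; apply: mx_norm_le; first exact: ltW.
  by move=> i j; rewrite mxE; exact: le_trans (entry_le_norm _ _ _) (hM t tab).
pose L := K + n%:R * M * K.
have L0 : 0 < L by rewrite ltr_pwDl // !mulr_ge0 // ltW.
have lD i : lip t0 T (fun t => row i (D t)).
  have /choice[c hc] : forall j, exists c, forall t, t0 <= t <= T -> `|D t i j| <= c.
    move=> j; have cn : {within `[t0, T], continuous (fun t => `|D t i j|)}.
      by move=> t; apply: cvg_norm; exact: cD.
    have [m _ hm] := EVT_max t0T cn; exists `|D m i j| => t tab.
    by apply: hm; rewrite in_itv.
  have c0 j : 0 <= c j by exact: le_trans (normr_ge0 _) (hc j t0 t0ab).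
  have rD t : t0 <= t <= T -> `|row i (D t)| <= \sum_j c j.
    move=> tab; apply: norm_coordP; first exact: sumr_ge0.
    by move=> j; rewrite mxE (bigD1 j) //= (le_trans (hc j t tab)) // lerDl sumr_ge0.
  apply: lip_vec => j; exists (L * \sum_j c j).
  have -> : (fun t => row i (D t) 0 j) = (fun t => D t i j) by apply/funext => t; rewrite mxE.
  apply: (lip_of_interior_derive (cD i j) (fun t tT => (is_derive_mxP _ _ _).1 (dD t tT) i j)).
  move=> t /andP[tl tr]; have tab : t0 <= t <= T by rewrite !ltW.
  have h := bound (row i (D t)) t tab; rewrite -!row_mul -linearB /= in h.
  have := le_trans (norm_coord_le _ j) h; rewrite mxE => /le_trans; apply.
  by rewrite ler_pM2l //; exact: rD.
suff DE : D s = 0.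
  have /subr0_eq E := DE.
  by rewrite E mulKmx ?trmxK // A_unit.
apply/row_matrixP => i; rewrite row0; apply/eqP; rewrite -normr_le0.
have D0 : D t0 = 0.
  by rewrite /D Q0 trmxK AS // subrr.
have := @gronwall_lip R n t0 T L 0 (fun t => row i (D t)) L0 (lexx _) (lD i) _ s sab.
rewrite D0 row0 normr0 mulr0 mul0r addr0 mul0r; apply.
apply: ae_on_oo; apply: ae_on_all => t tab /dD/is_derive_mxP hD.
exists (row i (D t *m drsubmx (J t) - D t *m dlsubmx (J t) *m (Q t)^T)).
  move=> j; under [fun t => _]eq_fun do rewrite mxE.
  by rewrite mxE; exact: hD.
rewrite addr0 linearB /= !row_mul; exact: bound.
Qed.

End riccati.

(** * Trajectories and the value function *)
Section trajectories.
Variables (R : realType) (n : nat).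
Implicit Types (a b : R) (y z : R -> 'rV[R]_n).

Lemma abs_continuous_bounded (V : normedModType R) a b (f : R -> V) : a <= b ->
  abs_continuous a b f -> exists2 M, 0 < M & forall s, a <= s <= b -> `|f s| <= M.
Proof.
move=> ab acf.
have unif e : 0 < e -> exists2 d, 0 < d & forall s t, a <= s -> s <= t -> t <= b ->
    t - s < d -> `|f t - f s| < e.
  move=> e0; have [d d0 hd] := acf e e0; exists d => // s t as_ st tb std.
  have := hd 1%N (fun=> s) (fun=> t); rewrite !big_ord1; apply => //.
  by apply/trivIsetP => i j _ _; rewrite [i]ord1 [j]ord1 eqxx.
have [d d0 hd] := unif 1 ltr01.
pose Q x := exists2 M, 0 < M & forall s, a <= s <= x -> `|f s| <= M.
apply: (@real_induction R a b Q ab).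
  exists (`|f a| + 1) => [|s /andP[as_ sa]]; first by rewrite ltr_wpDl.
  by have -> : s = a by [apply/le_anti; rewrite sa]; rewrite lerDl.
move=> s sab; exists (d / 2); first by rewrite divr_gt0.
move=> u v au us sv vb sr vr [M M0 hM]; exists (M + 1); first by rewrite addr_gt0.
move=> t /andP[at_ tv]; have [tu|/ltW ut] := leP t u.
  by apply: le_trans (hM t _) _; rewrite ?at_ //; lra.
have -> : f t = (f t - f u) + f u by rewrite subrK.
apply: le_trans (ler_normD _ _) _; rewrite addrC lerD //.
  by apply: hM; rewrite au lexx.
by apply: ltW; apply: hd => //; lra.
Qed.

Variable F : 'rV[R]_n -> set 'rV[R]_n.

(** Under linear growth the trajectories are Lipschitz; this class, unlike
    that of absolutely continuous functions, has immediate closure properties under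
    products, concatenation and time reversal. *)
Definition traj a b y : Prop :=
  lip a b y /\ ae_on a b (fun s => exists2 dy : 'rV[R]_n,
    is_derive s 1 y dy & F (y s) dy).

Lemma traj_sub a b a' b' y : a <= a' -> b' <= b -> traj a b y -> traj a' b' y.
Proof. by move=> aa bb [l h]; split; [exact: lip_sub l|exact: ae_on_sub h]. Qed.

Lemma traj_trajectory a b y : traj a b y -> trajectory b F a (y a) y.
Proof.
move=> [l h]; split => //; first exact: lip_abs_continuous.
apply: ae_on_imp h => s _ [dy hdy Fdy]; split; first by case: hdy.
by rewrite derive1E derive_val.
Qed.

Variable Gam : R.
Hypothesis Gam0 : 0 < Gam.
Hypothesis F_growth : forall x v, F x v -> `|v| <= Gam * (1 + `|x|).

Lemma trajectory_traj a b x y : a <= b -> trajectory b F a x y -> traj a b y.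
Proof.
move=> ab [acy hy yx].
have hy' : ae_on a b (fun s => exists2 dy : 'rV[R]_n, is_derive s 1 y dy & F (y s) dy).
  apply: ae_on_imp hy => s _ [dy Fy]; exists (derive1 y s) => //.
  by rewrite derive1E; exact: derivableP.
split => //; have [M M0 hM] := abs_continuous_bounded ab acy.
apply: lip_vec => i; exists (Gam * (1 + M)).
apply: abs_continuous_lip; first exact: abs_continuous_coord.
apply: ae_on_imp hy' => s sab [dy hdy Fdy]; exists (dy 0 i).
  by move/is_derive_coordP : hdy.
apply: le_trans (norm_coord_le _ _) _; apply: le_trans (F_growth Fdy) _.
by rewrite ler_pM2l // lerD2l hM.
Qed.

Lemma traj_bound a b x : exists2 K, 0 < K & forall y, traj a b y -> y a = x ->
  forall s, a <= s <= b -> `|y s| <= K.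
Proof.
exists ((2 * `|x| + 1) * expR (2 * Gam * (b - a))).
  by rewrite mulr_gt0 ?expR_gt0 // ltr_wpDl // mulr_ge0.
move=> y [ly hy] yx s sab.
have := @gronwall_lip R n a b Gam Gam y Gam0 (ltW Gam0) ly _ s sab.
rewrite yx divff ?gt_eqF // => h; apply: le_trans (h _) _.
  apply: ae_on_imp hy => t _ [dy hdy Fdy]; exists dy.
    by move=> i; move/is_derive_coordP : hdy.
  by apply: le_trans (F_growth Fdy) _; rewrite mulrDr mulr1 addrC.
apply: ler_wpM2l; first by rewrite addr_ge0 // mulr_ge0.
case/andP: sab => as_ sb.
by rewrite ler_expR ler_wpM2l ?lerD2r // mulr_ge0 // ltW.
Qed.

Lemma traj_cat a s b y z : a <= s -> s <= b -> traj a s y -> traj s b z -> y s = z s ->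
  exists w, [/\ traj a b w, forall t, t <= s -> w t = y t &
    forall t, s <= t -> w t = z t].
Proof.
move=> as_ sb [ly hy] [lz hz] yz.
pose w t := if t <= s then y t else z t.
have wl t : t <= s -> w t = y t by rewrite /w => ->.
have wr t : s <= t -> w t = z t.
  rewrite /w => st; case: ifP => // ts.
  by have -> : t = s by apply/le_anti; rewrite ts.
exists w; split => //; split.
  have [L L0 hL] := lip_pos ly; have [M M0 hM] := lip_pos lz.
  exists (L + M).
  have H t r : a <= t -> t <= r -> r <= b -> `|w r - w t| <= (L + M) * `|r - t|.
    move=> at_ tr rb; rewrite [`|r - t|]ger0_norm ?subr_ge0 //.
    have Lge c : 0 <= c -> L * c <= (L + M) * c.
      by move=> c0; rewrite ler_wpM2r // lerDl ltW.
    have Mge c : 0 <= c -> M * c <= (L + M) * c.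
      by move=> c0; rewrite ler_wpM2r // lerDr ltW.
    have [rs|/ltW sr] := leP r s.
      rewrite !wl ?(le_trans tr) //; have := hL r t.
      rewrite [`|r - t|]ger0_norm ?subr_ge0 // at_ rs (le_trans at_ tr) (le_trans tr rs).
      by move=> /(_ isT isT)/le_trans; apply; apply: Lge; rewrite subr_ge0.
    have [ts|/ltW st] := leP t s; last first.
      rewrite !wr //; have := hM r t.
      rewrite [`|r - t|]ger0_norm ?subr_ge0 // st rb sr (le_trans tr rb).
      by move=> /(_ isT isT)/le_trans; apply; apply: Mge; rewrite subr_ge0.
    rewrite (wr r) // (wl t) //.
    have -> : z r - y t = (z r - z s) + (y s - y t) by rewrite yz subrKA.
    apply: le_trans (ler_normD _ _) _.
    have := hM r s; have := hL s t; rewrite !ger0_norm ?subr_ge0 //.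
    rewrite at_ ts sr rb as_ sb !lexx => /(_ isT isT) h1 /(_ isT isT) h2.
    have h3 : L * (s - t) <= (L + M) * (s - t) by apply: Lge; rewrite subr_ge0.
    have h4 : M * (r - s) <= (L + M) * (r - s) by apply: Mge; rewrite subr_ge0.
    have -> : (L + M) * (r - t) = (L + M) * (r - s) + (L + M) * (s - t) by ring.
    by apply: lerD; [exact: le_trans h2 h4|exact: le_trans h1 h3].
  move=> t r /andP[at_ tb] /andP[ar rb].
  have [tr|/ltW rt] := leP t r; last exact: H.
  by rewrite distrC [`|t - r|]distrC; exact: H.
apply: (@ae_on_cat _ a s b); apply: ae_on_oo.
  apply: ae_on_imp hy => t _ [dy hdy Fdy] /andP[at_ ts].
  exists dy; last by rewrite wl // ltW.
  apply: near_eq_is_derive hdy; near=> r; rewrite wl //.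
  by near: r; apply: filterS (lt_nbhsl ts) => q /ltW.
apply: ae_on_imp hz => t _ [dz hdz Fdz] /andP[st tb].
exists dz; last by rewrite wr // ltW.
apply: near_eq_is_derive hdz; near=> r; rewrite wr //.
by near: r; apply: filterS (lt_nbhsr st) => q /ltW.
Unshelve. all: by end_near. Qed.

Section value_function.
Variables (phi : 'rV[R]_n -> R) (T : R).
Hypothesis phi_lip : locally_lipschitz phi.
Let V := value T F phi.

Lemma locally_lipschitz_continuous : continuous phi.
Proof.
move=> x; have [U xU hU] := phi_lip x.
have [M M0 hM] : exists2 M, 0 < M & forall y z : 'rV[R]_n, U y -> U z ->
    `|phi y - phi z| <= M * `|y - z|.
  have [M M0 hM] := pinfty_ex_gt0 hU; exists M => // y z Uy Uz.
  exact: (hM (y, z)).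
apply/(@cvgrPdist_le _ _ _ (nbhs x)) => e e0.
have Ux := nbhs_singleton xU.
have xB : nbhs x (ball x (e / M)) by apply: nbhsx_ballx; rewrite divr_gt0.
apply: filterS2 xU xB => y Uy; rewrite -ball_normE /ball_ /= => /ltW hy.
apply: le_trans (hM x y Ux Uy) _.
by rewrite mulrC -ler_pdivlMr.
Qed.

Lemma norm_ball_compact (c : 'rV[R]_n) (r : R) : compact [set z : 'rV[R]_n | `|z - c| <= r].
Proof.
apply: bounded_closed_compact.
  exists (r + `|c|); split; first exact: num_real.
  move=> M hM z /= hz; apply: ltW; apply: le_lt_trans hM.
  have := ler_normD (z - c) c; rewrite subrK; lra.
have -> : [set z : 'rV[R]_n | `|z - c| <= r] =
    (fun z : 'rV[R]_n => `|z - c|) @^-1` [set x | x <= r].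
  by [].
apply: closed_comp; last exact: closed_le.
move=> z _; apply/(@cvgrPdist_le _ _ _ (nbhs z)) => e e0.
apply: filterS (nbhsx_ballx z e e0) => y; rewrite -ball_normE /ball_ /= => /ltW hy.
apply: le_trans (ler_dist_dist _ _) _; apply: le_trans hy.
by have -> : z - c - (y - c) = z - y by rewrite opprB addrA subrK.
Qed.

(** Gronwall confines the trajectories from [x] to a ball, on which the cost is
    bounded below. *)
Lemma cost_bounded_below t x : t <= T ->
  exists c, forall y, trajectory T F t x y -> c <= phi (y T).
Proof.
move=> tT; have [K K0 hK] := traj_bound t T x.
have [|c _ hc] := EVT_min_rV _ (@norm_ball_compact 0 K)
  (continuous_subspaceT locally_lipschitz_continuous).
  by exists 0; rewrite /= subrr normr0 ltW.
exists (phi c) => y hy; apply: hc; rewrite inE /= subr0.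
have [_ _ yx] := hy.
by apply: (hK y (trajectory_traj tT hy) yx); rewrite tT lexx.
Qed.

Lemma value_le t y : t <= T -> traj t T y -> V t (y t) <= phi (y T).
Proof.
move=> tT hy; have [c hc] := cost_bounded_below (y t) tT.
apply: ge_inf.
  by exists c => _ [z hz <-]; exact: hc.
by exists y => //; exact: traj_trajectory.
Qed.

Lemma value_ge t x c : t <= T -> (exists2 y, traj t T y & y t = x) ->
  (forall y, traj t T y -> y t = x -> c <= phi (y T)) -> c <= V t x.
Proof.
move=> tT [y hy yx] h; apply: lb_le_inf.
  by exists (phi (y T)), y => //; rewrite -yx; exact: traj_trajectory.
move=> _ [z hz <-]; have [_ _ zx] := hz.
by apply: h => //; exact: trajectory_traj hz.
Qed.

Lemma value_near t x d : t <= T -> 0 < d -> (exists2 y, traj t T y & y t = x) ->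
  exists y, [/\ traj t T y, y t = x & phi (y T) <= V t x + d].
Proof.
move=> tT d0 ex; apply: contrapT => hno.
have : V t x + d <= V t x.
  apply: value_ge => // y hy yx; rewrite leNgt; apply/negP => /ltW hlt.
  by apply: hno; exists y.
by rewrite leNgt ltrDl d0.
Qed.

Lemma value_dpp t s y : t <= s -> s <= T -> traj t s y ->
  (exists2 z, traj s T z & z s = y s) -> V t (y t) <= V s (y s).
Proof.
move=> ts sT hy ex; apply: value_ge => // z hz zs.
have [w [hw wl wr]] := traj_cat ts sT hy hz (esym zs).
have := value_le (le_trans ts sT) hw.
by rewrite wl // wr.
Qed.

Lemma optimal_value t x y : t <= T -> optimal T F phi t x y -> phi (y T) = V t x.
Proof.
move=> tT [hy hopt]; have [_ _ yx] := hy.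
have ty := trajectory_traj tT hy.
apply/le_anti; apply/andP; split; last by rewrite -yx; exact: value_le.
apply: value_ge => //; first by exists y.
by move=> z hz zx; apply: hopt; rewrite -zx; exact: traj_trajectory.
Qed.

End value_function.
End trajectories.

(** * Tubes around Hamiltonian arcs *)
Section tube_section.
Variables (R : realType) (n : nat).

Lemma der_dotv (y z : R -> 'rV[R]_n) (s : R) (dy dz : 'rV[R]_n) :
  is_derive s 1 y dy -> is_derive s 1 z dz ->
  is_derive s 1 (fun t => dotv (y t) (z t)) (dotv dy (z s) + dotv (y s) dz).
Proof.
move=> /is_derive_coordP hy /is_derive_coordP hz; rewrite /dotv -big_split /=.
have := @der_sum R n (fun i t => y t 0 i * z t 0 i)
  (fun i t => dy 0 i * z s 0 i + y s 0 i * dz 0 i) s.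
by apply=> i; exact: derM.
Qed.

Variable F : 'rV[R]_n -> set 'rV[R]_n.

(** What the deviation estimate needs to know about a Hamiltonian arc [(X, P)]: near
    [X s] the field [u s] selects the velocity maximizing the pairing with [P s];
    [tube_gap] is the curvature of [F y] there; and [tube_taylor] says that the
    maximal pairing, as a function of [y], has gradient [q s] at [X s] up to second
    order, so that [P' = - q] is the costate equation. *)
Record tube (a b : R) (X P : R -> 'rV[R]_n) (u : R -> 'rV[R]_n -> 'rV[R]_n)
    (q : R -> 'rV[R]_n) (rho C : R) : Prop := Tube {
  tube_rho : 0 < rho;
  tube_C : 1 <= C;
  tube_X : forall s, a <= s <= b -> is_derive s 1 X (u s (X s));
  tube_P : forall s, a <= s <= b -> is_derive s 1 P (- q s);
  tube_lip : forall s y y', `|u s y - u s y'| <= C * `|y - y'|;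
  tube_cont : forall y, continuous (u^~ y);
  tube_bounded : forall s y, `|u s y| <= C;
  tube_qb : forall s, a <= s <= b -> `|q s| <= C;
  tube_in : forall s y, a <= s <= b -> `|y - X s| <= rho -> F y (u s y);
  tube_gap : forall s y v, a <= s <= b -> `|y - X s| <= rho -> F y v ->
    dotv (u s y - v) (u s y - v) <= C * dotv (P s) (u s y - v);
  tube_taylor : forall s y, a <= s <= b -> `|y - X s| <= rho ->
    `|dotv (P s) (u s y - u s (X s)) - dotv (q s) (y - X s)| <=
      C * `|y - X s| ^+ 2;
  tube_Pb : forall s, a <= s <= b -> `|P s| <= C
}.

Variables (a b : R) (X P : R -> 'rV[R]_n) (u : R -> 'rV[R]_n -> 'rV[R]_n).
Variables (q : R -> 'rV[R]_n) (rho C : R).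
Hypothesis ab : a <= b.
Hypothesis tb : tube a b X P u q rho C.

Let C0 : 0 < C. Proof. exact: lt_le_trans ltr01 (tube_C tb). Qed.

Lemma lip_of_bounded_derive (y dy : R -> 'rV[R]_n) (c d M : R) :
  (forall s, c <= s <= d -> is_derive s 1 y (dy s)) ->
  (forall s, c <= s <= d -> `|dy s| <= M) -> lip c d y.
Proof.
move=> hy hM; apply: lip_vec => i; exists M.
apply: (@lip_of_derive R c d _ (fun s => dy s 0 i)) => s sab.
  by move/is_derive_coordP : (hy s sab).
exact: le_trans (norm_coord_le _ _) (hM s sab).
Qed.

Lemma tube_X_lip : lip a b X.
Proof.
apply: (lip_of_bounded_derive (tube_X tb) (M := C)) => s _.
exact: (tube_bounded tb).
Qed.

Lemma tube_P_lip : lip a b P.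
Proof.
apply: (lip_of_bounded_derive (tube_P tb) (M := C)) => s sab.
by rewrite normrN; exact: (tube_qb tb).
Qed.

(** The feedback [u] turns a perturbation of the arc at any time into a trajectory on
    the whole interval.  By [tube_taylor] and the costate equation, the derivative of
    its pairing with the costate is of second order. *)
Lemma tube_feedback : exists2 K, 1 <= K & forall s0 z, a <= s0 <= b ->
  K * `|z| <= rho -> exists y, [/\ traj F a b y, y s0 = X s0 + z &
    forall s, a <= s <= b -> `|y s - X s| <= K * `|z| /\
      `|dotv (P s) (y s - X s) - dotv (P s0) z| <= K * `|z| ^+ 2].
Proof.
pose K1 := 2 * expR (2 * C * (b - a)).
have K11 : 1 <= K1.
  have : 1 <= expR (2 * C * (b - a)).
    rewrite -[leLHS](@expR0 R) ler_expR !mulr_ge0 ?subr_ge0 // ltW //.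
  by rewrite /K1; lra.
have K10 : 0 < K1 by exact: lt_le_trans K11.
pose K2 := C * K1 ^+ 2 * (b - a).
have K20 : 0 <= K2 by rewrite !mulr_ge0 ?subr_ge0 ?exprn_ge0 // ltW.
exists (K1 + K2); first by lra.
move=> s0 z s0ab Kz; have [as0 s0b] := andP s0ab.
have K1z : K1 * `|z| <= rho.
  by apply: le_trans Kz; rewrite ler_wpM2r // lerDl.
have [y ys0 hy] := picard C0 (tube_lip tb) (tube_cont tb)
  (fun y => ex_intro _ C (fun s => tube_bounded tb s y)) s0 (X s0 + z).
have ly c d : lip c d y.
  by apply: (lip_of_bounded_derive (fun s _ => hy s) (M := C)) => s _; exact: (tube_bounded tb).
pose D s := y s - X s.
have dD s : a <= s <= b -> is_derive s 1 D (u s (y s) - u s (X s)).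
  by move=> sab; exact: (der_vecB (hy s) (tube_X tb sab)).
have Ds0 : D s0 = z by rewrite /D ys0 addrC addKr.
have lD : lip a b D by apply: lipB; [exact: ly|exact: tube_X_lip].
have haD : ae_on a b (fun s => exists2 dD : 'rV[R]_n,
    forall i, is_derive s 1 (fun t => D t 0 i) (dD 0 i) & `|dD| <= C * `|D s| + 0).
  apply: ae_on_all => s sab; exists (u s (y s) - u s (X s)).
    by move=> i; move/is_derive_coordP : (dD s sab).
  by rewrite addr0; exact: (tube_lip tb).
have Db s : a <= s <= b -> `|D s| <= K1 * `|z|.
  move=> /andP[as_ sb].
  have E t : 0 <= t <= b - a ->
      (2 * `|z| + 0 / C) * expR (2 * C * t) <= K1 * `|z|.
    move=> /andP[t0 tba]; rewrite mul0r addr0 /K1 mulrAC.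
    rewrite ler_wpM2r // ler_pM2l // ler_expR.
    by rewrite ler_wpM2l // mulr_ge0 // ltW.
  have [s0s|/ltW ss0] := leP s0 s.
    have := @gronwall_lip R n s0 b C 0 D C0 (lexx _) (lip_sub as0 (lexx _) lD)
      (ae_on_sub as0 (lexx _) haD) s.
    rewrite s0s sb Ds0 => /(_ isT)/le_trans; apply; apply: E.
    by rewrite subr_ge0 s0s /= lerB.
  have := @gronwall_lip_rev R n a s0 C 0 D C0 (lexx _) (lip_sub (lexx _) s0b lD)
    (ae_on_sub (lexx _) s0b haD) s.
  rewrite as_ ss0 Ds0 => /(_ isT)/le_trans; apply; apply: E.
  by rewrite subr_ge0 ss0 /= lerB.
have Drho s : a <= s <= b -> `|D s| <= rho.
  by move=> sab; exact: le_trans (Db s sab) K1z.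
exists y; split => //.
  split; first exact: ly.
  by apply: ae_on_all => s sab; exists (u s (y s)); [exact: hy|exact: (tube_in tb sab (Drho s sab))].
move=> s sab; split.
  by apply: le_trans (Db s sab) _; rewrite ler_wpM2r // lerDl.
have lf : lip_on a b (C * (K1 * `|z|) ^+ 2) (fun s => dotv (P s) (D s)).
  apply: (lip_of_derive (fun s sab => der_dotv (tube_P tb sab) (dD s sab))).
  move=> t tab; rewrite dotvNl addrC.
  apply: le_trans (tube_taylor tb tab (Drho t tab)) _.
  have K1z0 : 0 <= K1 * `|z| by rewrite mulr_ge0 // ltW.
  by rewrite ler_pM2l // ler_pXn2r ?nnegrE //; exact: Db.
have := lf s s0 sab s0ab; rewrite Ds0 => /le_trans; apply.
have ss : `|s - s0| <= b - a.
  by case/andP: sab => ? ?; rewrite ler_norml; apply/andP; split; lra.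
apply: (@le_trans _ _ (K2 * `|z| ^+ 2)); last first.
  by rewrite ler_wpM2r ?exprn_ge0 // lerDr ltW.
have -> : K2 * `|z| ^+ 2 = C * (K1 * `|z|) ^+ 2 * (b - a) by rewrite /K2; ring.
by rewrite ler_wpM2l // mulr_ge0 ?exprn_ge0 ?mulr_ge0 // ltW.
Qed.

(** The pointwise hypothesis of [deviation_estimate]: [tube_gap] bounds the square of
    [u s (y s) - dy] by the growth of the pairing, and the inequality
    [x <= lam x^2 + 1 / lam] makes it linear. *)
Lemma tube_deviation (C' s : R) (y : R -> 'rV[R]_n) (dy : 'rV[R]_n) :
  C <= C' -> a <= s <= b -> `|y s - X s| <= rho ->
  is_derive s 1 y dy -> F (y s) dy ->
  exists (dw : 'rV[R]_n) (dJ : R),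
    [/\ is_derive s 1 (fun t => y t - X t) dw,
        is_derive s 1 (fun t => dotv (P t) (y t - X t)) (- dJ) &
        forall lam i, 0 < lam -> `|dw 0 i| <= C' * `|y s - X s|
           + C' * lam * (dJ + C' * `|y s - X s| ^+ 2) + C' / lam].
Proof.
move=> CC' sab hrho hy Fy.
set w := y s - X s in hrho *.
pose dw := dy - u s (X s).
pose dJ := dotv (q s) w - dotv (P s) dw.
have hw : is_derive s 1 (fun t => y t - X t) dw.
  exact: (der_vecB hy (tube_X tb sab)).
exists dw, dJ; split => //.
  have := der_dotv (tube_P tb sab) hw.
  by rewrite dotvNl -/w /dJ opprB addrC.
move=> lam i lam0.
set gap := dotv (P s) (u s (y s) - dy).
have hgap := tube_gap tb sab hrho Fy.
have htay := tube_taylor tb sab hrho.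
have EJ : dJ = gap + (dotv (q s) w - dotv (P s) (u s (y s) - u s (X s))).
  by rewrite /dJ /gap /dw !dotvBr; ring.
have gapJ : gap <= dJ + C' * `|w| ^+ 2.
  have : C * `|w| ^+ 2 <= C' * `|w| ^+ 2 by rewrite ler_wpM2r ?exprn_ge0.
  move: htay; rewrite ler_norml EJ => /andP[? ?]; lra.
have gap0 : 0 <= gap.
  have := le_trans (dotv_ge0 _) hgap; rewrite pmulr_rge0 //.
set e := u s (y s) - dy in gap hgap EJ gapJ gap0.
have e2 : e 0 i ^+ 2 <= C * gap by exact: le_trans (coord_sqr_le _ _) hgap.
have eb : `|e 0 i| <= lam * (C * gap) + lam^-1.
  have h : `|e 0 i| <= lam * `|e 0 i| ^+ 2 + lam^-1.
    rewrite -subr_ge0; have -> : lam * `|e 0 i| ^+ 2 + lam^-1 - `|e 0 i| =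
      lam * ((`|e 0 i| - lam^-1 / 2) ^+ 2 + 3 / 4 * lam^-1 ^+ 2).
      by field; rewrite gt_eqF.
    by rewrite mulr_ge0 ?(ltW lam0) // addr_ge0 ?sqr_ge0 // mulr_ge0 ?sqr_ge0 //; lra.
  apply: le_trans h _; rewrite lerD2r ler_pM2l //.
  by rewrite real_normK // num_real.
have dwE : dw 0 i = - e 0 i + (u s (y s) - u s (X s)) 0 i.
  by rewrite /dw /e !mxE; ring.
have hu : `|(u s (y s) - u s (X s)) 0 i| <= C * `|w|.
  exact: le_trans (norm_coord_le _ _) (tube_lip tb _ _ _).
rewrite dwE; apply: le_trans (ler_normD _ _) _; rewrite normrN.
have C'1 : 1 <= C' by exact: le_trans (tube_C tb) CC'.
have h1 : C * `|w| <= C' * `|w| by rewrite ler_wpM2r.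
have h2 : lam^-1 <= C' / lam by rewrite ler_peMl // invr_ge0 ltW.
have h3 : lam * (C * gap) <= C' * lam * (dJ + C' * `|w| ^+ 2).
  rewrite mulrCA mulrA; apply: ler_pM => //; first by rewrite mulr_ge0 // ltW.
  by rewrite ler_wpM2r // ltW.
lra.
Qed.

Section pairing_bounds.
Variable K0 : R.
Hypothesis K0_ge0 : 0 <= K0.

(** The deviation estimate for [w = y - X] and [J = - dotv P w]. *)
Lemma deviation_forward : exists2 K, 1 <= K & forall (rho1 kappa sigma : R) y,
  rho1 <= rho -> traj F a b y -> 0 < sigma -> K * sigma < rho1 ->
  (forall s, a <= s <= b -> `|y s - X s| <= rho1 ->
    - dotv (P s) (y s - X s) <= kappa + K0 * `|y s - X s| ^+ 2) ->
  kappa - sigma ^+ 2 <= - dotv (P a) (y a - X a) -> `|y a - X a| <= sigma ->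
  forall s, a <= s <= b -> `|y s - X s| <= K * sigma.
Proof.
have C1 : 1 <= C + K0.
  by apply: le_trans (tube_C tb) _; rewrite lerDl.
have [K K1 hK] := @deviation_estimate R n a b (C + K0) ab C1.
exists K => // rho1 kappa sigma y r1 [ly hy] s0 Ks hJ Ja wa.
have lw : lip a b (fun s => y s - X s) by apply: lipB => //; exact: tube_X_lip.
apply: (hK rho1 sigma kappa (fun s => y s - X s)
  (fun s => - dotv (P s) (y s - X s))) => //.
- by apply: lipN; apply: lip_dotv => //; exact: tube_P_lip.
- apply: ae_on_imp hy => s sab [dy hdy Fdy] hr.
  have CC' : C <= C + K0 by rewrite lerDl.
  have [dw [dJ [h1 h2 h3]]] := tube_deviation CC' sab (le_trans hr r1) hdy Fdy.
  exists dw, dJ; split => //; first by move/is_derive_coordP : h1.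
  by have := derN h2; rewrite opprK.
- move=> s sab hr; apply: le_trans (hJ s sab hr) _.
  by rewrite lerD2l ler_wpM2r ?exprn_ge0 // lerDr ltW.
Qed.

(** The deviation estimate for the reversed deviation and [J = dotv P w]. *)
Lemma deviation_backward : exists2 K, 1 <= K & forall (rho1 kappa sigma : R) y,
  rho1 <= rho -> traj F a b y -> 0 < sigma -> K * sigma < rho1 ->
  (forall s, a <= s <= b -> `|y s - X s| <= rho1 ->
    dotv (P s) (y s - X s) <= kappa + K0 * `|y s - X s| ^+ 2) ->
  kappa - sigma ^+ 2 <= dotv (P b) (y b - X b) -> `|y b - X b| <= sigma ->
  forall s, a <= s <= b -> `|y s - X s| <= K * sigma.
Proof.
have C1 : 1 <= C + K0.
  by apply: le_trans (tube_C tb) _; rewrite lerDl.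
have [K K1 hK] := @deviation_estimate R n a b (C + K0) ab C1.
exists K => // rho1 kappa sigma y r1 [ly hy] s0 Ks hJ Jb wb s sab.
have lw : lip a b (fun s => y s - X s) by apply: lipB => //; exact: tube_X_lip.
have lrev (V : normedModType R) (f : R -> V) : lip a b f -> lip a b (fun t => f (a + b - t)).
  move=> [M hM]; exists M => t r /andP[? ?] /andP[? ?].
  have := hM (a + b - t) (a + b - r).
  have -> : a + b - t - (a + b - r) = r - t by ring.
  by rewrite [`|r - t|]distrC; apply; apply/andP; split; lra.
pose w t := y (a + b - t) - X (a + b - t).
have wE t : w (a + b - t) = y t - X t.
  by rewrite /w; have -> : a + b - (a + b - t) = t by ring.
have wa : w a = y b - X b by rewrite -wE; congr w; ring.
have abr t : a <= t <= b -> a <= a + b - t <= b.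
  by move=> /andP[? ?]; apply/andP; split; lra.
rewrite -wE; apply: (hK rho1 sigma kappa w
  (fun t => dotv (P (a + b - t)) (w t))) => //.
- exact: (lrev _ _ lw).
- by apply: (lrev _ (fun t => dotv (P t) (y t - X t))); apply: lip_dotv => //; exact: tube_P_lip.
- apply: ae_on_imp (ae_on_rev hy) => t tab [dy hdy Fdy] hr.
  have CC' : C <= C + K0 by rewrite lerDl.
  have [dw [dJ [h1 h2 h3]]] := tube_deviation CC' (abr t tab) (le_trans hr r1) hdy Fdy.
  exists (- dw), dJ; split.
  + by move=> i; rewrite mxE; move/is_derive_coordP : h1 => h1; exact: (is_derive_reflect (h1 i)).
  + by have := is_derive_reflect h2; rewrite opprK.
  + by move=> lam i lam0; rewrite mxE normrN; exact: h3.
- move=> t tab hr; apply: le_trans (hJ _ (abr t tab) hr) _.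
  by rewrite lerD2l ler_wpM2r ?exprn_ge0 // lerDr ltW.
- by rewrite wa; have -> : a + b - a = b by ring.
- by rewrite wa.
- exact: abr.
Qed.

End pairing_bounds.
End tube_section.

(** * The flow of the Hamiltonian field near a reference arc *)
Section clamping.
Variable R : realType.

Definition clamp (lo hi x : R) : R := Num.max lo (Num.min hi x).

Lemma clamp_id lo hi x : lo <= x <= hi -> clamp lo hi x = x.
Proof. by move=> /andP[h1 h2]; rewrite /clamp min_r // max_r. Qed.

Lemma clamp_in lo hi x : lo <= hi -> lo <= clamp lo hi x <= hi.
Proof. by move=> h; rewrite /clamp le_max lexx /= ge_max h ge_min lexx. Qed.

Lemma clamp_lip lo hi x y : `|clamp lo hi x - clamp lo hi y| <= `|x - y|.
Proof.
wlog xy : x y / x <= y.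
  move=> H; have [xy|/ltW yx] := leP x y; first exact: H.
  by rewrite distrC [leRHS]distrC; exact: H.
rewrite distrC [leRHS]distrC [leRHS]ger0_norm ?subr_ge0 // /clamp.
have h : 0 <= Num.min hi y - Num.min hi x <= y - x.
  by case: (leP hi x) => ?; case: (leP hi y) => ?; apply/andP; split; lra.
move: (Num.min hi y) (Num.min hi x) h => p q /andP[h1 h2].
rewrite ler_norml; case: (leP lo p) => ?; case: (leP lo q) => ?;
by apply/andP; split; lra.
Qed.

Definition vclamp n (r : R) (v : 'rV[R]_n) : 'rV[R]_n := \row_i clamp (- r) r (v 0 i).

Lemma vclamp_id n r (v : 'rV[R]_n) : `|v| <= r -> vclamp r v = v.
Proof.
move=> h; apply/rowP => i; rewrite mxE clamp_id // -ler_norml.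
exact: le_trans (norm_coord_le _ _) h.
Qed.

Lemma vclamp_le n r (v : 'rV[R]_n) : 0 <= r -> `|vclamp r v| <= r.
Proof.
move=> r0; apply: norm_coordP => // i; rewrite mxE ler_norml clamp_in //.
by rewrite ge0_cp.
Qed.

Lemma vclamp_lip n r (v w : 'rV[R]_n) : `|vclamp r v - vclamp r w| <= `|v - w|.
Proof.
apply: norm_coordP => // i; rewrite !mxE; apply: le_trans (clamp_lip _ _ _ _) _.
by have := norm_coord_le (v - w) i; rewrite !mxE.
Qed.

End clamping.

Section flow.
Local Opaque ham_field.
Variables (R : realType) (n : nat) (F : 'rV[R]_n -> set 'rV[R]_n).
Let H := hamiltonian F.
Hypothesis F_nonempty_compact : forall x, F x !=set0 /\ compact (F x).
Variable Gam : R.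
Hypothesis Gam0 : 0 < Gam.
Hypothesis F_growth : forall x v, F x v -> `|v| <= Gam * (1 + `|x|).
Hypothesis H_C2 : C2_on [set xp : 'rV[R]_n * 'rV[R]_n | xp.2 != 0]
  (fun xp => H xp.1 xp.2).

Lemma ham_differentiable (x p : 'rV[R]_n) : p != 0 ->
  differentiable (H x) p /\ differentiable (H^~ p) x.
Proof.
move=> p0; have [c1 _] := H_C2; have [dH _] := c1 (x, p) p0; split.
  have d : differentiable (fun q : 'rV[R]_n => (x, q)) p.
    by apply: differentiable_pair; [exact: differentiable_cst|exact: ex_diff].
  exact: (differentiable_comp d dH).
have d : differentiable (fun y : 'rV[R]_n => (y, p)) x.
  by apply: differentiable_pair; [exact: ex_diff|exact: differentiable_cst].
exact: (differentiable_comp d dH).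
Qed.

Variables (a b : R) (Zb : R -> 'rV[R]_(n + n)).
Hypothesis ab : a <= b.
Hypothesis Zb_lip : lip a b Zb.
Hypothesis Zb_dom : forall s, a <= s <= b -> ham_dom (Zb s).

Variable r : R.
Hypothesis r0 : 0 < r.
Hypothesis field_lip : forall s, a <= s <= b -> forall Z, `|Z - Zb s| < r ->
    ham_dom Z /\ forall Z', `|Z' - Zb s| < r ->
    `|ham_field H Z' - ham_field H Z| <= r^-1 * `|Z' - Z|.

Let c s := clamp a b s.
Let cab s : a <= c s <= b. Proof. exact: clamp_in. Qed.

(** The Hamiltonian field, extended by projection from a tube around [Zb] to all
    times and points: it is globally Lipschitz and bounded, so its solutions are
    global. *)
Definition frozen_field (s : R) (Z : 'rV[R]_(n + n)) : 'rV[R]_(n + n) :=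
  ham_field H (Zb (clamp a b s) + vclamp (r / 2) (Z - Zb (clamp a b s))).

Let r20 : 0 < r / 2. Proof. by rewrite divr_gt0. Qed.
Let r2r : r / 2 < r. Proof. by rewrite ltr_pdivrMr // ltr_pMr // ltr1n. Qed.

Lemma frozen_field_in s Z : a <= s <= b -> `|Z - Zb s| <= r / 2 ->
  frozen_field s Z = ham_field H Z.
Proof.
move=> sab h; have E := clamp_id sab; rewrite /frozen_field E (vclamp_id h).
by rewrite addrC subrK.
Qed.

Let frozen_near s (Z : 'rV[R]_(n + n)) :
  `|Zb (c s) + vclamp (r / 2) (Z - Zb (c s)) - Zb (c s)| < r.
Proof.
have -> : Zb (c s) + vclamp (r / 2) (Z - Zb (c s)) - Zb (c s) = vclamp (r / 2) (Z - Zb (c s)).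
  by rewrite addrC addKr.
by apply: le_lt_trans r2r; rewrite vclamp_le // ltW.
Qed.

Lemma frozen_field_lip s Z Z' :
  `|frozen_field s Z - frozen_field s Z'| <= r^-1 * `|Z - Z'|.
Proof.
have [_ h] := field_lip (cab s) (frozen_near s Z').
apply: le_trans (h _ (frozen_near s Z)) _.
rewrite ler_wpM2l ?invr_ge0 ?(ltW r0) // opprD addrACA subrr add0r.
apply: le_trans (vclamp_lip _ _ _) _.
by rewrite opprB addrA subrK.
Qed.

Lemma frozen_field_cont Z : continuous (frozen_field^~ Z).
Proof.
move=> s; have r0' := r0; have [L L0 hL] := lip_pos Zb_lip.
have zl t : `|Zb (c t) - Zb (c s)| <= L * `|t - s|.
  apply: le_trans (hL _ _ (cab t) (cab s)) _.
  by rewrite ler_pM2l // clamp_lip.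
apply/cvgrPdist_le => e e0; near=> t.
have ts : `|t - s| <= Num.min (r / (4 * L)) (e * r / (2 * L)).
  rewrite distrC; near: t; apply: cvgr_dist_le => //.
  by rewrite lt_min !divr_gt0 ?mulr_gt0.
move: ts; rewrite le_min !ler_pdivlMr ?mulr_gt0 // => /andP[ts1 ts2].
have hz := zl t.
have [_ h] := field_lip (cab s) (frozen_near s Z).
have near_t : `|Zb (c t) + vclamp (r / 2) (Z - Zb (c t)) - Zb (c s)| < r.
  have -> : Zb (c t) + vclamp (r / 2) (Z - Zb (c t)) - Zb (c s) =
    (Zb (c t) - Zb (c s)) + vclamp (r / 2) (Z - Zb (c t)) by rewrite addrAC.
  apply: le_lt_trans (ler_normD _ _) _.
  have := @vclamp_le R (n + n) (r / 2) (Z - Zb (c t)) (ltW r20); lra.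
rewrite distrC /frozen_field -/(c s) -/(c t).
apply: le_trans (h _ near_t) _; rewrite ler_pdivrMl //; apply: (@le_trans _ _ (2 * `|Zb (c t) - Zb (c s)|)).
  have -> : Zb (c t) + vclamp (r / 2) (Z - Zb (c t)) -
      (Zb (c s) + vclamp (r / 2) (Z - Zb (c s))) = (Zb (c t) - Zb (c s)) +
    (vclamp (r / 2) (Z - Zb (c t)) - vclamp (r / 2) (Z - Zb (c s))).
    by rewrite opprD addrACA.
  apply: le_trans (ler_normD _ _) _; rewrite mulr_natl mulr2n lerD2l.
  apply: le_trans (vclamp_lip _ _ _) _.
  have -> : Z - Zb (c t) - (Z - Zb (c s)) = Zb (c s) - Zb (c t).
    by rewrite opprB addrC subrKA.
  by rewrite distrC.
lra.
Unshelve. all: by end_near. Qed.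

Lemma ham_field_bounded : exists2 M, 0 < M & forall s, a <= s <= b ->
  `|ham_field H (Zb s)| <= M.
Proof.
have [|s sab|rho rho0 h] := @compact_uniform R a b
  (fun s rho => `|ham_field H (Zb s)| <= rho^-1).
- move=> t rho rho' h r'0 rr; apply: le_trans h _.
  by rewrite lef_pV2 // posrE // (lt_le_trans r'0).
- have [L L0 hL] := lip_pos Zb_lip.
  exists (r / L); first by rewrite divr_gt0.
  have N0 : 0 < `|ham_field H (Zb s)| + 1 by rewrite ltr_wpDl.
  exists (`|ham_field H (Zb s)| + 1)^-1; first by rewrite invr_gt0.
  move=> t tab; rewrite ltr_pdivlMr // mulrC invrK => ts.
  have zts : `|Zb t - Zb s| < r by exact: le_lt_trans (hL _ _ tab sab) ts.
  have [|_ h] := field_lip sab (Z := Zb s); first by rewrite subrr normr0.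
  have := h (Zb t) zts.
  have h1 : r^-1 * `|Zb t - Zb s| <= 1 by rewrite ler_pdivrMl // mulr1 ltW.
  move=> h2.
  have := ler_normD (ham_field H (Zb t) - ham_field H (Zb s)) (ham_field H (Zb s)).
  rewrite subrK => /le_trans; apply; rewrite addrC lerD2l.
  exact: le_trans h2 h1.
by exists rho^-1; rewrite ?invr_gt0.
Qed.

Lemma frozen_field_bounded : exists2 M, 0 < M & forall s Z, `|frozen_field s Z| <= M.
Proof.
have [M M0 hM] := ham_field_bounded.
exists (M + 1); first by rewrite addr_gt0.
move=> s Z; have [|_ h] := field_lip (cab s) (Z := Zb (c s)).
  by rewrite subrr normr0.
have h2 := h _ (frozen_near s Z).
have h1 : r^-1 * `|Zb (c s) + vclamp (r / 2) (Z - Zb (c s)) - Zb (c s)| <= 1.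
  by rewrite ler_pdivrMl // mulr1 ltW // frozen_near.
have h3 := hM _ (cab s).
have := ler_normD (frozen_field s Z - ham_field H (Zb (c s))) (ham_field H (Zb (c s))).
rewrite subrK => /le_trans; apply; rewrite addrC lerD //.
exact: le_trans h2 h1.
Qed.

Hypothesis Zb_field : ae_on a b (fun s => is_derive s 1 Zb (ham_field H (Zb s))).

Let ir0 : 0 < r^-1. Proof. by rewrite invr_gt0. Qed.

Local Opaque frozen_field.

(** Gronwall gives the Lipschitz dependence, and identifies [Zb] with the flow line
    from its initial point. *)
Lemma flow_exists : exists Phi : 'rV[R]_(n + n) -> R -> 'rV[R]_(n + n),
  [/\ forall Z, Phi Z a = Z,
      forall Z (s : R), is_derive s 1 (Phi Z) (frozen_field s (Phi Z s)),
      forall s, a <= s <= b -> Phi (Zb a) s = Zb s &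
      exists2 K, 1 <= K & forall Z Z' s, a <= s <= b ->
        `|Phi Z s - Phi Z' s| <= K * `|Z - Z'|].
Proof.
have [M M0 hM] := frozen_field_bounded.
have /choice[Phi hPhi] : forall Z, exists y : R -> 'rV[R]_(n + n), y a = Z /\
    forall s : R, is_derive s 1 y (frozen_field s (y s)).
  move=> Z; have [y ? ?] := picard ir0 frozen_field_lip frozen_field_cont
    (fun Z => ex_intro _ M (fun s => hM s Z)) a Z.
  by exists y.
have lPhi Z : lip a b (Phi Z).
  by apply: (lip_of_bounded_derive (fun s _ => (hPhi Z).2 s) (M := M)) => s _.
have gron (D : R -> 'rV[R]_(n + n)) : lip a b D ->
    ae_on a b (fun s => exists2 dD : 'rV[R]_(n + n), is_derive s 1 D dD &
      `|dD| <= r^-1 * `|D s|) ->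
    forall s, a <= s <= b -> `|D s| <= 2 * expR (2 * r^-1 * (b - a)) * `|D a|.
  move=> lD hD s sab.
  have := @gronwall_lip R (n + n) a b r^-1 0 D ir0 (lexx _) lD _ s sab.
  move=> /(_ _)/le_trans; apply.
    apply: ae_on_imp hD => t _ [dD h1 h2]; exists dD; last by rewrite addr0.
    by move=> i; move/is_derive_coordP : h1.
  rewrite mul0r addr0 mulrAC ler_wpM2r // ler_pM2l // ler_expR.
  case/andP: sab => ? ?; by rewrite ler_wpM2l ?lerD2r // mulr_ge0 // ltW.
exists Phi; split.
- by move=> Z; have [] := hPhi Z.
- by move=> Z; have [] := hPhi Z.
- move=> s sab; apply/eqP; rewrite -subr_eq0 -normr_le0.
  have := gron (fun t => Phi (Zb a) t - Zb t) _ _ s sab.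
  have [-> _] := hPhi (Zb a); rewrite subrr normr0 mulr0; apply.
    exact: lipB.
  apply: ae_on_imp Zb_field => t tab ht.
  exists (frozen_field t (Phi (Zb a) t) - ham_field H (Zb t)).
    exact: (der_vecB ((hPhi (Zb a)).2 t) ht).
  have E : frozen_field t (Zb t) = ham_field H (Zb t).
    by apply: frozen_field_in => //; rewrite subrr normr0; exact: ltW.
  by rewrite -E; exact: frozen_field_lip.
- exists (2 * expR (2 * r^-1 * (b - a))).
    have : 1 <= expR (2 * r^-1 * (b - a)).
      by rewrite -[leLHS](@expR0 R) ler_expR !mulr_ge0 ?subr_ge0 // ltW.
    lra.
  move=> Z Z' s sab; have := gron (fun t => Phi Z t - Phi Z' t) _ _ s sab.
  have [-> dZ] := hPhi Z; have [-> dZ'] := hPhi Z'; apply.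
    exact: lipB.
  apply: ae_on_all => t tab.
  exists (frozen_field t (Phi Z t) - frozen_field t (Phi Z' t)).
    exact: (der_vecB (dZ t) (dZ' t)).
  exact: frozen_field_lip.
Qed.

Lemma partial_grads_lip s (y y' p p' : 'rV[R]_n) (k : R) : a <= s <= b ->
  `|row_mx y p - Zb s| < r -> `|row_mx y' p' - Zb s| < r ->
  `|y' - y| <= k -> `|p' - p| <= k ->
  [/\ p != 0, `|grad (H y') p' - grad (H y) p| <= r^-1 * k &
    `|grad (H^~ p') y' - grad (H^~ p) y| <= r^-1 * k].
Proof.
move=> sab h1 h2 hy hp; have [hd h] := field_lip sab h1.
have {}h := h _ h2; rewrite (row_mxB y' y p' p) in h.
have hk := norm_row_mx_le hy hp.
have {hk}h : `|ham_field H (row_mx y' p') - ham_field H (row_mx y p)| <= r^-1 * k.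
  by apply: le_trans h _; rewrite ler_wpM2l // ltW.
rewrite !ham_fieldE in h.
move: h; move: (grad (H y') p') (grad (H y) p) => g1 g2.
move: (grad (H^~ p') y') (grad (H^~ p) y) => g3 g4.
rewrite row_mxB -opprD => h; split.
- by move: hd; rewrite /ham_dom /= row_mxKr.
- by have := norm_lsubmx_le (row_mx (g1 - g2) (- (g3 - g4))); rewrite row_mxKl => /le_trans; apply.
- by have := norm_rsubmx_le (row_mx (g1 - g2) (- (g3 - g4))); rewrite row_mxKr normrN => /le_trans; apply.
Qed.

(** For the curvature bound, let [U] be the maximizing velocity at [p] and [v] another
    one.  At [p + tau (v - U)] the value [H y] is at least the pairing with [v],
    while its increment from [p] is the pairing of [tau (v - U)] with [U] up to
    [N tau^2 |v - U|^2]; for small [tau] the gain [tau |v - U|^2] is at least twice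
    this error and must be compensated by [dotv p (U - v)].  The constants do not depend
    on the arc. *)
Lemma flow_tube : exists2 C, 1 <= C & forall Phi : R -> 'rV[R]_(n + n),
  (forall s : R, is_derive s 1 Phi (frozen_field s (Phi s))) ->
  (forall s, a <= s <= b -> `|Phi s - Zb s| <= r / 8) ->
  exists u, tube F a b (fun s => lsubmx (Phi s)) (fun s => rsubmx (Phi s)) u
    (fun s => - rsubmx (frozen_field s (Phi s))) (r / 8) C.
Proof.
have [M M0 hM] := frozen_field_bounded.
have [B B0 hB] := lip_bounded Zb_lip.
pose V1 := Gam * (1 + (B + r)) + M.
have V10 : 0 < V1 by rewrite addr_gt0 // mulr_gt0 // !addr_gt0.
pose N := n%:R / r + 1; have N0 : 0 < N by rewrite ltr_wpDl // divr_ge0 // ltW.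
(* The first bound keeps the quadratic error at half of the gain, the second keeps
   [p + tau (v - U)] inside the tube. *)
pose tau := Num.min (2 * N)^-1 (r / (8 * V1)).
have tau0 : 0 < tau by rewrite lt_min invr_gt0 mulr_gt0 //= divr_gt0 // mulr_gt0.
pose C := 1 + (r^-1 + M + B + r + N + 2 / tau).
have C1 : r^-1 <= C /\ M <= C /\ B + r <= C /\ N <= C /\ 2 / tau <= C.
  have : 0 < 2 / tau by rewrite divr_gt0.
  move: M0 B0 r0 N0 ir0; rewrite /C => *; split; first lra.
  by split; [lra|split; [lra|split; lra]].
have [C_r [C_M [C_B [C_N C_tau]]]] := C1.
exists C.
  have : 0 < 2 / tau by rewrite divr_gt0.
  by move: M0 B0 r0 N0 ir0; rewrite /C => *; lra.
move=> Phi dPhi hPhi; have r0' := r0.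
pose X s := lsubmx (Phi s); pose P s := rsubmx (Phi s).
pose u s y := lsubmx (frozen_field s (row_mx y (P s))).
have PhiE s : row_mx (X s) (P s) = Phi s by rewrite hsubmxK.
have inside s y : a <= s <= b -> `|y - X s| <= r / 8 -> `|row_mx y (P s) - Zb s| <= r / 4.
  move=> sab hy.
  have -> : row_mx y (P s) - Zb s = row_mx (y - X s) 0 + (Phi s - Zb s).
    by rewrite -PhiE addrA add_row_mx add0r subrK.
  apply: le_trans (ler_normD _ _) _; rewrite norm_row_mx0.
  have := hPhi s sab; lra.
have insideH s y : a <= s <= b -> `|y - X s| <= r / 8 ->
    P s != 0 /\ frozen_field s (row_mx y (P s)) = ham_field H (row_mx y (P s)).
  move=> sab hy; have h := inside s y sab hy; split.
    have [|hd _] := field_lip sab (Z := row_mx y (P s)); first by lra.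
    by move: hd; rewrite /ham_dom /= row_mxKr.
  by apply: frozen_field_in => //; lra.
have uE s y : a <= s <= b -> `|y - X s| <= r / 8 ->
    P s != 0 /\ u s y = grad (H y) (P s).
  move=> sab hy; have [P0 h] := insideH s y sab hy; split; first exact: P0.
  by rewrite /u h ham_fieldE row_mxKl.
have XX s : a <= s <= b -> `|X s - X s| <= r / 8.
  by move=> sab; rewrite subrr normr0 divr_ge0 // ltW.
have cP y : continuous (fun s => row_mx y (P s) : 'rV[R]_(n + n)).
  apply: (@is_derive_continuous R _ _
    (fun s => row_mx 0 (rsubmx (frozen_field s (Phi s))))) => s.
  apply/is_derive_coordP => i; case: (split_ordP i) => j ->.
    under [fun t : R => _]eq_fun do rewrite row_mxEl.
    by rewrite row_mxEl mxE; exact: der_cst.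
  under [fun t : R => _]eq_fun do rewrite row_mxEr mxE.
  by rewrite row_mxEr mxE; move/is_derive_coordP : (dPhi s).
have insideP s y1 p1 : a <= s <= b -> `|y1 - X s| <= r / 8 -> `|p1 - P s| <= r / 8 ->
    `|row_mx y1 p1 - Zb s| < r.
  move=> sab h1 h2.
  have -> : row_mx y1 p1 - Zb s = row_mx (y1 - X s) (p1 - P s) + (Phi s - Zb s).
    by rewrite -row_mxB PhiE subrKA.
  apply: le_lt_trans (ler_normD _ _) _.
  have := norm_row_mx_le h1 h2; have := hPhi s sab; lra.
have PP s : `|P s - P s| <= r / 8 by rewrite subrr normr0 divr_ge0 // ltW.
exists u; split.
- by rewrite divr_gt0.
- have : 0 < 2 / tau by rewrite divr_gt0.
  by move: M0 B0 r0 N0 ir0; rewrite /C => *; lra.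
- move=> s sab; apply/is_derive_coordP => i; rewrite /u PhiE.
  under [fun t : R => _]eq_fun do rewrite mxE.
  by rewrite mxE; exact: ((is_derive_coordP _ _ _).1 (dPhi s) (lshift n i)).
- move=> s sab; rewrite opprK; apply/is_derive_coordP => i.
  under [fun t : R => _]eq_fun do rewrite mxE.
  by rewrite mxE; exact: ((is_derive_coordP _ _ _).1 (dPhi s) (rshift n i)).
- move=> s y y'; rewrite /u -linearB; apply: le_trans (norm_lsubmx_le _) _.
  apply: le_trans (frozen_field_lip _ _ _) _.
  by rewrite row_mxB subrr norm_row_mx0 ler_wpM2r.
- move=> y s; apply: (continuous_comp (f := fun s => frozen_field s (row_mx y (P s)))).
    exact: (field_continuous ir0 frozen_field_lip frozen_field_cont (cP y)).
  exact: continuous_lsubmx.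
- by move=> s y; apply: le_trans (norm_lsubmx_le _) _; exact: le_trans C_M.
- move=> s sab; rewrite normrN; apply: le_trans (norm_rsubmx_le _) _.
  exact: le_trans C_M.
- move=> s y sab hy; have [P0 ->] := uE s y sab hy.
  by have [] := hamiltonian_grad_in F_nonempty_compact (ham_differentiable y P0).1.
- move=> s y v sab hy Fv; have [P0 uEs] := uE s y sab hy.
  set p := P s in P0 uEs *; set U := u s y in uEs *.
  have HU : H y p = dotv U p.
    by rewrite uEs; have [] := hamiltonian_grad_in F_nonempty_compact (ham_differentiable y P0).1.
  pose e := v - U.
  have UM : `|U| <= M by apply: le_trans (norm_lsubmx_le _) _.
  have yB : `|y| <= B + r.
    have := inside s y sab hy; have := hB s sab.
    have := norm_lsubmx_le (row_mx y p); rewrite row_mxKl.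
    have := ler_normD (row_mx y p - Zb s) (Zb s); rewrite subrK; lra.
  have eV : `|e| <= V1.
    apply: le_trans (ler_normB _ _) _; apply: lerD => //.
    by apply: le_trans (F_growth Fv) _; rewrite ler_pM2l // lerD2l.
  have te : tau * `|e| <= r / 8.
    apply: (@le_trans _ _ (r / (8 * V1) * V1)).
      by apply: ler_pM => //; [exact: ltW|rewrite /tau ge_min lexx orbT].
    by have -> : r / (8 * V1) * V1 = r / 8; [field; rewrite gt_eqF|].
  have seg (th : R) : 0 <= th <= 1 -> `|p + th *: (tau *: e) - p| <= tau * `|e|.
    move=> /andP[th0 th1].
    have -> : p + th *: (tau *: e) - p = th *: (tau *: e) by rewrite addrC addKr.
    by rewrite !normrZ ger0_norm // gtr0_norm // ler_piMl // mulr_ge0 // ltW.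
  have segr (th : R) th01 := le_trans (seg th th01) te.
  have [|th th01 mv] := @mvt_grad R n (H y) p (tau *: e).
    move=> th th01; have i1 := insideP s y _ sab hy (segr th th01).
    have [||p0 _ _] := @partial_grads_lip s y y _ _ 0 sab i1 i1 _ _.
    - by rewrite subrr normr0.
    - by rewrite subrr normr0.
    - exact: (ham_differentiable y p0).1.
  have hge : dotv v (p + tau *: e) <= H y (p + tau *: e).
    exact: hamiltonian_ge.
  have gradd : `|grad (H y) (p + th *: (tau *: e)) - U| <= r^-1 * (tau * `|e|).
    rewrite uEs.
    have [|_ h _] := partial_grads_lip sab (insideP s y p sab hy (PP s))
      (insideP s y _ sab hy (segr th th01)) _ (seg th th01); last exact: h.
    by rewrite subrr normr0 mulr_ge0 // ltW.
  have hd : dotv (grad (H y) (p + th *: (tau *: e)) - U) (tau *: e) <=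
      N * tau ^+ 2 * dotv e e.
    apply: le_trans (ler_norm _) _; apply: le_trans (dotv_abs_le _ _) _.
    rewrite normrZ gtr0_norm //.
    apply: (@le_trans _ _ (n%:R * (r^-1 * (tau * `|e|)) * (tau * `|e|))).
      by rewrite ler_wpM2r ?mulr_ge0 ?(ltW tau0) // ler_wpM2l.
    have -> : n%:R * (r^-1 * (tau * `|e|)) * (tau * `|e|) =
      n%:R / r * tau ^+ 2 * `|e| ^+ 2 by ring.
    apply: ler_pM => //.
    - by rewrite !mulr_ge0 ?exprn_ge0 ?(ltW ir0) // ltW.
    - by rewrite ler_wpM2r ?exprn_ge0 ?(ltW tau0) // /N lerDl.
    - exact: norm_sqr_le.
  set Q := dotv e e in hd.
  have Q0 : 0 <= Q by exact: dotv_ge0.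
  have eE : dotv (U - v) (U - v) = Q.
    by rewrite /Q /e -[U - v]opprB dotvNl dotvNr opprK.
  have gE : dotv p (U - v) = - dotv e p by rewrite dotvC -[U - v]opprB dotvNl.
  set g := dotv p (U - v) in gE *; rewrite eE.
  have tQ : tau * Q <= g + N * tau ^+ 2 * Q.
    move: hge mv hd; rewrite -/p HU dotvDr !dotvBl !dotvZr.
    have -> : dotv v p = - g + dotv U p by rewrite gE /e dotvBl; ring.
    have -> : dotv v e = Q + dotv U e by rewrite /Q -dotvDl /e subrK.
    lra.
  have Nt : N * tau <= 2^-1.
    have : tau <= (2 * N)^-1 by rewrite /tau ge_min lexx.
    move=> /(ler_wpM2l (ltW N0)); have -> : N * (2 * N)^-1 = 2^-1 by field; rewrite gt_eqF.
    by [].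
  have g0 : tau / 2 * Q <= g.
    have : N * tau * (tau * Q) <= 2^-1 * (tau * Q).
      by rewrite ler_wpM2r // mulr_ge0 // ltW.
    have -> : N * tau * (tau * Q) = N * tau ^+ 2 * Q by ring.
    lra.
  have gg : 0 <= g by apply: le_trans g0; rewrite mulr_ge0 // divr_ge0 // ltW.
  apply: (@le_trans _ _ (2 / tau * g)); last by rewrite ler_wpM2r.
  have -> : Q = 2 / tau * (tau / 2 * Q) by field; rewrite gt_eqF.
  by rewrite ler_wpM2l // divr_ge0 // ltW.
- move=> s y sab hy; have [P0 uy] := uE s y sab hy.
  have [_ uX] := uE s (X s) sab (XX s sab).
  set p := P s in P0 uy uX *.
  have Hy : dotv p (u s y) = H y p.
    by rewrite uy dotvC; exact/esym/(hamiltonian_grad_in F_nonempty_compact (ham_differentiable y P0).1).2.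
  have HX : dotv p (u s (X s)) = H (X s) p.
    by rewrite uX dotvC; exact/esym/(hamiltonian_grad_in F_nonempty_compact (ham_differentiable (X s) P0).1).2.
  have qE : - rsubmx (frozen_field s (Phi s)) = grad (H^~ p) (X s).
    have [_] := insideH s (X s) sab (XX s sab); rewrite PhiE => ->.
    by rewrite -PhiE ham_fieldE row_mxKr opprK.
  have uu : dotv p (u s y - u s (X s)) = H y p - H (X s) p.
    by rewrite dotvBr; congr (_ - _).
  change (`|dotv p (u s y - u s (X s)) -
    dotv (- rsubmx (frozen_field s (Phi s))) (y - X s)| <= C * `|y - X s| ^+ 2).
  rewrite uu qE.
  have seg (th : R) : 0 <= th <= 1 -> `|X s + th *: (y - X s) - X s| <= `|y - X s|.
    move=> /andP[th0 th1].
    have -> : X s + th *: (y - X s) - X s = th *: (y - X s) by rewrite addrC addKr.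
    by rewrite normrZ ger0_norm // ler_piMl.
  have [|th th01] := @mvt_grad R n (H^~ p) (X s) (y - X s).
    by move=> th th01; exact: (ham_differentiable _ P0).2.
  have -> : X s + (y - X s) = y by rewrite addrC subrK.
  move=> ->; rewrite -dotvBl.
  apply: le_trans (dotv_abs_le _ _) _.
  apply: (@le_trans _ _ (n%:R * (r^-1 * `|y - X s|) * `|y - X s|)); last first.
    have -> : n%:R * (r^-1 * `|y - X s|) * `|y - X s| = n%:R / r * `|y - X s| ^+ 2 by ring.
    rewrite ler_wpM2r ?exprn_ge0 //; apply: le_trans C_N; by rewrite /N lerDl.
  rewrite ler_wpM2r // ler_wpM2l //.
  have i1 := insideP s (X s) p sab (XX s sab) (PP s).
  have i2 := insideP s _ p sab (le_trans (seg th th01) hy) (PP s).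
  have [|_ _ h] := partial_grads_lip sab i1 i2 (seg th th01) _; last exact: h.
  by rewrite subrr normr0.
- move=> s sab; apply: le_trans (norm_rsubmx_le _) _; apply: le_trans C_B.
  have := ler_normD (Phi s - Zb s) (Zb s); rewrite subrK.
  have := hPhi s sab; have := hB s sab; lra.
Qed.

End flow.

(** * Regularity of dual arcs *)
Section dual_arcs.
Variables (R : realType) (n : nat) (F : 'rV[R]_n -> set 'rV[R]_n).
Hypothesis hSH : SH F.
Let H := hamiltonian F.

Lemma SH_compact x : F x !=set0 /\ compact (F x).
Proof. by have [h _ _] := hSH; have [] := h x. Qed.

Lemma SH_growth : exists2 Gam : R, 0 < Gam & forall x v, F x v -> `|v| <= Gam * (1 + `|x|).
Proof.
have [_ _ [g g0 hg]] := hSH; exists (g * n.+1%:R); first by rewrite mulr_gt0.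
move=> x v Fv; apply: le_trans (norm_le_enorm _) _; apply: le_trans (hg x v Fv) _.
rewrite -mulrA ler_pM2l // mulrDr mulr1; apply: lerD; first by rewrite ler1n.
by apply: le_trans (enorm_le _) _; rewrite ler_wpM2r // ler_nat.
Qed.

(** The Hausdorff Lipschitz bound on [F] passes to its support function, with a
    factor [|p|]. *)
Lemma ham_locally_lipschitz (a b : R) (xb : R -> 'rV[R]_n) : lip a b xb ->
  exists2 rho, 0 < rho & forall t, a <= t <= b -> forall z y p : 'rV[R]_n,
    `|z - xb t| < rho -> `|y - xb t| < rho -> H z p - H y p <= rho^-1 * `|z - y| * `|p|.
Proof.
move=> lx; apply: (@compact_uniform R a b (fun t rho => forall z y p : 'rV[R]_n,
    `|z - xb t| < rho -> `|y - xb t| < rho -> H z p - H y p <= rho^-1 * `|z - y| * `|p|)).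
  move=> t rho rho' h r0 rr z y p hz hy.
  apply: le_trans (h z y p (lt_le_trans hz rr) (lt_le_trans hy rr)) _.
  by rewrite -!mulrA ler_wpM2r ?mulr_ge0 // lef_pV2 // posrE // (lt_le_trans r0).
move=> s sab; have [_ loc _] := hSH; have [K xK [c c0 hc]] := loc (xb s).
have /nbhs_ballP[r /= r0 hr] := xK.
have [L L0 hL] := lip_pos lx.
exists (r / (2 * L)); first by rewrite divr_gt0 // mulr_gt0.
pose C := c * n%:R * n%:R + 1.
have C0 : 0 < C by rewrite ltr_wpDl // !mulr_ge0 // ltW.
exists (Num.min (r / 2) C^-1); first by rewrite lt_min divr_gt0 // invr_gt0.
move=> t tab ts z y p; rewrite !lt_min => /andP[hz _] /andP[hy _].
have inK w : `|w - xb t| < r / 2 -> K w.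
  move=> hw; apply: hr; rewrite -ball_normE /ball_ /= distrC.
  have := hL t s tab sab.
  have : L * `|t - s| < r / 2.
    move: ts; rewrite ltr_pdivlMr ?mulr_gt0 //; lra.
  have := ler_normD (w - xb t) (xb t - xb s); rewrite subrKA; lra.
have [v [Fv Hv _]] := hamiltonian_max SH_compact z p.
have [w Fw [e eb ve]] := hc z y (inK z hz) (inK y hy) v Fv.
have {Hv}-> : H z p = dotv v p by exact: Hv.
rewrite -ve dotvDl dotvZl.
have h1 : dotv w p <= H y p by apply: hamiltonian_ge => //; exact: SH_compact.
have e1 : `|e| <= 1.
  by apply: le_trans (norm_le_enorm _) _; move: eb; rewrite /eball /= subr0.
have h2 : dotv e p <= n%:R * `|p|.
  apply: le_trans (ler_norm _) _; apply: le_trans (dotv_abs_le _ _) _.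
  by rewrite ler_wpM2r // ler_piMr.
have h3 : c * enorm (z - y) * dotv e p <= c * n%:R * n%:R * `|z - y| * `|p|.
  have ce : 0 <= c * enorm (z - y) by rewrite mulr_ge0 ?enorm_ge0 // ltW.
  apply: le_trans (ler_wpM2l ce h2) _.
  have -> : c * n%:R * n%:R * `|z - y| * `|p| = c * (n%:R * `|z - y|) * (n%:R * `|p|) by ring.
  by rewrite ler_wpM2r ?mulr_ge0 // ler_wpM2l ?enorm_le // ltW.
have h4 : c * n%:R * n%:R * `|z - y| * `|p| <= (Num.min (r / 2) C^-1)^-1 * `|z - y| * `|p|.
  rewrite -![_ * `|z - y| * `|p|]mulrA ler_wpM2r ?mulr_ge0 //.
  apply: (@le_trans _ _ C); first by rewrite /C lerDl.
  rewrite -[leLHS]invrK lef_pV2 ?posrE ?invr_gt0 ?lt_min ?divr_gt0 //= ?invr_gt0 //.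
  by rewrite ge_min lexx orbT.
lra.
Qed.

Lemma subgradient_bound (x p q : 'rV[R]_n) (rho : R) : 0 < rho ->
  (forall z y p : 'rV[R]_n, `|z - x| < rho -> `|y - x| < rho ->
     H z p - H y p <= rho^-1 * `|z - y| * `|p|) ->
  lower_grad (H^~ p) x q -> `|q| <= rho^-1 * `|p|.
Proof.
move=> rho0 hH hq; apply: norm_coordP; first by rewrite mulr_ge0 // invr_ge0 ltW.
move=> i; apply/ler_addgt0Pr => e e0.
have [r r0 hr] := hq e e0.
pose t := Num.min rho r / 2.
have m0 : 0 < Num.min rho r by rewrite lt_min rho0.
have t0 : 0 < t by rewrite divr_gt0.
have tm : t < Num.min rho r by rewrite ltr_pdivrMr // ltr_pMr // ltr1n.
clearbody t.
have [trho tr] : t < rho /\ t < r by move: tm; rewrite lt_min => /andP[].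
have H1 (sg : R) : `|sg| = 1 -> sg * q 0 i <= rho^-1 * `|p| + e.
  move=> sg1; pose h : 'rV[R]_n := (t * sg) *: delta_mx 0 i.
  have nh : `|h| <= t.
    apply: norm_coordP; first exact: ltW.
    move=> j; rewrite !mxE normrM normrM sg1 mulr1 gtr0_norm //.
    by case: (_ && _); rewrite ?normr1 ?normr0 ?mulr1 ?mulr0 // ltW.
  have := hr h (le_lt_trans nh tr); rewrite dotvZr dotv_delta.
  have xh : x + h - x = h by rewrite addrC addKr.
  have := hH (x + h) x p; rewrite subrr normr0 xh.
  move=> /(_ (le_lt_trans nh trho) rho0) h1 h2.
  have k1 : e * `|h| <= e * t by rewrite ler_pM2l.
  have k2 : rho^-1 * `|h| * `|p| <= rho^-1 * t * `|p|.
    by rewrite ler_wpM2r // ler_wpM2l // invr_ge0 ltW.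
  have : t * (sg * q 0 i) <= t * (rho^-1 * `|p| + e).
    have -> : t * (rho^-1 * `|p| + e) = rho^-1 * t * `|p| + e * t by ring.
    lra.
  by rewrite ler_pM2l.
rewrite ler_norml; have := H1 1; rewrite normr1 => /(_ erefl).
have := H1 (-1); rewrite normrN1 => /(_ erefl) ? ?.
by apply/andP; split; lra.
Qed.

Hypothesis H_C2 : C2_on [set xp : 'rV[R]_n * 'rV[R]_n | xp.2 != 0]
  (fun xp => H xp.1 xp.2).

(** The inequality [|pb'| <= c |pb|] makes [pb] Lipschitz and, by Gronwall from a
    zero up to time [T], nowhere zero.  So [H] is differentiable along the arc and its
    subdifferentials reduce to gradients. *)
Lemma dual_arc_regular (phi : 'rV[R]_n -> R) (t0 T : R) (x0 : 'rV[R]_n)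
    (xb pb : R -> 'rV[R]_n) : t0 <= T ->
  trajectory T F t0 x0 xb -> dual_arc T F phi t0 xb pb -> pb T != 0 ->
  let Zb s := row_mx (xb s) (pb s) in
  [/\ lip t0 T Zb, forall s, t0 <= s <= T -> ham_dom (Zb s) &
      ae_on t0 T (fun s => is_derive s 1 Zb (ham_field H (Zb s)))].
Proof.
move=> t0T hx [acp hp _] pT Zb.
have [Gam Gam0 growth] := SH_growth.
have [lx _] := trajectory_traj Gam0 growth t0T hx.
have [rho rho0 hrho] := ham_locally_lipschitz lx.
have pbd : ae_on t0 T (fun s => exists2 dp : 'rV[R]_n, is_derive s 1 pb dp &
    `|dp| <= rho^-1 * `|pb s|).
  apply: ae_on_imp hp => s sab [_ dp _ hsub]; exists (derive1 pb s).
    by rewrite derive1E; exact: derivableP.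
  rewrite -normrN; apply: (@subgradient_bound (xb s)) => //.
    exact: hrho.
  exact: subdiff_lower_grad.
have [M M0 hM] := abs_continuous_bounded t0T acp.
have lp : lip t0 T pb.
  apply: lip_vec => i; exists (rho^-1 * M).
  apply: abs_continuous_lip; first exact: abs_continuous_coord.
  apply: ae_on_imp pbd => s sab [dp h1 h2]; exists (dp 0 i).
    by move/is_derive_coordP : h1.
  apply: le_trans (norm_coord_le _ _) _; apply: le_trans h2 _.
  by rewrite ler_pM2l ?invr_gt0 // hM.
have pn0 s : t0 <= s <= T -> pb s != 0.
  move=> /andP[t0s sT]; apply: contraNneq pT => ps0.
  have ir0 : 0 < rho^-1 by rewrite invr_gt0.
  have := @gronwall_lip R n s T rho^-1 0 pb ir0 (lexx _) (lip_sub t0s (lexx _) lp) _ T.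
  rewrite ps0 normr0 mulr0 mul0r addr0 mul0r sT lexx => h.
  rewrite -normr_le0; apply: h => //.
  apply: ae_on_imp (ae_on_sub t0s (lexx _) pbd) => t _ [dp h1 h2]; exists dp.
    by move=> i; move/is_derive_coordP : h1.
  by rewrite addr0.
split.
- apply: lip_vec => i; case: (split_ordP i) => j ->.
    by under [fun s => _]eq_fun do rewrite row_mxEl; exact: lip_coord.
  by under [fun s => _]eq_fun do rewrite row_mxEr; exact: lip_coord.
- by move=> s sab; rewrite /ham_dom /= row_mxKr; exact: pn0.
- apply: ae_on_imp hp => s sab [dx dp hsx hsp].
  have [dHp dHx] := ham_differentiable H_C2 (xb s) (pn0 s sab).
  have gp : derive1 xb s = grad (H (xb s)) (pb s).
    apply: (@lower_upper_eq _ _ (H (xb s)) (pb s) _ _ (subdiff_lower_grad hsx)).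
    exact: has_grad_upper ((has_gradP _ _ _).2 (conj dHp erefl)).
  have gx : - derive1 pb s = grad (H^~ (pb s)) (xb s).
    apply: (@lower_upper_eq _ _ (H^~ (pb s)) (xb s) _ _ (subdiff_lower_grad hsp)).
    exact: has_grad_upper ((has_gradP _ _ _).2 (conj dHx erefl)).
  have gx' := canRL (@opprK _) gx.
  have dx0 : is_derive s 1 xb (derive1 xb s) by rewrite derive1E; exact: (derivableP dx).
  have dp0 : is_derive s 1 pb (derive1 pb s) by rewrite derive1E; exact: (derivableP dp).
  have dxs := eq_ind _ (is_derive s 1 xb) dx0 _ gp.
  have dps := eq_ind _ (is_derive s 1 pb) dp0 _ gx'.
  rewrite ham_fieldE; apply/is_derive_coordP => i; case: (split_ordP i) => j ->.
    under [fun t : R => _]eq_fun do rewrite row_mxEl.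
    by rewrite row_mxEl; move/is_derive_coordP : dxs.
  under [fun t : R => _]eq_fun do rewrite row_mxEr.
  by rewrite row_mxEr; move/is_derive_coordP : dps.
Qed.

End dual_arcs.

(** * The linearised flow *)
Section linearised_flow.
Local Opaque ham_field frozen_field.
Variables (R : realType) (n : nat) (F : 'rV[R]_n -> set 'rV[R]_n).
Let H := hamiltonian F.
Hypothesis H_C2 : C2_on [set xp : 'rV[R]_n * 'rV[R]_n | xp.2 != 0]
  (fun xp => H xp.1 xp.2).
Variables (a b : R) (Zb : R -> 'rV[R]_(n + n)).
Hypothesis ab : a <= b.
Hypothesis Zb_lip : lip a b Zb.
Hypothesis Zb_dom : forall s, a <= s <= b -> ham_dom (Zb s).
Variable r : R.
Hypothesis r0 : 0 < r.
Hypothesis field_lip : forall s, a <= s <= b -> forall Z, `|Z - Zb s| < r ->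
    ham_dom Z /\ forall Z', `|Z' - Zb s| < r ->
    `|ham_field H Z' - ham_field H Z| <= r^-1 * `|Z' - Z|.
Hypothesis Zb_field : ae_on a b (fun s => is_derive s 1 Zb (ham_field H (Zb s))).

Let ir0 : 0 < r^-1. Proof. by rewrite invr_gt0. Qed.

Lemma jacobian_bound s (h : 'rV[R]_(n + n)) : a <= s <= b ->
  `|h *m 'J (ham_field H) (Zb s)| <= r^-1 * `|h|.
Proof.
move=> sab; apply/ler_addgt0Pr => d d0.
have [->|hn0] := eqVneq h 0; first by rewrite mul0mx !normr0 mulr0 add0r ltW.
have h0 : 0 < `|h| by rewrite normr_gt0.
have d1 : 0 < d / `|h| by rewrite divr_gt0.
have [r1 r10 hr1] := ham_field_diff H_C2 (Zb_dom sab) d1.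
have m0 : 0 < Num.min r1 r by rewrite lt_min r10.
pose t := Num.min r1 r / (2 * `|h|).
have t0 : 0 < t by rewrite divr_gt0 // mulr_gt0.
have nth : `|t *: h| < Num.min r1 r.
  rewrite normrZ gtr0_norm // /t; move: (Num.min _ _) m0 => m m0.
  have -> : m / (2 * `|h|) * `|h| = m / 2 by field; rewrite gt_eqF.
  by rewrite ltr_pdivrMr //; lra.
clearbody t; move: nth; rewrite lt_min => /andP[th1 th2].
have h1 := hr1 _ th1.
have [|_ h2] := field_lip sab (Z := Zb s); first by rewrite subrr normr0.
have E : Zb s + t *: h - Zb s = t *: h by rewrite addrC addKr.
have := h2 (Zb s + t *: h); rewrite E => /(_ th2) h3.
move: h1 h3; move: (ham_field H (Zb s + t *: h) - ham_field H (Zb s)) => w h1 h3.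
have : `|t *: h *m 'J (ham_field H) (Zb s)| <= (r^-1 + d / `|h|) * `|t *: h|.
  move: h1; move: (t *: h *m _) => v h1.
  have -> : v = w - (w - v) by rewrite opprB addrC subrK.
  by apply: le_trans (ler_normB _ _) _; rewrite mulrDl lerD.
rewrite -scalemxAl !normrZ gtr0_norm // mulrCA ler_pM2l //.
by rewrite mulrDl divfK // gt_eqF.
Qed.

Lemma linear_flow_exists : exists Lam : 'rV[R]_(n + n) -> R -> 'rV[R]_(n + n),
  (forall v, Lam v a = v) /\
  forall v s, a <= s <= b -> is_derive s 1 (Lam v) (Lam v s *m 'J (ham_field H) (Zb s)).
Proof.
pose A s (v : 'rV[R]_(n + n)) := v *m 'J (ham_field H) (Zb (clamp a b s)).
have cab s : a <= clamp a b s <= b by exact: clamp_in.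
have Abd s v : `|A s v| <= r^-1 * `|v| by exact: jacobian_bound (cab s).
have AL s v w : `|A s v - A s w| <= r^-1 * `|v - w|.
  by rewrite /A -mulmxBl; exact: Abd.
have Ac v : continuous (A^~ v).
  move=> s; apply/cvgrPdist_le => e e0.
  have [d d0 hd] := ham_jac_continuous H_C2 Zb_lip Zb_dom v (cab s) e0.
  near=> t; rewrite distrC; apply: hd; first exact: cab.
  apply: le_lt_trans (clamp_lip _ _ _ _) _; rewrite distrC.
  by near: t; apply: cvgr_dist_lt.
have Ab z : exists M, forall s, `|A s z| <= M.
  by exists (r^-1 * `|z|) => s; exact: Abd.
have /choice[Lam hLam] : forall v, exists y : R -> 'rV[R]_(n + n), y a = v /\
    forall s : R, is_derive s 1 y (A s (y s)).
  move=> v; have [y ? ?] := picard ir0 AL Ac Ab a v.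
  by exists y.
exists Lam; split=> [v|v s sab]; first by have [] := hLam v.
have [_ h] := hLam v; have := h s.
by rewrite /A clamp_id.
Unshelve. all: by end_near. Qed.

Variable Lam : 'rV[R]_(n + n) -> R -> 'rV[R]_(n + n).
Hypothesis Lam_a : forall v, Lam v a = v.
Hypothesis Lam_der : forall v s, a <= s <= b ->
  is_derive s 1 (Lam v) (Lam v s *m 'J (ham_field H) (Zb s)).

Lemma linear_flow_lip v : lip a b (Lam v).
Proof.
have cL : {within `[a, b], continuous (fun s => `|Lam v s|)}.
  move=> s; apply: cvg_norm; move: s.
  apply: derivable_within_continuous => s; rewrite in_itv /= => sab.
  by case: (Lam_der v sab).
have [c _ hc] := EVT_max ab cL.
apply: (lip_of_bounded_derive (Lam_der v) (M := r^-1 * `|Lam v c|)) => s sab.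
apply: le_trans (jacobian_bound _ sab) _.
by rewrite ler_pM2l //; apply: hc; rewrite in_itv.
Qed.

Lemma linear_flow_unique (y z : R -> 'rV[R]_(n + n)) :
  lip a b y -> lip a b z ->
  (forall s, a <= s <= b -> is_derive s 1 y (y s *m 'J (ham_field H) (Zb s))) ->
  (forall s, a <= s <= b -> is_derive s 1 z (z s *m 'J (ham_field H) (Zb s))) ->
  y a = z a -> forall s, a <= s <= b -> y s = z s.
Proof.
move=> ly lz hy hz yz s sab; apply/eqP; rewrite -subr_eq0 -normr_le0.
have := @gronwall_lip R (n + n) a b r^-1 0 (fun t => y t - z t) ir0 (lexx _) (lipB ly lz) _ s sab.
rewrite yz subrr normr0 mulr0 mul0r addr0 mul0r; apply.
apply: ae_on_all => t tab.
exists (y t *m 'J (ham_field H) (Zb t) - z t *m 'J (ham_field H) (Zb t)).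
  by apply/is_derive_coordP; exact: (der_vecB (hy t tab) (hz t tab)).
by rewrite addr0 -mulmxBl; exact: jacobian_bound.
Qed.

Lemma linear_flow_linear (c : R) u v s : a <= s <= b ->
  Lam (c *: u + v) s = c *: Lam u s + Lam v s.
Proof.
have lZ : lip a b (fun s => c *: Lam u s).
  apply: lip_vec => i; under [fun s => _]eq_fun do rewrite mxE.
  by apply: lipM; [exact: lip_cst|apply: lip_coord; exact: linear_flow_lip].
apply: (@linear_flow_unique (Lam (c *: u + v)) (fun s => c *: Lam u s + Lam v s));
  first exact: linear_flow_lip.
- by apply: lipD => //; exact: linear_flow_lip.
- move=> t tab; rewrite mulmxDl -scalemxAl; apply/is_derive_coordP => i.
  have hu := (is_derive_coordP _ _ _).1 (Lam_der u tab) i.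
  have hv := (is_derive_coordP _ _ _).1 (Lam_der v tab) i.
  under [fun t : R => _]eq_fun do rewrite mxE mxE.
  by rewrite mxE mxE; exact: (derD (derZ c hu) hv).
- by rewrite !Lam_a.
Qed.

Variable Phi : 'rV[R]_(n + n) -> R -> 'rV[R]_(n + n).
Hypothesis Phi_a : forall Z, Phi Z a = Z.
Hypothesis Phi_der : forall Z (s : R), is_derive s 1 (Phi Z) (frozen_field F a b Zb r s (Phi Z s)).
Hypothesis Phi_Zb : forall s, a <= s <= b -> Phi (Zb a) s = Zb s.
Variable K : R.
Hypothesis K1 : 1 <= K.
Hypothesis Phi_lip : forall Z Z' s, a <= s <= b -> `|Phi Z s - Phi Z' s| <= K * `|Z - Z'|.

(** The remainder satisfies the linearised equation up to [o(|h|)] and vanishes at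
    [a]; apply Gronwall. *)
Lemma flow_linearised e : 0 < e -> exists2 d, 0 < d & forall h, `|h| < d ->
  forall s, a <= s <= b -> `|Phi (Zb a + h) s - Zb s - Lam h s| <= e * `|h|.
Proof.
move=> e0; have K0 : 0 < K by exact: lt_le_trans K1.
have r0' := r0.
pose E := expR (2 * r^-1 * (b - a)).
have E0 : 0 < E by exact: expR_gt0.
pose e1 := e / (K * r * E).
have e10 : 0 < e1 by rewrite divr_gt0 // !mulr_gt0.
have [d1 d10 hd1] := ham_field_diff_tube H_C2 Zb_lip Zb_dom e10.
exists (Num.min d1 (r / 2) / K); first by rewrite divr_gt0 // lt_min d10 divr_gt0.
move=> h; rewrite ltr_pdivlMr // mulrC lt_min => /andP[hd hr] s sab.
have Dl t : a <= t <= b -> `|Phi (Zb a + h) t - Zb t| <= K * `|h|.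
  move=> tab; rewrite -(Phi_Zb tab); apply: le_trans (Phi_lip _ _ tab) _.
  by have -> : Zb a + h - Zb a = h by rewrite addrC addKr.
have [M M0 hM] := frozen_field_bounded ab Zb_lip r0 field_lip.
have lPhi : lip a b (Phi (Zb a + h)).
  by apply: (lip_of_bounded_derive (fun s _ => Phi_der (Zb a + h) s) (M := M)) => t _; exact: hM.
have e1K : 0 <= e1 * (K * `|h|).
  by apply: mulr_ge0; [exact: ltW|apply: mulr_ge0 => //; exact: ltW].
have := @gronwall_lip R (n + n) a b r^-1 (e1 * (K * `|h|))
  (fun t => Phi (Zb a + h) t - Zb t - Lam h t) ir0 e1K _ _ s sab.
rewrite Phi_a Lam_a.
have -> : Zb a + h - Zb a - h = 0 by rewrite [Zb a + h]addrC addrK subrr.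
rewrite normr0 mulr0 add0r => G; apply: le_trans (G _ _) _.
- by apply: lipB; [exact: lipB|exact: linear_flow_lip].
- apply: ae_on_imp Zb_field => t tab hz.
  exists (frozen_field F a b Zb r t (Phi (Zb a + h) t) - ham_field H (Zb t) -
     Lam h t *m 'J (ham_field H) (Zb t)).
    apply/is_derive_coordP; exact: (der_vecB (der_vecB (Phi_der _ t) hz) (Lam_der h tab)).
  have hD := Dl t tab.
  have -> : frozen_field F a b Zb r t (Phi (Zb a + h) t) = ham_field H (Phi (Zb a + h) t).
    by apply: frozen_field_in => //; apply: le_trans hD (ltW hr).
  set De := Phi (Zb a + h) t - Zb t in hD *.
  have EP : Phi (Zb a + h) t = Zb t + De by rewrite /De [RHS]addrC subrK.
  have h1 := hd1 t tab De (le_lt_trans hD hd).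
  rewrite EP; move: h1.
  move: (ham_field H (Zb t + De) - ham_field H (Zb t)) => w h1.
  have h2 := jacobian_bound (De - Lam h t) tab; rewrite mulmxBl in h2.
  move: h1 h2; move: (De *m _) (Lam h t *m _) => v1 v2 h1 h2.
  have -> : w - v2 = (w - v1) + (v1 - v2) by rewrite subrKA.
  apply: le_trans (ler_normD _ _) _; rewrite addrC; apply: lerD => //.
  by apply: le_trans h1 _; rewrite ler_pM2l.
- have -> : e * `|h| = e1 * (K * `|h|) / r^-1 * E.
    by rewrite /e1 invrK; field; rewrite !gt_eqF.
  rewrite ler_wpM2l ?divr_ge0 ?(ltW ir0) // /E ler_expR.
  case/andP: sab => ? ?; rewrite ler_wpM2l ?lerD2r // mulr_ge0 // ltW //.
Qed.

(** Superposition of the solutions starting from the basis vectors. *)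
Lemma flow_matrix : exists L : R -> 'M[R]_(n + n), [/\ L a = 1%:M,
  forall s, a <= s <= b -> is_derive s 1 L (L s *m 'J (ham_field H) (Zb s)) &
  forall e, 0 < e -> exists2 d, 0 < d & forall h, `|h| < d ->
    forall s, a <= s <= b -> `|Phi (Zb a + h) s - Zb s - h *m L s| <= e * `|h|].
Proof.
pose L s : 'M[R]_(n + n) := \matrix_i Lam (delta_mx 0 i) s.
have LamE v s : a <= s <= b -> Lam v s = v *m L s.
  move=> sab; have Lam0 : Lam 0 s = 0.
    by have := linear_flow_linear (-1) 0 0 sab; rewrite scaler0 addr0 scaleN1r addNr.
  rewrite mulmx_sum_row [in LHS](row_sum_delta v).
  elim/big_rec2: _ => // i y z _ IH.
  by rewrite linear_flow_linear // IH rowK.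
exists L; split.
- by apply/row_matrixP => i; rewrite rowK Lam_a rowE mulmx1.
- move=> s sab; apply/is_derive_mxP => i j.
  have := (is_derive_coordP _ _ _).1 (Lam_der (delta_mx 0 i) sab) j.
  rewrite [Lam _ s]LamE // -mulmxA -rowE mxE; congr is_derive.
  by apply/funext => t; rewrite mxE.
- move=> e /flow_linearised[d d0 hd]; exists d => // h hh s sab.
  by rewrite -LamE //; exact: hd.
Qed.

End linearised_flow.

(** * Arcs that nearly realise the value are close to the extremal *)
Section closeness.
Variables (R : realType) (n : nat) (F : 'rV[R]_n -> set 'rV[R]_n).

Lemma tube_sub a b a' b' X P u q (rho C : R) : a <= a' -> b' <= b ->
  tube F a b X P u q rho C -> tube F a' b' X P u q rho C.
Proof.
move=> aa bb [t1 t2 t3 t4 t5 t6 t7 t8 t9 t10 t11 t12].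
have inc s : a' <= s <= b' -> a <= s <= b.
  by move=> /andP[h1 h2]; rewrite (le_trans aa h1) (le_trans h2 bb).
split => //.
- by move=> s /inc; exact: t3.
- by move=> s /inc; exact: t4.
- by move=> s /inc; exact: t8.
- by move=> s y /inc; exact: t9.
- by move=> s y v /inc; exact: t10.
- by move=> s y /inc; exact: t11.
- by move=> s /inc; exact: t12.
Qed.

Variables (a b : R) (X P : R -> 'rV[R]_n) (u : R -> 'rV[R]_n -> 'rV[R]_n).
Variables (q : R -> 'rV[R]_n) (rho C : R).
Hypothesis ab : a <= b.
Hypothesis tb : tube F a b X P u q rho C.

Lemma tube_traj : traj F a b X.
Proof.
have rho0 := tube_rho tb.
split; first exact: (tube_X_lip tb).
apply: ae_on_all => s sab; exists (u s (X s)); first exact: (tube_X tb).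
by apply: (tube_in tb) => //; rewrite subrr normr0 ltW.
Qed.

(** Let [y] nearly minimize [f] at time [a] among the arcs with the same final
    point.  From a point of [y] at time [t], steer back to time [a] along the
    feedback: the resulting competitor, continued by [y], turns near-minimality into
    the upper bound on [- dotv P (y - X)] at time [t] that [deviation_forward]
    requires. *)
Lemma forward_close (f : 'rV[R]_n -> R) (r C1 : R) : 0 < r -> 0 <= C1 ->
  (forall h, `|h| <= r -> f (X a) - dotv (P a) h - C1 * `|h| ^+ 2 <= f (X a + h)) ->
  forall eps, 0 < eps -> exists2 d, 0 < d & forall y, traj F a b y ->
    `|y a - X a| <= d ->
    (forall z, traj F a b z -> z b = y b -> `|z a - X a| <= r -> f (z a) <= f (X a) + d) ->
    forall s, a <= s <= b -> `|y s - X s| <= eps.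
Proof.
move=> r0 C10 hf eps eps0.
have [K K1 hK] := tube_feedback ab tb.
have K0 : 0 < K by exact: lt_le_trans K1.
have rho0 := tube_rho tb; have tC := tube_C tb.
pose K0' := C1 * K ^+ 2 + K.
have K0'0 : 0 <= K0' by rewrite addr_ge0 ?mulr_ge0 ?exprn_ge0 // ltW.
have [Kk Kk1 hkey] := deviation_forward ab tb K0'0.
have Kk0 : 0 < Kk by exact: lt_le_trans Kk1.
pose rho1 := Num.min (rho / K) (r / K).
have rho10 : 0 < rho1 by rewrite lt_min !divr_gt0.
have rho1rho : rho1 <= rho.
  by rewrite ge_min; apply/orP; left; rewrite ler_pdivrMr // ler_peMr // ltW.
pose sg := Num.min eps (rho1 / 2) / Kk.
have m0 : 0 < Num.min eps (rho1 / 2) by rewrite lt_min eps0 divr_gt0.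
have sg0 : 0 < sg by rewrite divr_gt0.
have Ksg : Kk * sg = Num.min eps (rho1 / 2) by rewrite /sg mulrC divfK // gt_eqF.
have Kse : Kk * sg <= eps by rewrite Ksg ge_min lexx.
have Ksr : Kk * sg < rho1.
  rewrite Ksg gt_min; apply/orP; right; rewrite ltr_pdivrMr // ltr_pMr // ltr1n //.
pose nC := n%:R * C; have nC0 : 0 <= nC.
  by rewrite mulr_ge0 // (le_trans ler01).
clearbody sg.
exists (Num.min sg (sg ^+ 2 / (1 + nC))).
  by rewrite lt_min sg0 divr_gt0 ?exprn_gt0 // ltr_pwDl.
set d := Num.min _ _.
have d1 : d <= sg by rewrite ge_min lexx.
have d2 : (1 + nC) * d <= sg ^+ 2.
  by rewrite mulrC -ler_pdivlMr ?ltr_pwDl // ge_min lexx orbT.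
clearbody d.
move=> y hy ya hz s sab; apply: le_trans Kse.
apply: (hkey rho1 d sg y) => //; last exact: le_trans d1.
  move=> t tab ht.
  have Kt : K * `|y t - X t| <= rho.
    rewrite mulrC -ler_pdivlMr //; apply: le_trans ht _; by rewrite ge_min lexx.
  have Ktr : K * `|y t - X t| <= r.
    rewrite mulrC -ler_pdivlMr //; apply: le_trans ht _; by rewrite ge_min lexx orbT.
  have [z [tz zt hzs]] := hK t (y t - X t) tab Kt.
  have zy : z t = y t by rewrite zt addrC subrK.
  have [at_ tb'] := andP tab.
  have [w [tw wl wr]] := traj_cat at_ tb' (traj_sub (lexx _) tb' tz)
    (traj_sub at_ (lexx _) hy) zy.
  have aab : a <= a <= b by rewrite lexx ab.
  have [za1 za2] := hzs a aab.
  have wa : w a = z a by rewrite wl.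
  have := hz w tw; rewrite wr // wa => /(_ erefl (le_trans za1 Ktr)) h1.
  have := hf (z a - X a) (le_trans za1 Ktr).
  have -> : X a + (z a - X a) = z a by rewrite addrC subrK.
  move=> h2.
  have h3 : C1 * `|z a - X a| ^+ 2 <= C1 * K ^+ 2 * `|y t - X t| ^+ 2.
    rewrite -mulrA -exprMn ler_wpM2l // ler_pXn2r ?nnegrE ?mulr_ge0 // ltW //.
  move: za2; rewrite ler_norml => /andP[h4 h5].
  rewrite /K0' mulrDl; lra.
have h1 : dotv (P a) (y a - X a) <= nC * d.
  apply: le_trans (ler_norm _) _; apply: le_trans (dotv_abs_le _ _) _.
  apply: ler_pM => //.
  by rewrite ler_wpM2l // (tube_Pb tb) // lexx.
by move: d2; rewrite mulrDl mul1r; lra.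
Qed.

(** In reversed time the competitors follow [y] up to time [t] and then the feedback
    up to time [b]. *)
Lemma backward_close (g : 'rV[R]_n -> R) (r C1 : R) : 0 < r -> 0 <= C1 ->
  (forall h, `|h| <= r -> g (X b + h) <= g (X b) - dotv (P b) h + C1 * `|h| ^+ 2) ->
  exists K r1, [/\ 1 <= K, 0 < r1 & forall y (c sg : R), traj F a b y ->
    0 < sg -> sg <= r1 ->
    (forall z, traj F a b z -> z a = y a -> `|z b - X b| <= r -> c <= g (z b)) ->
    g (X b) - c - sg ^+ 2 <= dotv (P b) (y b - X b) -> `|y b - X b| <= sg ->
    forall s, a <= s <= b -> `|y s - X s| <= K * sg].
Proof.
move=> r0 C10 hg.
have [K K1 hK] := tube_feedback ab tb.
have K0 : 0 < K by exact: lt_le_trans K1.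
have rho0 := tube_rho tb.
pose K0' := C1 * K ^+ 2 + K.
have K0'0 : 0 <= K0' by rewrite addr_ge0 ?mulr_ge0 ?exprn_ge0 // ltW.
have [Kk Kk1 hkey] := deviation_backward ab tb K0'0.
have Kk0 : 0 < Kk by exact: lt_le_trans Kk1.
pose rho1 := Num.min (rho / K) (r / K).
have rho10 : 0 < rho1 by rewrite lt_min !divr_gt0.
have rho1rho : rho1 <= rho.
  by rewrite ge_min; apply/orP; left; rewrite ler_pdivrMr // ler_peMr // ltW.
exists Kk, (rho1 / 2 / Kk); split => //; first by rewrite !divr_gt0.
move=> y c sg hy sg0 sgr hz hyb yb s sab.
have Ksr : Kk * sg < rho1.
  move: sgr; rewrite ler_pdivlMr // mulrC; lra.
apply: (hkey rho1 (g (X b) - c) sg y) => // t tab ht.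
have Kt : K * `|y t - X t| <= rho.
  rewrite mulrC -ler_pdivlMr //; apply: le_trans ht _; by rewrite ge_min lexx.
have Ktr : K * `|y t - X t| <= r.
  rewrite mulrC -ler_pdivlMr //; apply: le_trans ht _; by rewrite ge_min lexx orbT.
have [z [tz zt hzs]] := hK t (y t - X t) tab Kt.
have zy : y t = z t by rewrite zt addrC subrK.
have [at_ tb'] := andP tab.
have [w [tw wl wr]] := traj_cat at_ tb' (traj_sub (lexx _) tb' hy)
    (traj_sub at_ (lexx _) tz) zy.
have bab : a <= b <= b by rewrite ab lexx.
have [za1 za2] := hzs b bab.
have wb : w b = z b by rewrite wr.
have := hz w tw; rewrite wl // wb => /(_ erefl (le_trans za1 Ktr)) h1.
have := hg (z b - X b) (le_trans za1 Ktr).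
have -> : X b + (z b - X b) = z b by rewrite addrC subrK.
move=> h2.
have h3 : C1 * `|z b - X b| ^+ 2 <= C1 * K ^+ 2 * `|y t - X t| ^+ 2.
  rewrite -mulrA -exprMn ler_wpM2l // ler_pXn2r ?nnegrE ?mulr_ge0 // ltW //.
move: za2; rewrite ler_norml => /andP[h4 h5].
rewrite /K0' mulrDl; lra.
Qed.

End closeness.

(** * Quadratic one-sided bounds *)
Section quadratic_bounds.
Variables (R : realType) (n : nat).
Implicit Types (f : 'rV[R]_n -> R) (x q h : 'rV[R]_n).

Definition upper_quad f x q : Prop := exists r c, [/\ 0 < r, 0 <= c &
  forall h, `|h| <= r -> f (x + h) <= f x + dotv q h + c * `|h| ^+ 2].

Definition lower_quad f x q : Prop := exists r c, [/\ 0 < r, 0 <= c &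
  forall h, `|h| <= r -> f x + dotv q h - c * `|h| ^+ 2 <= f (x + h)].

(** Iterating the midpoint inequality [D h <= 2 * D (h / 2) + c |h|^2] for the
    first-order remainder [D] leaves a geometric series, because a supergradient
    makes [2^m * D (h / 2^m)] asymptotically nonpositive. *)
Lemma semiconcave_quadratic f x q : locally_semiconcave f -> upper_grad f x q ->
  upper_quad f x q.
Proof.
move=> fsc fq; have [U /nbhs_ballP[r0 /= r00 hr0] [_ [c0 hc0]]] := fsc x.
pose c := `|c0| * n%:R ^+ 2 / 4.
have c_ge0 : 0 <= c by rewrite divr_ge0 // mulr_ge0 // exprn_ge0.
pose D h := f (x + h) - f x - dotv q h.
have step h : `|h| < r0 -> D h <= 2 * D (2^-1 *: h) + c * `|h| ^+ 2.
  move=> hr; pose k := 2^-1 *: h.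
  have hk : h = k + k.
    by rewrite /k -scalerDl; have -> : 2^-1 + 2^-1 = 1 :> R by [field]; rewrite scale1r.
  have nk : `|k| = `|h| / 2 by rewrite normrZ gtr0_norm ?invr_gt0 // mulrC.
  have := hc0 (x + k) k; rewrite addrK (_ : x + k + k = x + h); last by rewrite -addrA -hk.
  have -> : enorm k ^+ 2 = dotv k k by exact: enorm_sqr.
  move=> H; have {}H := H _.
  have {}H : f (x + h) + f x - 2 * f (x + k) <= c0 * dotv k k.
    apply: H => s s1; apply: hr0; rewrite -ball_normE /ball_ /=.
    have -> : x - (x + k + s *: k) = - ((1 + s) *: k).
      by apply/rowP => i; rewrite !mxE; ring.
    rewrite normrN normrZ nk; apply: le_lt_trans hr.
    have : `|1 + s| <= 2 by case/andP: s1 => ? ?; rewrite ler_norml; apply/andP; split; lra.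
    have := normr_ge0 h; move: `|h| `|1 + s| => a b a0 b2.
    have -> : b * (a / 2) = (b / 2) * a by ring.
    by rewrite ler_piMl // ler_pdivrMr // mul1r.
  have h1 : c0 * dotv k k <= c * `|h| ^+ 2.
    have -> : c * `|h| ^+ 2 = `|c0| * (n%:R ^+ 2 * `|k| ^+ 2) by rewrite nk /c; field.
    apply: le_trans (ler_norm _) _; rewrite normrM ler_wpM2l //.
    rewrite ger0_norm ?dotv_ge0 // -enorm_sqr -exprMn.
    by rewrite ler_pXn2r ?nnegrE ?enorm_ge0 ?mulr_ge0 // enorm_le.
  have hq : dotv q h = 2 * dotv q k by rewrite {1}hk dotvDr; ring.
  rewrite /D -/k; rewrite hq; lra.
have iter m h : `|h| < r0 ->
    D h <= 2 ^+ m * D ((2 ^+ m)^-1 *: h) + 2 * c * `|h| ^+ 2 * (1 - (2 ^+ m)^-1).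
  elim: m h => [|m IH] h hr; first by rewrite expr0 invr1 scale1r subrr mulr0 addr0 mul1r.
  have p0 : 0 < (2 : R) ^+ m by rewrite exprn_gt0.
  have p1 : 1 <= (2 : R) ^+ m by rewrite exprn_ege1 // ler1n.
  apply: le_trans (IH h hr) _.
  have nh : `|(2 ^+ m)^-1 *: h| = (2 ^+ m)^-1 * `|h|.
    by rewrite normrZ gtr0_norm ?invr_gt0.
  have := step ((2 ^+ m)^-1 *: h); rewrite nh scalerA -invfM -exprS => st.
  have {}st := st (le_lt_trans _ hr).
  have p2 : (2 ^+ m)^-1 <= 1 :> R by rewrite invf_le1.
  have {}st := st (ler_piMl (normr_ge0 h) p2).
  rewrite -(ler_pM2l p0) in st; apply: (@le_trans _ _ (2 ^+ m *
    (2 * D ((2 ^+ m.+1)^-1 *: h) + c * ((2 ^+ m)^-1 * `|h|) ^+ 2) +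
    2 * c * `|h| ^+ 2 * (1 - (2 ^+ m)^-1))); first by rewrite lerD2r.
  rewrite exprS le_eqVlt; apply/orP; left; apply/eqP; field.
  by rewrite gt_eqF.
exists (r0 / 2), (2 * c); split; [by rewrite divr_gt0|by rewrite mulr_ge0|].
move=> h hr; suff : D h <= 2 * c * `|h| ^+ 2 by rewrite /D; lra.
have {}hr : `|h| < r0 by lra.
apply/ler_addgt0Pr => e e0.
have e1 : 0 < e / (1 + `|h|) by rewrite divr_gt0 // ltr_pwDl.
have [r1 r10 hr1] := fq _ e1.
have r12 : 0 < r1 / 2 by rewrite divr_gt0.
have [m hm] := small_geometric `|h| r12.
have p0 : 0 < (2 : R) ^+ m by rewrite exprn_gt0.
have nh : `|(2 ^+ m)^-1 *: h| = `|h| / 2 ^+ m.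
  by rewrite normrZ gtr0_norm ?invr_gt0 // mulrC.
have := hr1 ((2 ^+ m)^-1 *: h); rewrite nh => /(_ _) h1.
have {}h1 : D ((2 ^+ m)^-1 *: h) <= e / (1 + `|h|) * (`|h| / 2 ^+ m) by apply: h1; lra.
apply: le_trans (iter m h hr) _; rewrite addrC; apply: lerD.
  by rewrite ler_piMr ?mulr_ge0 ?exprn_ge0 // gerBl invr_ge0 ltW.
apply: (@le_trans _ _ (e / (1 + `|h|) * `|h|)).
  rewrite mulrC -ler_pdivlMr //; apply: le_trans h1 _.
  by rewrite mulrA.
rewrite mulrAC ler_pdivrMr ?ltr_pwDl // ler_pM2l //; lra.
Qed.

(** By the mean value theorem, since the gradient increment is at most linear at a
    point where the gradient is differentiable. *)
Lemma twice_differentiable_lower_quad f x : twice_differentiable f x ->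
  lower_quad f x (grad f x).
Proof.
move=> [/nbhs_ballP[r0 /= r00 hr0] dg].
have [r1 r10 hr1] := diff_near_eps dg ltr01.
have [C C0 hC] := mulmx_bounded ('J (grad f) x).
pose r := Num.min r0 r1 / 2.
have m0 : 0 < Num.min r0 r1 by rewrite lt_min r00.
exists r, (n%:R * (1 + C)); split; first by rewrite divr_gt0.
  by rewrite mulr_ge0 // addr_ge0 // ltW.
move=> h hr.
have hm : `|h| < Num.min r0 r1 by rewrite /r in hr; lra.
move: hm; rewrite lt_min => /andP[h0 h1].
have th (t : R) : 0 <= t <= 1 -> `|t *: h| <= `|h|.
  by move=> /andP[t0 t1]; rewrite normrZ ger0_norm // ler_piMl.
have [t t01|t t01 E] := @mvt_grad R n f x h.
  apply: hr0; rewrite -ball_normE /ball_ /= opprD addrA subrr sub0r normrN.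
  exact: le_lt_trans (th t t01) h0.
suff : `|f (x + h) - f x - dotv (grad f x) h| <= n%:R * (1 + C) * `|h| ^+ 2.
  by rewrite ler_norml => /andP[? _]; lra.
rewrite E.
rewrite -dotvBl; apply: le_trans (dotv_abs_le _ _) _.
rewrite expr2 -!mulrA ler_wpM2l // mulrA ler_wpM2r //.
have h2 := hr1 _ (le_lt_trans (th t t01) h1).
have h3 := hC (t *: h); have h4 := th t t01.
have h5 : C * `|t *: h| <= C * `|h| by rewrite ler_pM2l.
have := ler_normD (grad f (x + t *: h) - grad f x - t *: h *m 'J (grad f) x)
  (t *: h *m 'J (grad f) x); rewrite subrK => h6.
apply: le_trans h6 _; rewrite mulrDl; apply: lerD; last exact: le_trans h3 h5.
by apply: le_trans h2 _; rewrite !mul1r.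
Qed.

Lemma lower_quad_grad f x q : lower_quad f x q -> lower_grad f x q.
Proof.
move=> [r [c [r0 c0 hf]]] e e0; exists (Num.min r (e / (1 + c))).
  by rewrite lt_min r0 divr_gt0 // ltr_pwDl.
move=> h; rewrite lt_min => /andP[h1 h2]; have := hf h (ltW h1).
suff : c * `|h| ^+ 2 <= e * `|h| by lra.
rewrite expr2 mulrA ler_wpM2r //; move: h2; rewrite ltr_pdivlMr ?ltr_pwDl // => h2.
by have := normr_ge0 h; lra.
Qed.

Lemma upper_quad_grad f x q : upper_quad f x q -> upper_grad f x q.
Proof.
move=> [r [c [r0 c0 hf]]] e e0; exists (Num.min r (e / (1 + c))).
  by rewrite lt_min r0 divr_gt0 // ltr_pwDl.
move=> h; rewrite lt_min => /andP[h1 h2]; have := hf h (ltW h1).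
suff : c * `|h| ^+ 2 <= e * `|h| by lra.
rewrite expr2 mulrA ler_wpM2r //; move: h2; rewrite ltr_pdivlMr ?ltr_pwDl // => h2.
by have := normr_ge0 h; lra.
Qed.

Lemma dotv_sqr_continuous x1 : continuous (fun x => dotv (x - x1) (x - x1)).
Proof.
have cc i : continuous (fun x : 'rV[R]_n => (x - x1) 0 i).
  have -> : (fun x : 'rV[R]_n => (x - x1) 0 i) = (fun x => x 0 i - x1 0 i).
    by apply/funext => x; rewrite !mxE.
  move=> x; apply: continuousB; last exact: cst_continuous.
  exact: coord_continuous.
apply: continuous_big => [|i _ x]; first exact: add_continuous.
exact: (continuousM (cc i x) (cc i x)).
Qed.

Lemma sqr_dist_continuous (k : R) :
  continuous (fun w : 'rV[R]_n * 'rV[R]_n => k * dotv (w.1 - w.2) (w.1 - w.2)).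
Proof.
have cQ : continuous (fun x : 'rV[R]_n => k * dotv x x).
  have -> : (fun x : 'rV[R]_n => k * dotv x x) = (fun x => k * dotv (x - 0) (x - 0)).
    by apply/funext => x; rewrite subr0.
  move=> x; have h1 : {for x, continuous (cst k : 'rV[R]_n -> R)} by exact: cst_continuous.
  exact: (continuousM h1 (@dotv_sqr_continuous 0 x)).
move=> w; apply: (@continuous_comp _ _ _ (fun w : 'rV[R]_n * 'rV[R]_n => w.1 - w.2)
    (fun x => k * dotv x x)); last exact: cQ.
exact: sub_continuous.
Qed.

(** Minimize the sum of [f] and a steep quadratic centred at [x1]. *)
Lemma quadratic_minorant_dense f x1 e : 0 < e ->
  (forall x, `|x - x1| <= e -> differentiable f x) ->
  exists2 x, `|x - x1| <= e / 2 & lower_quad f x (grad f x).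
Proof.
move=> e0 df; pose A := [set x : 'rV[R]_n | `|x - x1| <= e].
have cA : compact A by exact: norm_ball_compact.
have Ax1 : A x1 by rewrite /A /= subrr normr0 ltW.
have A0 : A !=set0 by exists x1.
have cf : {within A, continuous f}.
  apply: continuous_in_subspaceT => x; rewrite inE => Ax.
  exact/differentiable_continuous/df.
have [xm _ hm] := EVT_min_rV A0 cA cf.
have {}hm x : A x -> f xm <= f x by move=> Ax; apply: hm; rewrite inE.
have df1 : 0 <= f x1 - f xm by rewrite subr_ge0 hm.
pose k := 1 + 4 * (f x1 - f xm) / e ^+ 2.
have e2 : 0 < e ^+ 2 by rewrite exprn_gt0.
have k1 : 1 <= k by rewrite lerDl divr_ge0 // ?mulr_ge0 // ltW.
have k0 : 0 < k by exact: lt_le_trans k1.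
have ke : 4 * (f x1 - f xm) <= k * e ^+ 2.
  have -> : k * e ^+ 2 = e ^+ 2 + 4 * (f x1 - f xm) by rewrite /k; field; rewrite gt_eqF.
  by rewrite lerDr ltW.
clearbody k.
pose g x := f x + k * dotv (x - x1) (x - x1).
have cg : {within A, continuous g}.
  apply: continuous_in_subspaceT => x; rewrite inE => Ax.
  apply: (@continuousD _ _ _ f); first exact/differentiable_continuous/df.
  apply: (@continuousM _ _ (cst k)); first exact: cst_continuous.
  exact: dotv_sqr_continuous.
have [x xA hx] := EVT_min_rV A0 cA cg; rewrite inE in xA.
have {}hx y : A y -> g x <= g y by move=> Ay; apply: hx; rewrite inE.
have gx : `|x - x1| <= e / 2.
  have := hx _ Ax1; rewrite /g subrr dotv0r mulr0 addr0 => h1.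
  have h2 := hm x xA.
  have h3 : k * `|x - x1| ^+ 2 <= k * dotv (x - x1) (x - x1).
    by rewrite ler_pM2l // norm_sqr_le.
  rewrite -(@ler_pXn2r R 2) ?nnegrE ?divr_ge0 ?(ltW e0) // -(ler_pM2l k0).
  have -> : k * (e / 2) ^+ 2 = k * e ^+ 2 / 4 by field.
  lra.
have touch h : `|h| <= e / 2 ->
    f x - 2 * k * dotv (x - x1) h - k * n%:R * `|h| ^+ 2 <= f (x + h).
  move=> hh; have Ah : A (x + h).
    rewrite /A /= addrAC; apply: le_trans (ler_normD _ _) _; lra.
  have := hx _ Ah; rewrite /g addrAC; move: (x - x1) => w.
  rewrite !(dotvDl, dotvDr) (dotvC h).
  have : k * dotv h h <= k * n%:R * `|h| ^+ 2.
    by rewrite -mulrA ler_pM2l // dotv_sqr_le.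
  lra.
have kn0 : 0 <= k * n%:R by rewrite mulr_ge0 // ltW.
have gE : grad f x = - (2 * k) *: (x - x1).
  have e20 : 0 < e / 2 by rewrite divr_gt0.
  apply/esym/(@lower_upper_eq R n f x).
    apply: lower_quad_grad; exists (e / 2), (k * n%:R); split => // h /touch.
    by rewrite dotvZl mulNr.
  by apply: has_grad_upper; apply/has_gradP; split => //; exact: df.
exists x => //; exists (e / 2), (k * n%:R); split => //; first by rewrite divr_gt0.
move=> h /touch.
by rewrite gE dotvZl mulNr.
Qed.

End quadratic_bounds.

(** * Propagation of the value along an extremal *)
Section propagation.
Variables (R : realType) (n : nat) (F : 'rV[R]_n -> set 'rV[R]_n).

Section transfer.
Variables (a b : R) (X P : R -> 'rV[R]_n) (u : R -> 'rV[R]_n -> 'rV[R]_n).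
Variables (q : R -> 'rV[R]_n) (rho C : R).
Hypothesis ab : a <= b.
Hypothesis tb : tube F a b X P u q rho C.
Variables (f g : 'rV[R]_n -> R) (r : R).
Hypothesis r0 : 0 < r.
Hypothesis fg : forall y, traj F a b y -> `|y b - X b| <= r -> f (y a) <= g (y b).
Hypothesis fgX : f (X a) = g (X b).

(** The feedback carries a perturbation of one end to the other end and preserves
    its pairing with the costate to second order.  Hence one-sided expansions of
    [f] and [g], of first or second order, propagate along the tube. *)
Lemma tube_transfer : exists K r1, [/\ 1 <= K, 0 < r1,
  forall h, `|h| <= r1 -> exists k, [/\ `|k| <= K * `|h|,
    `|dotv (P b) k - dotv (P a) h| <= K * `|h| ^+ 2 & f (X a + h) <= g (X b + k)] &
  forall k, `|k| <= r1 -> exists h, [/\ `|h| <= K * `|k|,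
    `|dotv (P b) k - dotv (P a) h| <= K * `|k| ^+ 2 & f (X a + h) <= g (X b + k)]].
Proof.
have [K K1 hK] := tube_feedback ab tb.
have K0 : 0 < K by exact: lt_le_trans K1.
have rho0 := tube_rho tb; have r0' := r0.
have aab : a <= a <= b by rewrite lexx ab.
have bab : a <= b <= b by rewrite ab lexx.
have m0 : 0 < Num.min rho r by rewrite lt_min rho0.
exists K, (Num.min rho r / K); split; [by []|by rewrite divr_gt0| |].
  move=> h; rewrite ler_pdivlMr // mulrC le_min => /andP[h1 h2].
  have [y [ty ya hy]] := hK a h aab h1.
  have [y1 y2] := hy b bab; exists (y b - X b); split => //.
  rewrite -ya; have -> : X b + (y b - X b) = y b by rewrite addrC subrK.
  by apply: fg => //; exact: le_trans h2.
move=> k; rewrite ler_pdivlMr // mulrC le_min => /andP[h1 h2].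
have [y [ty yb hy]] := hK b k bab h1.
have [y1 y2] := hy a aab; exists (y a - X a); split => //.
  by rewrite distrC.
have -> : X a + (y a - X a) = y a by rewrite addrC subrK.
rewrite -yb; apply: fg => //; rewrite yb addrC addKr.
by apply: le_trans h2; rewrite ler_peMl.
Qed.

Lemma upper_grad_backward : upper_grad g (X b) (- P b) -> upper_grad f (X a) (- P a).
Proof.
have [K [r1 [K1 r10 hK _]]] := tube_transfer; move=> hg e e0.
have K0 : 0 < K by exact: lt_le_trans K1.
have e1 : 0 < e / (2 * K) by rewrite divr_gt0 // mulr_gt0.
have [r2 r20 hr2] := hg _ e1.
exists (Num.min r1 (Num.min r2 (e / 2) / K)).
  by rewrite lt_min r10 divr_gt0 // lt_min r20 divr_gt0.
move=> h; rewrite lt_min ltr_pdivlMr // [_ * K]mulrC lt_min => /andP[h1 /andP[h2 h3]].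
have [k [k1 k2 k3]] := hK h (ltW h1).
have := hr2 k (le_lt_trans k1 h2); rewrite !dotvNl fgX => h4.
have h5 : e / (2 * K) * `|k| <= e / 2 * `|h|.
  have -> : e / 2 * `|h| = e / (2 * K) * (K * `|h|) by field; rewrite gt_eqF.
  by rewrite ler_pM2l.
have h6 : K * `|h| ^+ 2 <= e / 2 * `|h|.
  by rewrite expr2 mulrA ler_wpM2r // ltW.
move: k2; rewrite ler_norml => /andP[? ?]; lra.
Qed.

Lemma lower_grad_forward : lower_grad f (X a) (- P a) -> lower_grad g (X b) (- P b).
Proof.
have [K [r1 [K1 r10 _ hK]]] := tube_transfer; move=> hg e e0.
have K0 : 0 < K by exact: lt_le_trans K1.
have e1 : 0 < e / (2 * K) by rewrite divr_gt0 // mulr_gt0.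
have [r2 r20 hr2] := hg _ e1.
exists (Num.min r1 (Num.min r2 (e / 2) / K)).
  by rewrite lt_min r10 divr_gt0 // lt_min r20 divr_gt0.
move=> h; rewrite lt_min ltr_pdivlMr // [_ * K]mulrC lt_min => /andP[h1 /andP[h2 h3]].
have [k [k1 k2 k3]] := hK h (ltW h1).
have := hr2 k (le_lt_trans k1 h2); rewrite !dotvNl -fgX => h4.
have h5 : e / (2 * K) * `|k| <= e / 2 * `|h|.
  have -> : e / 2 * `|h| = e / (2 * K) * (K * `|h|) by field; rewrite gt_eqF.
  by rewrite ler_pM2l.
have h6 : K * `|h| ^+ 2 <= e / 2 * `|h|.
  by rewrite expr2 mulrA ler_wpM2r // ltW.
move: k2; rewrite ler_norml => /andP[? ?]; lra.
Qed.

Lemma upper_quad_backward : upper_quad g (X b) (- P b) -> upper_quad f (X a) (- P a).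
Proof.
have [K [r1 [K1 r10 hK _]]] := tube_transfer; move=> [r2 [c [r20 c0 hg]]].
have K0 : 0 < K by exact: lt_le_trans K1.
exists (Num.min r1 (r2 / K)), (c * K ^+ 2 + K); split.
- by rewrite lt_min r10 divr_gt0.
- by rewrite addr_ge0 ?mulr_ge0 ?exprn_ge0 // ltW.
move=> h; rewrite le_min ler_pdivlMr // [_ * K]mulrC => /andP[h1 h2].
have [k [k1 k2 k3]] := hK h h1.
have := hg k (le_trans k1 h2); rewrite !dotvNl -fgX => h4.
have h5 : c * `|k| ^+ 2 <= c * K ^+ 2 * `|h| ^+ 2.
  by rewrite -mulrA -exprMn ler_wpM2l // ler_pXn2r ?nnegrE ?mulr_ge0 // ltW.
move: k2; rewrite ler_norml mulrDl => /andP[? ?]; lra.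
Qed.

Lemma lower_quad_forward : lower_quad f (X a) (- P a) -> lower_quad g (X b) (- P b).
Proof.
have [K [r1 [K1 r10 _ hK]]] := tube_transfer; move=> [r2 [c [r20 c0 hg]]].
have K0 : 0 < K by exact: lt_le_trans K1.
exists (Num.min r1 (r2 / K)), (c * K ^+ 2 + K); split.
- by rewrite lt_min r10 divr_gt0.
- by rewrite addr_ge0 ?mulr_ge0 ?exprn_ge0 // ltW.
move=> h; rewrite le_min ler_pdivlMr // [_ * K]mulrC => /andP[h1 h2].
have [k [k1 k2 k3]] := hK h h1.
have := hg k (le_trans k1 h2); rewrite !dotvNl fgX => h4.
have h5 : c * `|k| ^+ 2 <= c * K ^+ 2 * `|h| ^+ 2.
  by rewrite -mulrA -exprMn ler_wpM2l // ler_pXn2r ?nnegrE ?mulr_ge0 // ltW.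
move: k2; rewrite ler_norml mulrDl => /andP[? ?]; lra.
Qed.

End transfer.

Variable Gam : R.
Hypothesis Gam0 : 0 < Gam.
Hypothesis F_growth : forall x v, F x v -> `|v| <= Gam * (1 + `|x|).
Variables (phi : 'rV[R]_n -> R) (T : R).
Hypothesis phi_lip : locally_lipschitz phi.
Let V := value T F phi.

Variables (t0 : R) (X P : R -> 'rV[R]_n) (u : R -> 'rV[R]_n -> 'rV[R]_n).
Variables (q : R -> 'rV[R]_n) (rho C : R).
Hypothesis t0T : t0 <= T.
Hypothesis tb : tube F t0 T X P u q rho C.

(** An arc that ends inside the tube is continued up to [T] by the feedback, so the
    dynamic programming inequality applies to it. *)
Lemma tube_dpp : exists2 r, 0 < r & forall t s, t0 <= t -> t <= s -> s <= T ->
  forall y, traj F t s y -> `|y s - X s| <= r -> V t (y t) <= V s (y s).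
Proof.
have [K K1 hK] := tube_feedback t0T tb.
have K0 : 0 < K by exact: lt_le_trans K1.
exists (rho / K); first by rewrite divr_gt0 // (tube_rho tb).
move=> t s t0t ts sT y hy; rewrite ler_pdivlMr // mulrC => hr.
apply: (value_dpp Gam0 F_growth phi_lip) => //.
have sab : t0 <= s <= T by rewrite (le_trans t0t ts).
have [z [tz zs _]] := hK s (y s - X s) sab hr; exists z.
  by apply: traj_sub tz => //; exact: le_trans ts.
by rewrite zs addrC subrK.
Qed.

(** Near-optimal arcs issued from a point with a quadratic minorant converge to
    the extremal issued from it, which is therefore optimal. *)
Lemma minorant_optimal : lower_quad (V t0) (X t0) (- P t0) -> phi (X T) = V t0 (X t0).
Proof.
move=> [r [c [r0 c0 hV]]]; have tX := tube_traj tb.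
apply/le_anti; rewrite (value_le Gam0 F_growth phi_lip) // andbT.
apply/ler_addgt0Pr => e e0.
have e20 : 0 < e / 2 by rewrite divr_gt0.
have cphi : {for X T, continuous phi} by exact: locally_lipschitz_continuous.
have /nbhs_ballP[d0 /= d00 hd0] : \forall y \near X T, `|phi (X T) - phi y| <= e / 2.
  by move: cphi => /(@cvgrPdist_le _ _ _ (nbhs (X T))); apply.
have d20 : 0 < d0 / 2 by rewrite divr_gt0.
have [h|d d_gt0 hd] := forward_close t0T tb r0 c0 (f := V t0) _ d20.
  by move=> /hV; rewrite dotvNl.
have m0 : 0 < Num.min d (e / 2) by rewrite lt_min d_gt0.
have exX : exists2 y, traj F t0 T y & y t0 = X t0 by exists X.
have [y [ty yx hy]] := value_near Gam0 F_growth phi t0T m0 exX.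
have hyT : `|y T - X T| <= d0 / 2.
  apply: (hd y ty); last by rewrite t0T lexx.
    by rewrite yx subrr normr0 ltW.
  move=> z tz zT _; apply: le_trans (value_le Gam0 F_growth phi_lip t0T tz) _.
  by rewrite zT; apply: le_trans hy _; rewrite lerD2l ge_min lexx.
have := hd0 (y T); rewrite -ball_normE /ball_ /= distrC => /(_ _) h1.
have {}h1 : `|phi (X T) - phi (y T)| <= e / 2 by apply: h1; lra.
have h2 : Num.min d (e / 2) <= e / 2 by rewrite ge_min lexx orbT.
move: h1; rewrite ler_norml => /andP[? ?]; rewrite -/V in hy; lra.
Qed.

Section along_optimal.
Hypothesis Xopt : phi (X T) = V t0 (X t0).

Lemma value_along s : t0 <= s <= T -> V s (X s) = V t0 (X t0).
Proof.
move=> /andP[ts sT]; have tX := tube_traj tb; apply/le_anti.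
have [r r0 hr] := tube_dpp.
apply/andP; split; last first.
  apply: hr => //; first exact: traj_sub tX.
  by rewrite subrr normr0 ltW.
by rewrite -Xopt; apply: (value_le Gam0 F_growth phi_lip) => //; exact: traj_sub tX.
Qed.

Lemma value_lower_quad s : t0 <= s <= T -> lower_quad (V t0) (X t0) (- P t0) ->
  lower_quad (V s) (X s) (- P s).
Proof.
move=> sab; have /andP[ts sT] := sab; have [r r0 hr] := tube_dpp.
apply: (lower_quad_forward ts (tube_sub (lexx _) sT tb) r0).
  by move=> y ty; exact: hr.
by rewrite value_along.
Qed.

Lemma value_upper_quad s : t0 <= s <= T -> upper_quad phi (X T) (- P T) ->
  upper_quad (V s) (X s) (- P s).
Proof.
move=> sab; have /andP[ts sT] := sab.
apply: (upper_quad_backward sT (tube_sub ts (lexx _) tb) ltr01).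
  by move=> y ty _; exact: (value_le Gam0 F_growth phi_lip).
by rewrite value_along.
Qed.

Lemma value_upper_grad s : t0 <= s <= T -> upper_grad phi (X T) (- P T) ->
  upper_grad (V s) (X s) (- P s).
Proof.
move=> sab; have /andP[ts sT] := sab.
apply: (upper_grad_backward sT (tube_sub ts (lexx _) tb) ltr01).
  by move=> y ty _; exact: (value_le Gam0 F_growth phi_lip).
by rewrite value_along.
Qed.

(** The subgradient of the value propagates forward to the final cost, where it
    meets the assumed supergradient; the cost is thus differentiable there, and
    its gradient propagates back to all times. *)
Lemma value_has_grad s : superdiff phi (X T) !=set0 ->
  lower_grad (V t0) (X t0) (- P t0) -> t0 <= s <= T -> has_grad (V s) (X s) (- P s).
Proof.
move=> [p hp] hV sab; have /andP[ts sT] := sab.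
have up := superdiff_upper_grad hp.
have lo : lower_grad phi (X T) (- P T).
  apply: (lower_grad_forward t0T tb ltr01 _ _ hV); last by rewrite Xopt.
  by move=> y ty _; exact: (value_le Gam0 F_growth phi_lip).
have E := lower_upper_eq lo up; rewrite -E in up.
apply: has_grad_lower_upper; last exact: value_upper_grad.
have [r r0 hr] := tube_dpp.
apply: (lower_grad_forward ts (tube_sub (lexx _) sT tb) r0 _ _ hV).
  by move=> y ty; exact: hr.
by rewrite value_along.
Qed.

End along_optimal.
End propagation.

(** * The field of extremals *)
Section slack.
Variable R : realFieldType.
Implicit Types (a b d e k q r s v A B D : R).

Lemma le_sqr1D (c : R) : 0 <= c -> c <= (1 + c) ^+ 2.
Proof. by move=> c0; have := mulr_ge0 c0 c0; rewrite expr2; lra. Qed.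

Lemma drop_slack v v' d e s : v - d - e <= v' -> e <= s -> v - v' - s <= d.
Proof. by lra. Qed.

Lemma slack_tau vh q vy vm v1 A B D tau : vh + q <= vy -> vm - v1 <= A ->
  vy - vm <= B -> 0 <= q -> A <= D -> B <= D -> 2 * D <= tau -> vh - tau <= v1.
Proof. by lra. Qed.

Lemma slack_quad q e v v' q' k d :
  q <= e -> v' - (q' + k * - d + q) <= v - q' -> v' <= v + - k * d + e.
Proof. by lra. Qed.

Lemma slack_quad2 q e q' k d :
  q <= e -> - q' - k * d - e <= - (q' + k * d + q).
Proof. by lra. Qed.

Lemma slack_value v v' d c s k2 b e w : v + d - b <= v' -> b <= c * e ->
  - d - w <= k2 * e -> 0 <= e -> e + k2 * e + c * e <= s -> v - v' - s <= w.
Proof. by lra. Qed.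

Lemma slack_value2 v v' v'' s w :
  v - v' - s / 2 <= w -> v' - s / 2 <= v'' -> v - v'' - s <= w.
Proof. by lra. Qed.

Lemma quarter2 r d : d <= r / 4 -> r / 4 + d <= r / 2.
Proof. by lra. Qed.

Lemma quarter4 r a b : a <= r / 2 -> b <= r / 4 -> a + b + r / 4 <= r.
Proof. by lra. Qed.

End slack.

Section field_of_extremals.
Variables (R : realType) (n : nat) (F : 'rV[R]_n -> set 'rV[R]_n).
Variable Gam : R.
Hypothesis Gam0 : 0 < Gam.
Hypothesis F_growth : forall x v, F x v -> `|v| <= Gam * (1 + `|x|).
Variables (phi : 'rV[R]_n -> R) (T : R).
Hypothesis phi_lip : locally_lipschitz phi.
Hypothesis phi_super : forall z, superdiff phi z !=set0.
Let V := value T F phi.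
Variables (t0 : R) (x0 : 'rV[R]_n).
Hypothesis t0T : t0 <= T.
Let g := grad (V t0).

(** The initial data of the extremal through [x] at time [t0]. *)
Definition initial_phase (x : 'rV[R]_n) : 'rV[R]_(n + n) := row_mx x (- g x).

Variables (Phi : 'rV[R]_(n + n) -> R -> 'rV[R]_(n + n)) (Kf : R).
Let X Z s := lsubmx (Phi Z s).
Let P Z s := rsubmx (Phi Z s).
Hypothesis Phi_a : forall Z, Phi Z t0 = Z.
Hypothesis Kf1 : 1 <= Kf.
Hypothesis Phi_lip : forall Z Z' s, t0 <= s <= T ->
  `|Phi Z s - Phi Z' s| <= Kf * `|Z - Z'|.

Variables (d0 rho C : R).
Hypothesis tubes : forall Z, `|Z - initial_phase x0| <= d0 ->
  exists u q, tube F t0 T (X Z) (P Z) u q rho C.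

Variable r0 : R.
Hypothesis r0_gt0 : 0 < r0.
Hypothesis r0d0 : r0 <= d0.
Hypothesis V_diff : forall x, `|x - x0| <= r0 -> differentiable (V t0) x.
Hypothesis g_cont : forall x, `|x - x0| <= r0 -> {for x, continuous g}.
Hypothesis g_near : forall x, `|x - x0| <= r0 -> `|g x - g x0| <= d0.

Let E x := Phi (initial_phase x).
Let Kf0 : 0 < Kf. Proof. exact: lt_le_trans Kf1. Qed.

Let Xa Z : X Z t0 = lsubmx Z. Proof. by rewrite /X Phi_a. Qed.
Let Pa Z : P Z t0 = rsubmx Z. Proof. by rewrite /P Phi_a. Qed.
Let Xc x : X (initial_phase x) t0 = x. Proof. by rewrite Xa row_mxKl. Qed.
Let Pc x : P (initial_phase x) t0 = - g x. Proof. by rewrite Pa row_mxKr. Qed.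

Lemma initial_phase_near x : `|x - x0| <= r0 -> `|initial_phase x - initial_phase x0| <= d0.
Proof.
move=> xr; rewrite row_mxB norm_row_mx_le ?(le_trans xr) //.
by rewrite -opprD normrN g_near.
Qed.

Lemma initial_phase_continuous x : `|x - x0| <= r0 -> forall e, 0 < e ->
  exists2 d, 0 < d & forall y, `|y - x| < d -> `|initial_phase y - initial_phase x| <= e.
Proof.
move=> xr e e0.
have /nbhs_ballP[d /= d_gt0 hd] : \forall y \near x, `|g x - g y| <= e.
  by move: (g_cont xr) => /(@cvgrPdist_le _ _ _ (nbhs x)); apply.
exists (Num.min d e); first by rewrite lt_min d_gt0.
move=> y; rewrite lt_min => /andP[h1 h2].
rewrite row_mxB norm_row_mx_le ?(ltW h2) // opprK addrC.
by apply: hd; rewrite -ball_normE /ball_ /= distrC.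
Qed.

Lemma extremal_continuous x s : t0 <= s <= T -> `|x - x0| <= r0 ->
  {for x, continuous (fun y => X (initial_phase y) s)}.
Proof.
move=> sab xr; apply/(@cvgrPdist_le _ _ _ (nbhs x)) => e e0.
have e1 : 0 < e / Kf by rewrite divr_gt0.
have [d d_gt0 hd] := initial_phase_continuous xr e1.
apply/nbhs_ballP; exists d => // y; rewrite -ball_normE /ball_ /= distrC => /hd h.
have -> : X (initial_phase x) s - X (initial_phase y) s = lsubmx (Phi (initial_phase x) s - Phi (initial_phase y) s).
  by rewrite linearB.
apply: le_trans (norm_lsubmx_le _) _; apply: le_trans (Phi_lip (initial_phase x) (initial_phase y) sab) _.
rewrite [X in _ * X]distrC; move: h; move: (`|_|) => v.
by rewrite ler_pdivlMr // mulrC.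
Qed.

Let V_cont x : `|x - x0| <= r0 -> {for x, continuous (V t0)}.
Proof. by move=> xr; exact/differentiable_continuous/V_diff. Qed.

(** Extremals issued from the points with a quadratic minorant are optimal, these
    points are dense, and both sides of the claim are continuous. *)
Lemma extremal_optimal x : `|x - x0| < r0 -> phi (X (initial_phase x) T) = V t0 x.
Proof.
move=> xr; have xr' := ltW xr.
pose f y := phi (X (initial_phase y) T) - V t0 y.
have Tab : t0 <= T <= T by rewrite t0T lexx.
have cf : {for x, continuous f}.
  apply: continuousB; last exact: V_cont.
  apply: (@continuous_comp _ _ _ (fun y => X (initial_phase y) T) phi).
    exact: extremal_continuous.
  exact: locally_lipschitz_continuous.
apply/eqP; rewrite -subr_eq0 -normr_le0; apply/ler_addgt0Pr => e e0; rewrite add0r.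
have /nbhs_ballP[d /= d_gt0 hd] : \forall y \near x, `|f x - f y| <= e.
  by move: cf => /(@cvgrPdist_le _ _ _ (nbhs x)); apply.
pose d1 := Num.min d (r0 - `|x - x0|).
have d10 : 0 < d1 by rewrite lt_min d_gt0 subr_gt0.
have d1d : d1 <= d by rewrite ge_min lexx.
have d1r : d1 <= r0 - `|x - x0| by rewrite ge_min lexx orbT.
clearbody d1.
have near y : `|y - x| <= d1 -> `|y - x0| <= r0.
  move=> h; have -> : y - x0 = (y - x) + (x - x0) by rewrite subrKA.
  by apply: le_trans (ler_normD _ _) _; lra.
have [|y yx hy] := @quadratic_minorant_dense R n (V t0) x d1 d10.
  by move=> y /near/V_diff.
have yx' : `|y - x| <= d1 by lra.
have [u [q tb]] := tubes (initial_phase_near (near y yx')).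
have fy : f y = 0.
  have := minorant_optimal Gam0 F_growth phi_lip t0T tb; rewrite Xc Pc opprK /f.
  by move=> /(_ hy) ->; rewrite subrr.
have := hd y; rewrite fy subr0; apply.
by rewrite -ball_normE /ball_ /= distrC; lra.
Qed.

Lemma extremal_value x s : `|x - x0| < r0 -> t0 <= s <= T ->
  V s (X (initial_phase x) s) = V t0 x.
Proof.
move=> xr sab; have [u [q tb]] := tubes (initial_phase_near (ltW xr)).
have := value_along Gam0 F_growth phi_lip t0T tb; rewrite Xc => /(_ (extremal_optimal xr)).
exact.
Qed.

Lemma extremal_grad x s : `|x - x0| < r0 -> t0 <= s <= T ->
  has_grad (V s) (X (initial_phase x) s) (- P (initial_phase x) s).
Proof.
move=> xr sab; have [u [q tb]] := tubes (initial_phase_near (ltW xr)).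
have := value_has_grad Gam0 F_growth phi_lip t0T tb; rewrite Xc Pc opprK.
move=> /(_ (extremal_optimal xr) s (phi_super _)); apply => //.
by apply: has_grad_lower; apply/has_gradP; split => //; exact: V_diff (ltW xr).
Qed.

Lemma value_lipschitz : exists2 L, 0 < L & forall x y, `|x - x0| <= r0 ->
  `|y - x0| <= r0 -> V t0 y - V t0 x <= L * `|y - x|.
Proof.
have G0 : 0 <= `|g x0| + d0.
  by rewrite addr_ge0 // (le_trans _ r0d0) // ltW.
exists (n%:R * (`|g x0| + d0) + 1); first by rewrite ltr_wpDl // mulr_ge0.
move=> x y hx hy.
have seg (t : R) : 0 <= t <= 1 -> `|x + t *: (y - x) - x0| <= r0.
  move=> /andP[t00 t1].
  have -> : x + t *: (y - x) - x0 = (1 - t) *: (x - x0) + t *: (y - x0).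
    by apply/rowP => i; rewrite !mxE; ring.
  apply: le_trans (ler_normD _ _) _; rewrite !normrZ (ger0_norm t00) ger0_norm ?subr_ge0 //.
  have h1 : (1 - t) * `|x - x0| <= (1 - t) * r0 by rewrite ler_wpM2l // subr_ge0.
  have h2 : t * `|y - x0| <= t * r0 by rewrite ler_wpM2l.
  by move: h1 h2; rewrite mulrBl mul1r; lra.
have [t t01|t t01] := @mvt_grad R n (V t0) x (y - x).
  exact: V_diff (seg t t01).
rewrite [x + (y - x)]addrC subrK => ->; apply: le_trans (ler_norm _) _.
apply: le_trans (dotv_abs_le _ _) _; rewrite ler_wpM2r //.
apply: (@le_trans _ _ (n%:R * (`|g x0| + d0))); last by rewrite lerDl.
rewrite ler_wpM2l //; have := g_near (seg t t01).
rewrite -/g; move: (g (x + t *: (y - x))) => v; have := ler_normD (v - g x0) (g x0); rewrite subrK; lra.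
Qed.

Section localisation.
Variable t : R.
Hypothesis tab : t0 <= t <= T.
Let t0t : t0 <= t. Proof. by case/andP: tab. Qed.
Let tT : t <= T. Proof. by case/andP: tab. Qed.
Let x0r : `|x0 - x0| < r0. Proof. by rewrite subrr normr0. Qed.
Let Xb := X (initial_phase x0).
Let Pb := P (initial_phase x0).
Let Vb : V t (Xb t) = V t0 x0.
Proof. exact: extremal_value. Qed.

Hypothesis V_lower : lower_quad (V t0) x0 (g x0).
Hypothesis phi_upper : upper_quad phi (Xb T) (- Pb T).

(** An arc ending near [Xb t], whose starting value is nearly the largest compatible
    with its end, starts near [x0]: the quadratic upper bound for [V t] at
    [Xb t] feeds [backward_close]. *)
Lemma backward_localisation : exists K r1, [/\ 1 <= K, 0 < r1 &
  forall y sg, traj F t0 t y -> 0 < sg -> sg <= r1 -> `|y t - Xb t| <= sg ->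
    V t (Xb t) - V t0 (y t0) - sg ^+ 2 <= dotv (Pb t) (y t - Xb t) ->
    `|y t0 - x0| <= K * sg].
Proof.
have [u [q tb]] := tubes (initial_phase_near (ltW x0r)).
have opt : phi (X (initial_phase x0) T) = V t0 (X (initial_phase x0) t0).
  by rewrite Xc; exact: extremal_optimal.
have [r1 [c [r10 c0 hV]]] := value_upper_quad Gam0 F_growth phi_lip t0T tb opt tab phi_upper.
have [r2 r20 hr2] := tube_dpp Gam0 F_growth phi_lip t0T tb.
have m0 : 0 < Num.min r1 r2 by rewrite lt_min r10.
have [h|K [r3 [K1 r30 hK]]] := backward_close t0t (tube_sub (lexx _) tT tb) m0 c0 (g := V t).
  by rewrite le_min => /andP[h1 _]; have := hV h h1; rewrite dotvNl.
exists K, r3; split => // y sg ty sg0 sgr hy hd.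
rewrite -{1}(Xc x0); apply: (hK y (V t0 (y t0)) sg ty sg0 sgr) => //; last by rewrite lexx t0t.
move=> z tz <-; rewrite le_min => /andP[_ h]; exact: hr2.
Qed.

(** The extremals separate linearly: backward localisation applied to the
    extremals themselves, which realise the values. *)
Lemma extremal_separation : exists K r1, [/\ 1 <= K, 0 < r1 & forall x,
  `|x - x0| < r1 -> `|x - x0| <= K * `|X (initial_phase x) t - Xb t|].
Proof.
have [K [r1 [K1 r10 hK]]] := backward_localisation.
have K0 : 0 < K by exact: lt_le_trans K1.
have [u [q tb]] := tubes (initial_phase_near (ltW x0r)).
have opt : phi (X (initial_phase x0) T) = V t0 (X (initial_phase x0) t0).
  by rewrite Xc; exact: extremal_optimal.
have := value_lower_quad Gam0 F_growth phi_lip t0T tb opt tab.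
rewrite Xc Pc opprK => /(_ V_lower)[r2 [c [r20 c0 hV]]].
have m0 : 0 < Num.min (r1 / (1 + c)) r2 / 2.
  by rewrite divr_gt0 // lt_min r20 divr_gt0 // ltr_pwDl.
have c1 : 0 < 1 + c by rewrite ltr_pwDl.
have x0r' := ltW x0r.
have /nbhs_ballP[d /= d_gt0 hd] : \forall y \near x0,
    `|Xb t - X (initial_phase y) t| <= Num.min (r1 / (1 + c)) r2 / 2.
  by move: (extremal_continuous tab x0r') => /(@cvgrPdist_le _ _ _ (nbhs x0)); apply.
exists (K * (1 + c)), (Num.min d r0); split.
- by rewrite mulr_ege1 // lerDl.
- by rewrite lt_min d_gt0.
move=> x; rewrite lt_min => /andP[xd xr].
have hx : `|X (initial_phase x) t - Xb t| <= Num.min (r1 / (1 + c)) r2 / 2.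
  by rewrite distrC; apply: hd; rewrite -ball_normE /ball_ /= distrC.
have {hx m0} : `|X (initial_phase x) t - Xb t| < Num.min (r1 / (1 + c)) r2 by lra.
rewrite lt_min ltr_pdivlMr // => /andP[hx1 hx2].
have [u' [q' tb']] := tubes (initial_phase_near (ltW xr)).
have tx := traj_sub (lexx _) tT (tube_traj tb').
have hVx := extremal_value xr tab.
set w := X (initial_phase x) t - Xb t in hx1 hx2 *.
have Ew : X (initial_phase x0) t + w = X (initial_phase x) t by rewrite addrC subrK.
have hV1 : V t (Xb t) - dotv (Pb t) w - c * `|w| ^+ 2 <= V t0 x.
  rewrite -hVx -Ew -(dotvNl (Pb t) w); exact: hV w (ltW hx2).
apply/ler_addgt0Pr => e e0.
have h (sg : R) : 0 < sg -> (1 + c) * `|w| <= sg -> sg <= r1 -> `|x - x0| <= K * sg.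
  move=> sg0 wsg sgr; rewrite -{1}(Xc x); apply: (hK _ _ tx sg0 sgr).
    apply: le_trans wsg; rewrite ler_peMl // lerDl //.
  rewrite -/w Xc.
  have : c * `|w| ^+ 2 <= sg ^+ 2.
    apply: (@le_trans _ _ (((1 + c) * `|w|) ^+ 2)); last first.
      have w0 : 0 <= (1 + c) * `|w| by rewrite mulr_ge0 // ltW.
      by rewrite ler_pXn2r // nnegrE ltW.
    by rewrite exprMn ler_wpM2r ?exprn_ge0 ?le_sqr1D.
  exact: drop_slack hV1.
pose sg := Num.min r1 ((1 + c) * `|w| + e / K).
have sg0 : 0 < sg by rewrite lt_min r10 ltr_wpDl ?mulr_ge0 ?divr_gt0 // ltW.
apply: le_trans (h sg sg0 _ _) _.
- by rewrite le_min mulrC ltW //= lerDl divr_ge0 // ltW.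
- by rewrite ge_min lexx.
apply: (@le_trans _ _ (K * ((1 + c) * `|w| + e / K))).
  by rewrite ler_pM2l // ge_min lexx orbT.
by rewrite mulrDr mulrA lerD2l mulrCA divff ?mulr1 // gt_eqF.
Qed.

Definition reaches (z x : 'rV[R]_n) : Prop :=
  exists y, [/\ traj F t0 t y, y t0 = x & y t = z].

(** Maximize [V t0 y - k |x - y|^2] over [y] near [x0] and [x] in the closure of the
    points steered to [z].  By [loc] the maximum is interior.  Optimality in [y] makes
    [2 k (x - y)] the costate at [y]; optimality in [x] says that the arcs steering
    points near [x] to [z] nearly maximize [- k |. - y|^2], whose gradient at [x] is
    the opposite of that costate, so by [forward_close] the extremal from [x] with
    this costate ends at [z]. *)
Lemma sup_convolution z r tau xh e : 0 < r -> r < r0 -> 0 < tau -> 0 < e ->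
  reaches z xh -> `|xh - x0| <= r ->
  (forall x, reaches z x -> `|x - x0| <= r -> V t0 xh - tau <= V t0 x ->
     `|x - x0| <= r / 4) ->
  exists2 y, `|y - x0| <= r & `|X (initial_phase y) t - z| <= e.
Proof.
move=> r_gt0 rr0 tau0 e0 xhz xhr loc.
have [L L0 hL] := value_lipschitz.
pose B := [set x : 'rV[R]_n | `|x - x0| <= r].
have Br x : B x -> `|x - x0| <= r0 by move=> Bx; exact: le_trans Bx (ltW rr0).
have cB : compact B by exact: norm_ball_compact.
have clB : closed B by apply: compact_closed => //; exact: norm_hausdorff.
pose S := [set x | reaches z x /\ `|x - x0| <= r].
have SA : S `<=` closure S by exact: subset_closure.
have AB : closure S `<=` B.
  by rewrite [B](closure_id _).1 //; apply: closure_subset => x [].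
have cA : compact (closure S).
  exact: (subclosed_compact (@closed_closure _ _) cB AB).
(* The penalty [k] will force the two components of the maximizer within [de]; the
   three bounds serve interiority, the conclusion and the hypothesis [loc]. *)
pose de := Num.min (r / 4) (Num.min (e / Kf) (tau / (2 * L))).
have de0 : 0 < de by rewrite !lt_min !divr_gt0 // mulr_gt0.
have [de1 de2 de3] : [/\ de <= r / 4, Kf * de <= e & 2 * (L * de) <= tau].
  have : de <= r / 4 by rewrite ge_min lexx.
  have : de <= e / Kf by rewrite !ge_min lexx !orbT.
  have : de <= tau / (2 * L) by rewrite !ge_min lexx !orbT.
  rewrite !ler_pdivlMr // ?mulr_gt0 // => h1 h2 h3; split => //.
    by rewrite mulrC.
  by rewrite mulrA mulrC.
clearbody de.
have [k k0 hk] : exists2 k, 0 < k & L * (2 * r) <= k * de ^+ 2.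
  exists (L * (2 * r) / de ^+ 2); first by rewrite divr_gt0 ?exprn_gt0 // !mulr_gt0.
  by rewrite divfK // gt_eqF // exprn_gt0.
pose Q (x : 'rV[R]_n) := k * dotv x x.
pose Psi (w : 'rV[R]_n * 'rV[R]_n) := V t0 w.2 - Q (w.1 - w.2).
have cPsi : {within closure S `*` B, continuous Psi}.
  apply: continuous_in_subspaceT => w; rewrite inE => -[_ Bw].
  have cV : {for w, continuous (fun w : 'rV[R]_n * 'rV[R]_n => V t0 w.2)}.
    apply: (@continuous_comp _ _ _ snd (V t0)); first exact: cvg_snd.
    exact: V_cont (Br _ Bw).
  exact: (continuousB cV (@sqr_dist_continuous R n k w)).
have Sxh : S xh by [].
have ne : closure S `*` B !=set0 by exists (xh, xh); split => //; exact: SA.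
have [[xm ym] + hm] := compact_EVT_max ne (compact_setX cA cB) cPsi.
rewrite inE => -[/= Axm Bym].
have {}hm x y : closure S x -> B y -> V t0 y - Q (x - y) <= V t0 ym - Q (xm - ym).
  by move=> Ax By; apply: (hm (x, y)); rewrite inE.
pose w := xm - ym.
have QD h h' : Q (h + h') = Q h + 2 * k * dotv h h' + Q h'.
  by rewrite /Q !(dotvDl, dotvDr) (dotvC h' h); ring.
have Qle h : Q h <= k * n%:R * `|h| ^+ 2.
  by rewrite /Q -mulrA ler_pM2l // dotv_sqr_le.
have hxh : V t0 xh + Q w <= V t0 ym.
  by have := hm xh xh (SA _ Sxh) xhr; rewrite /Q subrr dotv0r mulr0 subr0 -lerBrDr.
have nw : `|w| <= de.
  have h1 : k * `|w| ^+ 2 <= Q w by rewrite ler_pM2l // norm_sqr_le.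
  have h2 : `|ym - xh| <= 2 * r.
    have -> : ym - xh = (ym - x0) - (xh - x0) by rewrite opprB addrA subrK.
    by apply: le_trans (ler_normB _ _) _; rewrite mulr_natl mulr2n lerD.
  have h3 : V t0 ym - V t0 xh <= k * de ^+ 2.
    apply: le_trans (hL _ _ (Br _ xhr) (Br _ Bym)) _; apply: le_trans hk.
    by rewrite ler_pM2l.
  rewrite -(@ler_pXn2r R 2) ?nnegrE ?(ltW de0) // -(ler_pM2l k0).
  apply: le_trans h1 _; apply: le_trans h3; by rewrite lerBrDl.
have close d : 0 < d -> exists2 x, S x & `|x - xm| <= d.
  move=> d_gt0; have [x [Sx]] := Axm _ (nbhsx_ballx xm d d_gt0).
  by rewrite -ball_normE /ball_ /= distrC => /ltW h; exists x.
have xmr : `|xm - x0| <= r / 2.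
  have [x1 [x1z x1r] x1d] := close de de0.
  have h1 := hL _ _ (Br _ x1r) (Br _ (AB _ Axm)).
  have h2 := hL _ _ (Br _ (AB _ Axm)) (Br _ Bym).
  have h3 : `|x1 - x0| <= r / 4.
    apply: loc => //; apply: slack_tau hxh h1 h2 _ _ _ de3; rewrite ?ler_pM2l //.
    - by rewrite mulr_ge0 ?dotv_ge0 // ltW.
    - by rewrite distrC.
    - by rewrite distrC.
  have -> : xm - x0 = (x1 - x0) - (x1 - xm) by rewrite opprB [RHS]addrC addrA subrK.
  apply: le_trans (ler_normB _ _) _; apply: le_trans (lerD h3 x1d) _.
  exact: quarter2.
have ymr : `|ym - x0| + r / 4 <= r.
  have -> : ym - x0 = (xm - x0) - w by rewrite /w opprB [RHS]addrC addrA subrK.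
  apply: le_trans (lerD (ler_normB _ _) (lexx _)) _.
  by apply: quarter4 xmr _; exact: le_trans nw de1.
have r4 : 0 < r / 4 by rewrite divr_gt0.
have r2 : 0 < r / 2 by rewrite divr_gt0.
have kn0 : 0 <= k * n%:R by rewrite mulr_ge0 // ltW.
have gE : g ym = - (2 * k) *: w.
  apply: (@lower_upper_eq R n (V t0) ym).
    apply: has_grad_lower; apply/has_gradP; split => //; exact: V_diff (Br _ Bym).
  apply: upper_quad_grad; exists (r / 4), (k * n%:R); split => // h hr.
  have Bh : B (ym + h).
    rewrite /B /= addrAC; apply: le_trans (ler_normD _ _) _.
    by apply: le_trans ymr; rewrite lerD2l.
  have := hm xm (ym + h) Axm Bh; rewrite opprD addrA -/w QD.
  have := Qle (- h); rewrite normrN dotvZl dotvNr.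
  exact: slack_quad.
pose Z : 'rV[R]_(n + n) := row_mx xm (- g ym).
have xmr0 : `|xm - x0| <= r0.
  by rewrite (le_trans xmr) // (le_trans _ (ltW rr0)) // ler_pdivrMr // ler_peMr ?ltW // ltr1n.
have Zd : `|Z - initial_phase x0| <= d0.
  rewrite row_mxB norm_row_mx_le ?(le_trans xmr0) // -opprD normrN.
  exact: g_near (Br _ Bym).
have [u [q tb]] := tubes Zd.
have XZ : X Z t0 = xm by rewrite Xa row_mxKl.
have PZ : P Z t0 = (2 * k) *: w by rewrite Pa row_mxKr gE scaleNr opprK.
have zE : X Z t = z.
  apply/esym/eqP; rewrite -subr_eq0 -normr_le0; apply/ler_addgt0Pr => ep ep0; rewrite add0r.
  have [h hr|d d_gt0 hd] := forward_close t0t (tube_sub (lexx _) tT tb) r2 kn0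
      (f := fun x => - Q (x - ym)) _ ep0.
    rewrite XZ PZ dotvZl; cbv beta; rewrite [xm + h - ym]addrAC -/w (QD w h); have := Qle h; exact: slack_quad2.
  have m0 : 0 < Num.min d (r / 2) by rewrite lt_min d_gt0.
  have [x [[y [ty yx yz]] _]] := close _ m0; rewrite le_min => /andP[xd xr].
  have tt : t0 <= t <= t by rewrite lexx t0t.
  rewrite -yz; apply: (hd y ty _ _ t tt); first by rewrite XZ yx.
  move=> z' tz' z't; rewrite XZ => z'r.
  have Sz' : S (z' t0).
    split; first by exists z'; rewrite z't.
    have -> : z' t0 - x0 = (z' t0 - xm) + (xm - x0) by rewrite subrKA.
    by apply: le_trans (ler_normD _ _) _; rewrite [leRHS]splitr lerD.
  have := hm _ _ (SA _ Sz') Bym; rewrite lerD2l => h.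
  by apply: le_trans h _; rewrite lerDl ltW.
exists ym => //; rewrite -{1}zE.
have -> : X (initial_phase ym) t - X Z t = lsubmx (Phi (initial_phase ym) t - Phi Z t).
  by rewrite linearB.
apply: le_trans (norm_lsubmx_le _) _; apply: le_trans (Phi_lip (initial_phase ym) Z tab) _.
apply: le_trans de2; rewrite ler_pM2l // row_mxB subrr norm_row_mx0 distrC.
exact: nw.
Qed.

(** The point steered to [z] by the feedback has the value needed to apply
    [backward_localisation] to its competitors, hence [sup_convolution] to [z]; the
    extremals ending within [e] of [z] accumulate, by compactness, at one ending at
    [z]. *)
Lemma extremal_covering r : 0 < r -> exists2 eta, 0 < eta &
  forall z, `|z - Xb t| <= eta -> exists2 x, `|x - x0| <= r & X (initial_phase x) t = z.
Proof.
move=> r_gt0; pose r' := Num.min r (r0 / 2).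
have r'0 : 0 < r' by rewrite lt_min r_gt0 divr_gt0.
have r'r : r' <= r by rewrite ge_min lexx.
have r'r0 : r' < r0.
  by rewrite gt_min; apply/orP; right; rewrite ltr_pdivrMr // ltr_pMr // ltr1n.
clearbody r'.
have [K [r1 [K1 r10 hK]]] := backward_localisation.
have K0 : 0 < K by exact: lt_le_trans K1.
have [u [q tb]] := tubes (initial_phase_near (ltW x0r)).
have tt : t0 <= t <= t by rewrite t0t lexx.
have t0tt : t0 <= t0 <= t by rewrite t0t lexx.
have [K2 K21 hK2] := tube_feedback t0t (tube_sub (lexx _) tT tb).
have K20 : 0 < K2 by exact: lt_le_trans K21.
have rho0 := tube_rho tb.
have [r2 [c [r20 c0 hV]]] := V_lower.
have r4K : 0 < r' / (4 * K) by rewrite divr_gt0 // mulr_gt0.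
pose sg := Num.min r1 (r' / (4 * K)).
have sg0 : 0 < sg by rewrite lt_min r10.
have sgr1 : sg <= r1 by rewrite ge_min lexx.
have Ksg : K * sg <= r' / 4.
  have -> : r' / 4 = K * (r' / (4 * K)) by field; rewrite gt_eqF.
  by rewrite ler_pM2l // ge_min lexx orbT.
clearbody sg.
have tau0 : 0 < sg ^+ 2 / 2 by rewrite divr_gt0 // exprn_gt0.
(* [N] dominates the distance and the quadratic errors produced by the feedback. *)
pose N := 1 + K2 + c * K2 ^+ 2.
have cK : 0 <= c * K2 ^+ 2 by rewrite mulr_ge0 // exprn_ge0 // ltW.
have N1 : 1 <= N by rewrite /N -addrA lerDl addr_ge0 // ltW.
have NK : K2 <= N by rewrite /N addrAC lerDr addr_ge0.
have N0 : 0 < N by exact: lt_le_trans N1.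
pose m := Num.min (Num.min rho r2) (Num.min r' (Num.min sg (Num.min 1 (sg ^+ 2 / 2)))).
have m0 : 0 < m by rewrite !lt_min rho0 r20 r'0 sg0 ltr01 tau0.
exists (m / N); first by rewrite divr_gt0.
move=> z; set k := z - Xb t; rewrite ler_pdivlMr // mulrC => hk.
have hk2 : K2 * `|k| <= m by apply: le_trans hk; rewrite ler_wpM2r.
have hk1 : `|k| <= m by apply: le_trans hk; rewrite ler_peMl.
have [m1 m2 m3 m4] : [/\ m <= rho, m <= r2, m <= r' & m <= sg].
  by rewrite !ge_min !lexx !orbT.
have [m5 m6] : m <= 1 /\ m <= sg ^+ 2 / 2 by rewrite !ge_min !lexx !orbT.
have hkk : N * `|k| ^+ 2 <= sg ^+ 2 / 2.
  rewrite expr2 mulrA; apply: le_trans m6; apply: (@le_trans _ _ (m * `|k|)).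
    by rewrite ler_wpM2r.
  by rewrite ler_piMr ?(ltW m0) // (le_trans hk1).
have [y [ty yt hy]] := hK2 t k tt (le_trans hk2 m1).
have [] := hy t0 t0tt; rewrite (Xc x0) (Pc x0) => y1 y2.
have yz : y t = z by rewrite yt /k addrC subrK.
have yr : reaches z (y t0) by exists y.
have Vy : V t0 x0 - V t0 (y t0) - sg ^+ 2 / 2 <= dotv (Pb t) k.
  have := hV (y t0 - x0) (le_trans y1 (le_trans hk2 m2)).
  rewrite [x0 + (_ - _)]addrC subrK => h1.
  have h2 : c * `|y t0 - x0| ^+ 2 <= c * K2 ^+ 2 * `|k| ^+ 2.
    by rewrite -mulrA -exprMn ler_wpM2l // ler_pXn2r ?nnegrE ?mulr_ge0 // ltW.
  move: y2; rewrite dotvNl ler_norml => /andP[_ y2].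
  move: hkk; rewrite /N !mulrDl mul1r; exact: slack_value h1 h2 y2 (exprn_ge0 _ (normr_ge0 k)).
have yx0 : `|y t0 - x0| <= r' by rewrite (le_trans y1) // (le_trans hk2).
have approx e : 0 < e -> exists2 x, `|x - x0| <= r' & `|X (initial_phase x) t - z| <= e.
  move=> e0; apply: (sup_convolution r'0 r'r0 tau0 e0 yr yx0).
  move=> x [y' [ty' y'x y't]] xr hx; rewrite -y'x; apply: le_trans Ksg.
  apply: hK => //; rewrite y't -/k; first exact: le_trans hk1 m4.
  by rewrite Vb y'x; exact: slack_value2 Vy hx.
pose B := [set x : 'rV[R]_n | `|x - x0| <= r'].
have cf : {within B, continuous (fun x => `|X (initial_phase x) t - z|)}.
  apply: continuous_in_subspaceT => x; rewrite inE => Bx.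
  have cX := extremal_continuous tab (le_trans Bx (ltW r'r0)).
  have cXz : {for x, continuous (fun x => X (initial_phase x) t - z)}.
    by apply: continuousB cX _; exact: cst_continuous.
  exact: cvg_norm cXz.
have B0 : B !=set0 by exists x0; rewrite /B /= subrr normr0 ltW.
have [x Bx hx] := EVT_min_rV B0 (@norm_ball_compact _ _ x0 r') cf.
rewrite inE in Bx; exists x; first exact: le_trans Bx r'r.
apply/eqP; rewrite -subr_eq0 -normr_le0; apply/ler_addgt0Pr => e e0; rewrite add0r.
have [x' Bx' hx'] := approx e e0; apply: le_trans hx'; apply: hx.
by rewrite inE.
Qed.

End localisation.
End field_of_extremals.

(** * The Hessian along the arc *)
Section hessian_of_a_field.
Variables (R : realType) (n : nat) (f : 'rV[R]_n -> R).
Variables (x0 : 'rV[R]_n) (Xt Pt : 'rV[R]_n -> 'rV[R]_n) (A B : 'M[R]_n).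
Hypothesis Xt_sep : exists K r, [/\ 1 <= K, 0 < r & forall x, `|x - x0| < r ->
  `|x - x0| <= K * `|Xt x - Xt x0|].
Hypothesis Xt_cov : forall r, 0 < r -> exists2 eta, 0 < eta &
  forall z, `|z - Xt x0| <= eta -> exists2 x, `|x - x0| <= r & Xt x = z.
Hypothesis XPt_lin : forall e, 0 < e -> exists2 d, 0 < d & forall h, `|h| < d ->
  `|Xt (x0 + h) - Xt x0 - h *m A| <= e * `|h| /\
  `|Pt (x0 + h) - Pt x0 - h *m B| <= e * `|h|.
Hypothesis f_grad : exists2 r, 0 < r & forall x, `|x - x0| < r ->
  has_grad f (Xt x) (- Pt x).

(** The linear part inherits the separation of points, so it is injective. *)
Lemma separated_linear_unit : A \in unitmx.
Proof.
have [K [r [K1 r0 hK]]] := Xt_sep.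
have K0 : 0 < K by exact: lt_le_trans K1.
have K20 : 0 < (2 * K)^-1 by rewrite invr_gt0 mulr_gt0.
have [d d0 hd] := XPt_lin K20.
have ker (v : 'rV[R]_n) : v *m A = 0 -> v = 0.
  move=> vA; apply/eqP; rewrite -normr_eq0 eq_le normr_ge0 andbT leNgt.
  apply/negP => v0.
  have [m m0 mdr] : exists2 m : R, 0 < m & m < Num.min d r.
    have mm : 0 < Num.min d r by rewrite lt_min d0.
    by exists (Num.min d r / 2); [rewrite divr_gt0|rewrite ltr_pdivrMr // ltr_pMr // ltr1n].
  pose h : 'rV[R]_n := (m / `|v|) *: v.
  have nh : `|h| = m.
    rewrite normrZ gtr0_norm; last by rewrite divr_gt0.
    by rewrite divfK // gt_eqF.
  move: (mdr); rewrite -{1}nh.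
  rewrite lt_min => /andP[h1 h2].
  have hE : x0 + h - x0 = h by rewrite addrC addKr.
  have := hK (x0 + h); rewrite hE => /(_ h2) h3.
  have [h4 _] := hd h h1; rewrite -scalemxAl vA scaler0 subr0 in h4.
  have h5 : K * `|Xt (x0 + h) - Xt x0| <= K * ((2 * K)^-1 * `|h|) by rewrite ler_pM2l.
  have h6 : K * ((2 * K)^-1 * `|h|) = `|h| / 2 by field; rewrite gt_eqF.
  by have := le_trans h3 h5; rewrite h6 nh; lra.
rewrite -row_free_unit -kermx_eq0; apply/eqP/row_matrixP => i.
by rewrite row0; apply: ker; rewrite -row_mul mulmx_ker row0.
Qed.

(** Every [z] near [Xt x0] is [Xt (x0 + h)] with [|h| <= K |z - Xt x0|], so errors
    [o(|h|)] are [o(|z - Xt x0|)]: from [z - Xt x0 = h A + o(|h|)] and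
    [grad f z - grad f (Xt x0) = - h B + o(|h|)], eliminate [h]. *)
Lemma hessian_of_field : twice_differentiable f (Xt x0) /\
  hess f (Xt x0) = - (invmx A *m B)^T.
Proof.
have uA := separated_linear_unit.
have [K [r [K1 r0 hK]]] := Xt_sep; have [r1 r10 hr1] := f_grad.
have K0 : 0 < K by exact: lt_le_trans K1.
have gradE x : `|x - x0| < r1 -> differentiable f (Xt x) /\ grad f (Xt x) = - Pt x.
  by move=> /hr1/has_gradP.
have [C C0 hC] := mulmx_bounded (invmx A *m B).
have [|dg Jg] := @diff_of_eps R n n (grad f) (Xt x0) (- (invmx A *m B)).
  move=> e e0; have e10 : 0 < e / ((1 + C) * K).
    by rewrite divr_gt0 // mulr_gt0 // addr_gt0.
  have [d d0 hd] := XPt_lin e10.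
  have m0 : 0 < Num.min d (Num.min r r1) / 2 by rewrite divr_gt0 // !lt_min d0 r0.
  have [eta eta0 heta] := Xt_cov m0.
  exists eta => // k hk; have [|x hx xz] := heta (Xt x0 + k).
    by rewrite addrC addKr ltW.
  have : `|x - x0| < Num.min d (Num.min r r1) by lra.
  rewrite !lt_min => /and3P[hx1 hx2 hx3].
  have hxk : `|x - x0| <= K * `|k|.
    by have := hK x hx2; rewrite xz [Xt x0 + k]addrC addrK.
  have [_ gx] := gradE x hx3; have [|_ gx0] := gradE x0; first by rewrite subrr normr0.
  have [] := hd _ hx1; rewrite [x0 + _]addrC subrK gx0 -xz gx.
  have kE : k = Xt x - Xt x0 by rewrite xz [Xt x0 + k]addrC addrK.
  set h := x - x0; set o1 := Xt x - Xt x0 - h *m A; set o2 := Pt x - Pt x0 - h *m B.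
  move=> ho1 ho2.
  have kE' : k = h *m A + o1 by rewrite kE [RHS]addrC subrK.
  have -> : - Pt x - - Pt x0 - k *m - (invmx A *m B) = - o2 + o1 *m (invmx A *m B).
    rewrite mulmxN {1}kE' mulmxDl mulmxA mulmxK // /o2.
    by apply/rowP => i; rewrite !mxE; ring.
  apply: le_trans (ler_normD _ _) _; rewrite normrN.
  have h1 : e / ((1 + C) * K) * `|h| <= e / ((1 + C) * K) * (K * `|k|) by rewrite ler_pM2l.
  have h2 : C * `|o1| <= C * (e / ((1 + C) * K) * (K * `|k|)).
    by rewrite ler_pM2l // (le_trans ho1).
  apply: le_trans (lerD (le_trans ho2 h1) (le_trans (hC _) h2)) _.
  rewrite le_eqVlt; apply/orP; left; apply/eqP; field.
  by rewrite !gt_eqF // addr_gt0.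
split; last by rewrite /hess /jac Jg linearN.
split => //; have r120 : 0 < r1 / 2 by rewrite divr_gt0.
have [eta eta0 heta] := Xt_cov r120.
apply/nbhs_ballP; exists eta => // z; rewrite -ball_normE /ball_ /= distrC => /ltW hz.
have [x hx <-] := heta z hz; apply: (gradE x _).1; lra.
Qed.

End hessian_of_a_field.

Section differentials.
Variable R : realType.

Lemma chain_rule_eps n m k (Z : 'rV[R]_n -> 'rV[R]_m) (Psi : 'rV[R]_m -> 'rV[R]_k)
    (x : 'rV[R]_n) :
  differentiable Z x -> differentiable Psi (Z x) -> forall e, 0 < e ->
  exists2 r, 0 < r & forall h, `|h| < r ->
    `|Psi (Z (x + h)) - Psi (Z x) - h *m 'J Z x *m 'J Psi (Z x)| <= e * `|h|.
Proof.
move=> dZ dPsi e e0; have dc : differentiable (Psi \o Z) x by exact: differentiable_comp.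
have [r r0 hr] := diff_eps dc e0; exists r => // h hh.
have E : 'd Psi (Z x) ('d Z x h) = h *m 'J Z x *m 'J Psi (Z x).
  by rewrite -(deriveE _ dPsi) deriveEjacobian // -(deriveE _ dZ) deriveEjacobian.
by have := hr h hh; rewrite diff_comp //= E.
Qed.

Lemma C1_grad_continuous n (f : 'rV[R]_n -> R) (U : set 'rV[R]_n) x :
  C1_on U f -> U x -> {for x, continuous (grad f)}.
Proof.
move=> c1 Ux; apply/(@cvgrPdist_le _ _ _ (nbhs x)) => e e0.
have : \forall y \near x, forall i, `|grad f x 0 i - grad f y 0 i| <= e.
  apply: (@filter_forall _ _ _ (nbhs x)) => i; have [_ /(_ (delta_mx 0 i)) ci] := c1 x Ux.
  move: ci => /(@cvgrPdist_le _ _ _ (nbhs x))/(_ e e0); apply: filterS => y.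
  by rewrite !mxE.
apply: filterS => y hy; apply: norm_coordP; first exact: ltW.
by move=> i; move: (hy i); rewrite !mxE.
Qed.

Lemma jac_row_mx n (g : 'rV[R]_n -> 'rV[R]_n) (x : 'rV[R]_n) : differentiable g x ->
  differentiable (fun y => row_mx y (- g y)) x /\
  'J (fun y => row_mx y (- g y)) x = row_mx 1%:M (- 'J g x).
Proof.
move=> dg; apply: diff_of_eps => e e0; have [r r0 hr] := diff_near_eps dg e0.
exists r => // h hh; rewrite mul_mx_row mulmx1 mulmxN !row_mxB.
have -> : x + h - x - h = 0 by rewrite [x + h]addrC addrK subrr.
rewrite norm_row_0mx -normrN.
by have -> : - (- g (x + h) - - g x - - (h *m 'J g x)) = g (x + h) - g x - h *m 'J g x;
  [apply/rowP => i; rewrite !mxE; ring|exact: hr].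
Qed.

End differentials.

Section along_the_arc.
Local Opaque ham_field frozen_field.
Variables (R : realType) (n : nat) (T : R).
Variables (F : 'rV[R]_n -> set 'rV[R]_n) (phi : 'rV[R]_n -> R).
Variables (t0 : R) (x0 : 'rV[R]_n) (xb pb : R -> 'rV[R]_n).
Let H := hamiltonian F.
Let V := value T F phi.
Hypothesis hSH : SH F.
Hypothesis H_C2 : C2_on [set xp : 'rV[R]_n * 'rV[R]_n | xp.2 != 0]
  (fun xp => H xp.1 xp.2).
Hypothesis phi_lip : locally_lipschitz phi.
Hypothesis phi_super : forall z, superdiff phi z !=set0.
Hypothesis t0T : t0 <= T.
Hypothesis xb_opt : optimal T F phi t0 x0 xb.
Hypothesis pb_dual : dual_arc T F phi t0 xb pb.
Hypothesis pbT : (superdiff phi (xb T) `\ 0) (- pb T).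
Hypothesis V_C1 : exists2 U, nbhs x0 U & C1_on U (V t0).
Hypothesis V_twice : twice_differentiable (V t0) x0.
Hypothesis phi_sc : locally_semiconcave phi.

(** [W s] is the block row [(A s, B s)] of derivatives, at [x0], of the position and
    costate at time [s] of the extremal through [x]; [J s] is the Jacobian of the
    Hamiltonian field along the arc. *)
Lemma value_hessian_flow : exists (W : R -> 'M[R]_(n, n + n)) (J : R -> 'M[R]_(n + n)) (K : R),
  [/\ 0 < K, forall s (h : 'rV[R]_(n + n)), t0 <= s <= T -> `|h *m J s| <= K * `|h|,
      W t0 = row_mx 1%:M (- 'J (grad (V t0)) x0) &
      forall s, t0 <= s <= T -> [/\ is_derive s 1 W (W s *m J s),
        lsubmx (W s) \in unitmx,
        twice_differentiable (V s) (xb s) /\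
          hess (V s) (xb s) = - (invmx (lsubmx (W s)) *m rsubmx (W s))^T &
        [/\ Hxp H (xb s) (pb s) = (ulsubmx (J s))^T,
            Hpp H (xb s) (pb s) = (dlsubmx (J s))^T,
            Hxx H (xb s) (pb s) = - (ursubmx (J s))^T &
            Hpx H (xb s) (pb s) = - (drsubmx (J s))^T]]].
Proof.
have [Gam Gam0 F_growth] := SH_growth hSH.
have [sup_pT pT0] := pbT; have [xb_traj _] := xb_opt.
have xb0 : xb t0 = x0 by case: xb_traj.
have pbT0 : pb T != 0.
  by apply/eqP => E; apply: pT0; rewrite E oppr0.
have [Zb_lip Zb_dom Zb_field] := dual_arc_regular hSH H_C2 t0T xb_traj pb_dual pbT0.
set Zb := (fun s => row_mx (xb s) (pb s)) in Zb_lip Zb_dom Zb_field.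
have [r r0 field_lip] := ham_field_lip_tube H_C2 Zb_lip Zb_dom.
have [Phi [Phi_a Phi_der Phi_Zb [Kf Kf1 Phi_lip]]] :=
  flow_exists t0T Zb_lip r0 field_lip Zb_field.
have [C C1 tubeC] := flow_tube (SH_compact hSH) Gam0 F_growth H_C2 t0T Zb_lip r0 field_lip.
have Kf0 : 0 < Kf by exact: lt_le_trans Kf1.
pose d0 := r / 8 / Kf; have d00 : 0 < d0 by rewrite !divr_gt0.
have tubes0 Z : `|Z - Zb t0| <= d0 -> exists u q, tube F t0 T
    (fun s => lsubmx (Phi Z s)) (fun s => rsubmx (Phi Z s)) u q (r / 8) C.
  move=> hZ; have [|u hu] := tubeC (Phi Z) (Phi_der Z); last by exists u; eexists; exact: hu.
  move=> s sab; rewrite -(Phi_Zb s sab); apply: le_trans (Phi_lip Z (Zb t0) s sab) _.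
  by rewrite mulrC -ler_pdivlMr.
have t0ab : t0 <= t0 <= T by rewrite lexx.
have Tab : t0 <= T <= T by rewrite t0T lexx.
have Xb s : t0 <= s <= T -> lsubmx (Phi (Zb t0) s) = xb s.
  by move=> sab; rewrite Phi_Zb // row_mxKl.
have Pb s : t0 <= s <= T -> rsubmx (Phi (Zb t0) s) = pb s.
  by move=> sab; rewrite Phi_Zb // row_mxKr.
have [V_near V_hess] := V_twice.
have V_diff0 : differentiable (V t0) x0 by exact: nbhs_singleton V_near.
(* The supergradient of the cost, carried back to [t0], meets the gradient. *)
have pb0 : - pb t0 = grad (V t0) x0.
  apply/esym/(@lower_upper_eq R n (V t0) x0).
    by apply: has_grad_lower; apply/has_gradP.
  have [|u [q tb]] := tubes0 (Zb t0); first by rewrite subrr normr0 ltW.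
  have := value_upper_grad Gam0 F_growth phi_lip t0T tb _ t0ab.
  rewrite (Xb T Tab) (Xb t0 t0ab) (Pb T Tab) (Pb t0 t0ab) xb0; apply.
    exact: (optimal_value Gam0 F_growth phi_lip).
  exact: superdiff_upper_grad.
have Zb0 : Zb t0 = initial_phase F phi T t0 x0 by rewrite /Zb /initial_phase -pb0 opprK xb0.
have V_upper : upper_quad phi (lsubmx (Phi (initial_phase F phi T t0 x0) T))
    (- rsubmx (Phi (initial_phase F phi T t0 x0) T)).
  rewrite -Zb0 (Xb T Tab) (Pb T Tab).
  by apply: semiconcave_quadratic => //; exact: superdiff_upper_grad.
have V_lower := twice_differentiable_lower_quad V_twice.
rewrite Zb0 in tubes0.
have [U /nbhs_ballP[rU /= rU0 hU] V_C1U] := V_C1.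
have Ux0 : U x0 by apply: hU; exact: ballxx.
have /nbhs_ballP[rg /= rg0 hg] : \forall y \near x0,
    `|grad (V t0) x0 - grad (V t0) y| <= d0.
  by move: (C1_grad_continuous V_C1U Ux0) => /(@cvgrPdist_le _ _ _ (nbhs x0)); apply.
have [r1 [r10 r1d r1U r1g]] : exists r1 : R, [/\ 0 < r1, r1 <= d0, r1 < rU & r1 < rg].
  have m0 : 0 < Num.min d0 (Num.min rU rg) by rewrite !lt_min d00 rU0.
  exists (Num.min d0 (Num.min rU rg) / 2); split; first by rewrite divr_gt0.
  - have : Num.min d0 (Num.min rU rg) <= d0 by rewrite ge_min lexx.
    by move: m0; move: (Num.min _ _) => m m0; lra.
  - have : Num.min d0 (Num.min rU rg) <= rU by rewrite !ge_min lexx !orbT.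
    by move: m0; move: (Num.min _ _) => m m0; lra.
  - have : Num.min d0 (Num.min rU rg) <= rg by rewrite !ge_min lexx !orbT.
    by move: m0; move: (Num.min _ _) => m m0; lra.
have inU x : `|x - x0| <= r1 -> U x.
  by move=> h; apply: hU; rewrite -ball_normE /ball_ /= distrC (le_lt_trans h).
have V_diff x : `|x - x0| <= r1 -> differentiable (V t0) x.
  by move=> /inU/V_C1U[].
have g_cont x : `|x - x0| <= r1 -> {for x, continuous (grad (V t0))}.
  by move=> /inU; exact: C1_grad_continuous.
have g_near x : `|x - x0| <= r1 -> `|grad (V t0) x - grad (V t0) x0| <= d0.
  move=> h; rewrite distrC; apply: hg.
  by rewrite -ball_normE /ball_ /= distrC (le_lt_trans h).
have [Lam [Lam_a Lam_der]] := linear_flow_exists H_C2 t0T Zb_lip Zb_dom r0 field_lip.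
have [L [L_a L_der L_lin]] := flow_matrix H_C2 t0T Zb_lip Zb_dom r0 field_lip
  Zb_field Lam_a Lam_der Phi_a Phi_der Phi_Zb Kf1 Phi_lip.
(* The derivative at [x0] of the initial data [(x, - grad (V t0) x)]. *)
pose D0 : 'M[R]_(n, n + n) := row_mx 1%:M (- 'J (grad (V t0)) x0).
exists (fun s => D0 *m L s), (fun s => 'J (ham_field H) (Zb s)), r^-1; split.
- by rewrite invr_gt0.
- by move=> s h sab; exact: (jacobian_bound H_C2 Zb_dom r0 field_lip).
- by rewrite L_a mulmx1.
move=> s sab.
have [dZx JZx] := jac_row_mx V_hess.
have lin e : 0 < e -> exists2 d, 0 < d & forall h, `|h| < d ->
    `|Phi (initial_phase F phi T t0 (x0 + h)) s - Phi (initial_phase F phi T t0 x0) s - h *m (D0 *m L s)|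
      <= e * `|h|.
  have [|dP JP] := @diff_of_eps R (n + n) (n + n) (Phi^~ s) (initial_phase F phi T t0 x0) (L s).
    move=> e' /L_lin[d d_gt0 hd]; exists d => // h /hd/(_ s sab).
    by rewrite -Zb0 Phi_Zb.
  move=> e0; have [d d_gt0 hd] := chain_rule_eps dZx dP e0; exists d => // h hh.
  by have := hd h hh; rewrite JZx JP -mulmxA.
have sep := extremal_separation Gam0 F_growth phi_lip t0T Phi_a Kf1 Phi_lip tubes0
  r10 r1d V_diff g_cont g_near sab V_lower V_upper.
have cov := extremal_covering Gam0 F_growth phi_lip t0T Phi_a Kf1 Phi_lip tubes0
  r10 r1d V_diff g_cont g_near sab V_lower V_upper.
have lin2 e : 0 < e -> exists2 d, 0 < d & forall h, `|h| < d ->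
  `|lsubmx (Phi (initial_phase F phi T t0 (x0 + h)) s) - lsubmx (Phi (initial_phase F phi T t0 x0) s)
     - h *m lsubmx (D0 *m L s)| <= e * `|h| /\
  `|rsubmx (Phi (initial_phase F phi T t0 (x0 + h)) s) - rsubmx (Phi (initial_phase F phi T t0 x0) s)
     - h *m rsubmx (D0 *m L s)| <= e * `|h|.
  move=> /lin[d d_gt0 hd]; exists d => // h /hd.
  rewrite mulmx_lsub mulmx_rsub -!linearB /= => hh.
  by split; apply: le_trans hh; [exact: norm_lsubmx_le|exact: norm_rsubmx_le].
have gr : exists2 r2, 0 < r2 & forall x, `|x - x0| < r2 -> has_grad (V s)
    (lsubmx (Phi (initial_phase F phi T t0 x) s)) (- rsubmx (Phi (initial_phase F phi T t0 x) s)).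
  exists r1 => // x hx; exact: (extremal_grad Gam0 F_growth phi_lip phi_super t0T
    Phi_a Kf1 Phi_lip tubes0 r1d V_diff g_cont g_near hx sab).
pose Xs x := lsubmx (Phi (initial_phase F phi T t0 x) s).
pose Ps x := rsubmx (Phi (initial_phase F phi T t0 x) s).
split.
- have := der_mulmx (is_derive_cst D0 s 1) (L_der s sab).
  by rewrite mul0mx add0r mulmxA.
- exact: (@separated_linear_unit _ _ _ Xs Ps _ _ sep lin2).
- by have := @hessian_of_field _ _ _ _ Xs Ps _ _ sep cov lin2 gr; rewrite /Xs -Zb0 (Xb s sab).
- have pn : pb s != 0 by have := Zb_dom s sab; rewrite /ham_dom /= row_mxKr.
  exact: (ham_jacobians H_C2 (xb s) pn).
Qed.

End along_the_arc.

Theorem corollary4p2 (R : realType) (n : nat) (T : R)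
    (F : 'rV[R]_n -> set 'rV[R]_n) (phi : 'rV[R]_n -> R)
    (t0 : R) (x0 : 'rV[R]_n) (xb pb : R -> 'rV[R]_n)
    (H := hamiltonian F) (V := value T F phi) :
  SH F ->
  C2_on [set xp : 'rV[R]_n * 'rV[R]_n | xp.2 != 0] (fun xp => H xp.1 xp.2) ->
  locally_lipschitz phi ->
  (forall z, superdiff phi z !=set0) ->
  t0 <= T ->
  optimal T F phi t0 x0 xb ->
  superdiff phi (xb T) <> [set 0] ->
  dual_arc T F phi t0 xb pb ->
  (superdiff phi (xb T) `\ 0) (- pb T) ->
  (exists2 U, nbhs x0 U & C1_on U (V t0)) ->
  twice_differentiable (V t0) x0 ->
  locally_semiconcave phi ->
  (exists Q, riccati_solution t0 T H xb pb (- hess (V t0) x0) Q) /\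
  (forall Q, riccati_solution t0 T H xb pb (- hess (V t0) x0) Q ->
     forall t, t0 <= t <= T ->
       twice_differentiable (V t) (xb t) /\ Q t = - hess (V t) (xb t)).
Proof.
move=> hSH H_C2 phi_lip phi_super t0T opt _ dual pbT V_C1 V_twice phi_sc.
have [W [J [K [K0 J_bound W0 hW]]]] := value_hessian_flow hSH H_C2 phi_lip
  phi_super t0T opt dual pbT V_C1 V_twice phi_sc.
have W_der s : t0 <= s <= T -> is_derive s 1 W (W s *m J s) by move=> /hW[].
have A_unit s : t0 <= s <= T -> lsubmx (W s) \in unitmx by move=> /hW[].
have t0ab : t0 <= t0 <= T by rewrite lexx.
have Q0 : - hess (V t0) x0 =
    ((\det (lsubmx (W t0)))^-1 *: (\adj (lsubmx (W t0)) *m rsubmx (W t0)))^T.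
  rewrite (riccati_quotientE A_unit t0ab) W0 row_mxKl row_mxKr invmx1 mul1mx.
  by rewrite linearN.
have coef s : t0 <= s <= T ->
    [/\ Hxp H (xb s) (pb s) = (ulsubmx (J s))^T, Hpp H (xb s) (pb s) = (dlsubmx (J s))^T,
        Hxx H (xb s) (pb s) = - (ursubmx (J s))^T &
        Hpx H (xb s) (pb s) = - (drsubmx (J s))^T] by move=> /hW[].
split.
  by eexists; rewrite Q0; exact: (riccati_quotient_solution W_der A_unit coef).
move=> Q hQ t tab; rewrite Q0 in hQ; have [_ _ [td hE] _] := hW t tab.
split; first exact: td.
by rewrite hE opprK; exact: (riccati_unique W_der A_unit coef K0 J_bound hQ tab).
Qed.
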